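(* Let $G$ be a connected outerplanar graph with $n$ vertices. If $n\ge48$ is even, then $$\rho_2(G)\le\rho_2\Big(\big\{(K_1\vee P_{\frac{n-2}2})^{(1)}\cup(K_1\vee P_{\frac{n-2}2})^{(2)}\big\}+v_1^{(1)}v_1^{(2)}\Big),$$ where $(K_1\vee P_{\frac{n-2}2})^{(1)}$ and $(K_1\vee P_{\frac{n-2}2})^{(2)}$ are two copies of $K_1\vee P_{\frac{n-2}2}$, and $P^{(i)}_{\frac{n-2}2}=v_1^{(i)}v_2^{(i)}\cdots v^{(i)}_{\frac{n-2}2}$ for $i=1,2$. Equality holds if and only if, up to isomorphism, $G\cong\big\{(K_1\vee P_{\frac{n-2}2})^{(1)}\cup(K_1\vee P_{\frac{n-2}2})^{(2)}\big\}+v_1^{(1)}v_1^{(2)}$.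
   Context: All graphs are finite, simple and undirected. $\rho_2(G)$ is the second largest eigenvalue of the adjacency matrix of $G$. $P_k$ is the path on $k$ vertices and $G\vee H$ is the join of $G$ and $H$. $\{H_1\cup H_2\}+uv$ denotes the graph obtained from the disjoint union $H_1\cup H_2$ by adding the edge $uv$ with $u\in V(H_1)$, $v\in V(H_2)$. Here the added edge joins an endpoint $v_1^{(1)}$ of the path in the first copy to an endpoint $v_1^{(2)}$ of the path in the second copy. *)

(* Defs.v *)
From HB Require Import structures.
From mathcomp Require Import all_boot all_order all_algebra.
From mathcomp Require Import all_classical all_reals all_analysis.
Set Implicit Arguments.
Unset Strict Implicit.
Unset Printing Implicit Defensive.
Import Order.TTheory GRing.Theory Num.Theory.
Import numFieldNormedType.Exports.
Local Open Scope classical_set_scope.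
Local Open Scope ring_scope.

Record sgraph := SGraph {
  vertex :> finType;
  edge : rel vertex;
  edge_sym : symmetric edge;
  edge_irrefl : irreflexive edge }.

Definition connected_graph (G : sgraph) : Prop :=
  (0 < #|G|)%N /\ forall x y : G, connect (@edge G) x y.

Definition isomorphic (G H : sgraph) : Prop :=
  exists2 f : G -> H, bijective f & forall x y, edge (f x) (f y) = edge x y.

Definition adjacency (R : realType) (G : sgraph) : 'M[R]_#|G| :=
  \matrix_(i, j) (edge (enum_val i) (enum_val j))%:R.

(* The eigenvalues with multiplicity, in nonincreasing order.  Such a list is
   unique, and exists as soon as [A] is symmetric; [[::]] is a junk value. *)
Definition spectrum (R : realType) (n : nat) (A : 'M[R]_n) : seq R :=
  xget [::] [set s : seq R | sorted >=%R s /\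
                             char_poly A = \prod_(x <- s) ('X - x%:P)].

(* Counting from 0, index 1 is the second largest eigenvalue. *)
Definition rho2 (R : realType) (G : sgraph) : R :=
  (spectrum (adjacency R G))`_1.

Section Constructions.

Definition complete_rel (k : nat) : rel 'I_k := fun i j => i != j.

Fact complete_sym k : symmetric (@complete_rel k).
Proof. by move=> i j; rewrite /complete_rel eq_sym. Qed.

Fact complete_irrefl k : irreflexive (@complete_rel k).
Proof. by move=> i; rewrite /complete_rel eqxx. Qed.

Definition complete_graph k := SGraph (@complete_sym k) (@complete_irrefl k).

Definition path_rel (k : nat) : rel 'I_k :=
  fun i j => (i.+1 == j :> nat) || (j.+1 == i :> nat).

Fact path_sym k : symmetric (@path_rel k).
Proof. by move=> i j; rewrite /path_rel orbC. Qed.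

Fact path_irrefl k : irreflexive (@path_rel k).
Proof. by move=> i; rewrite /path_rel orbb gtn_eqF. Qed.

Definition path_graph k := SGraph (@path_sym k) (@path_irrefl k).

Variables G H : sgraph.

Definition join_rel : rel (G + H) := fun p q =>
  match p, q with
  | inl x, inl y => edge x y
  | inr x, inr y => edge x y
  | _, _ => true
  end.

Fact join_sym : symmetric join_rel.
Proof. by move=> [x|x] [y|y] //=; rewrite edge_sym. Qed.

Fact join_irrefl : irreflexive join_rel.
Proof. by move=> [x|x] /=; rewrite edge_irrefl. Qed.

Definition join := SGraph join_sym join_irrefl.

Definition union_edge_rel (u : G) (v : H) : rel (G + H) := fun p q =>
  match p, q with
  | inl x, inl y => edge x y
  | inr x, inr y => edge x y
  | inl x, inr y => (x == u) && (y == v)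
  | inr y, inl x => (x == u) && (y == v)
  end.

Fact union_edge_sym u v : symmetric (union_edge_rel u v).
Proof. by move=> [x|x] [y|y] //=; rewrite edge_sym. Qed.

Fact union_edge_irrefl u v : irreflexive (union_edge_rel u v).
Proof. by move=> [x|x] /=; rewrite edge_irrefl. Qed.

(* {G ∪ H} + uv *)
Definition union_edge u v :=
  SGraph (union_edge_sym u v) (union_edge_irrefl u v).

End Constructions.

(* K_1 ∨ P_m *)
Definition fan (m : nat) : sgraph := join (complete_graph 1) (path_graph m).

Definition fan_path (m : nat) (i : 'I_m) : fan m := inr i.

Section Outerplanarity.
Variables (R : realType) (G : sgraph).

(* [c x y] is a parametrization over [0, 1], from [p x] to [p y], of the curve
   representing the edge xy; its values are irrelevant when xy is not an edge. *)
Record plane_drawing (p : G -> R * R) (c : G -> G -> R -> R * R) : Prop := {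
  drawing_vertex_inj : injective p;
  drawing_continuous : forall x y, edge x y ->
    {within `[0, 1], continuous (c x y)};
  drawing_simple : forall x y, edge x y ->
    {in `[0, 1] &, injective (c x y)};
  drawing_ends : forall x y, edge x y -> c x y 0 = p x /\ c x y 1 = p y;
  drawing_undirected : forall x y, edge x y ->
    c x y @` `[0, 1] = c y x @` `[0, 1];
  drawing_avoids_vertices : forall x y z, edge x y ->
    ~ (c x y @` `]0, 1[) (p z);
  drawing_no_crossing : forall x y x' y', edge x y -> edge x' y' ->
    [set x; y]%SET != [set x'; y']%SET ->
    c x y @` `]0, 1[ `&` c x' y' @` `]0, 1[ = set0 }.

Definition drawing_support (p : G -> R * R) (c : G -> G -> R -> R * R) :
    set (R * R) :=
  range p `|` [set q | exists x y, edge x y /\ (c x y @` `[0, 1]) q].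

Definition frontier (F : set (R * R)) : set (R * R) := closure F `\` F°.

Definition face (D F : set (R * R)) : Prop :=
  exists2 q, (~` D) q & F = connected_component (~` D) q.

(* Some crossing-free drawing in the plane has every vertex on the boundary of
   its outer (unbounded) face. *)
Definition outerplanar : Prop :=
  exists p c, plane_drawing p c /\
    exists F, [/\ face (drawing_support p c) F, ~ bounded_set F &
                  forall x, frontier F (p x)].

End Outerplanarity.

(* Main.v *)
(* An outerplanar drawing extends by curves from a point q of the outer face to all
   vertices.  These curves may cross each other, but the mod 2 count behind the
   non-planarity of K_{3,3} and K_5 only involves pairs of independent edges; so an
   outerplanar graph contains no subdivision of K_{2,3} or K_4, as adding q would
   give one of K_{3,3} or K_5.  The count is made on fine chains p_i, q_j along
   disjoint compact curves, through the signs of the differences p_i - q_j.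

   Let k = (n-2)/2, and let rho be the largest eigenvalue, with eigenvector y, of
   A - e e^T, where A is the adjacency matrix of the fan on k+1 = n/2 vertices and
   e the unit vector at an end of its path.  Then (y, -y) is an eigenvector of the
   extremal graph H, so rho <= rho_2(H).  Suppose rho <= rho_2(G); then G has an
   eigenvector x of both signs, with an eigenvalue l >= rho.  Each of the vertex sets
   {x > 0}, {x < 0} carries a subgraph with largest eigenvalue at least l, and one
   has at most n/2 vertices.  Counting walks of length 2 from a vertex of largest
   weight shows that such a subgraph has n/2 vertices and is a fan; so both are
   fans, and G is two fans with linking edges.  For a linking edge uv with
   |x_u| <= |x_v|, the Rayleigh quotient for A - e_u e_u^T of the part of x that
   contains u is at least l, while the largest eigenvalue of A - e_u e_u^T is at
   most rho, with equality only at path ends.  Equality throughout makes u and v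
   path ends and uv the only linking edge. *)
Require Import Defs.
From Stdlib Require Import Btauto.
From mathcomp Require Import all_boot all_order all_algebra.
From mathcomp Require Import all_classical all_reals all_analysis.
From mathcomp Require Import complex ring lra zify.
Set Implicit Arguments.
Unset Strict Implicit.
Unset Printing Implicit Defensive.
Import Order.TTheory GRing.Theory Num.Theory.
Import numFieldNormedType.Exports.
Local Open Scope classical_set_scope.
Local Open Scope ring_scope.


(** * Crossing parity and non-planarity *)

(** The edges of a drawing are arbitrary continuous curves. Chains finer than the mutual distance of
    disjoint curves turn non-planarity into a finite identity mod 2. The constants meet in the bound
    k <= l^2 - 2l + 7/(2l). Let u be a vertex of largest weight in a sign part with eigenvalue l,
    and N its neighbourhood there. After multiplication by l, the walk count loses at least 2
    because N spans a forest, and more than 3/2 if some vertex is not a neighbour of u; as 7/2 = 2 +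
    3/2, there is no such vertex. As 7/2 < 4 and degree sums are even, the loss in N is exactly 2,
    so that N spans a path. In the extremal fan, the two path ends and the weight -1 cost about 3,
    and at most 7/2 once the eigenvalue is at least 11/2. The margin 3/2 requires l > 23/4; it is n
    >= 48, that is k >= 23, that gives rho >= 29/5. *)

Section CrossingParity.
Variable R : realType.
Implicit Types (u v p q : R * R) (s : seq (R * R)).

(* One of [u], [- u] is [upper] for [u != 0], so reversing a chain of differences
   that avoids 0 changes the sides of its ends and nothing else. *)
Definition upper u := (0 < u.2) || ((u.2 == 0) && (0 < u.1)).

(* does a short step from [u] to [v] cross the positive horizontal half line *)
Definition crosses u v := xorb (upper u) (upper v) && (0 < u.1).

(** A winding number around [p] reduced mod 2: crossings of the half line from [p] to the right are
    counted along the chain [q :: s], closed or not. *)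
Fixpoint winding p q s :=
  if s is r :: s' then xorb (crosses (q - p) (r - p)) (winding p r s') else false.

Definition near_pt (e : R) p q := (`|p.1 - q.1| < e) && (`|p.2 - q.2| < e).
Definition far_pt (e : R) p q := (4 * e <= `|p.1 - q.1|) || (4 * e <= `|p.2 - q.2|).

Lemma upper_opp e p q : 0 < e -> far_pt e p q -> upper (q - p) = ~~ upper (p - q).
Proof.
case: p q => [x y] [z t] e0; rewrite /far_pt /upper /= => f.
rewrite -[z - x]opprB -[t - y]opprB oppr_gt0 oppr_eq0.
case: (ltgtP (y - t) 0) => [h|h|h] //=.
rewrite oppr_gt0; case: (ltgtP (x - z) 0) => [//|//|h'].
by move: f; rewrite h h' !normr0 leNgt mulr_gt0.
Qed.

(* The four differences vary by less than [2 * e], and one of their coordinates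
   has size at least [2 * e] throughout: they all lie in one open half plane. *)
Lemma crossing_cell e p p' q q' : near_pt e p p' -> near_pt e q q' ->
  far_pt e p q -> far_pt e p q' -> far_pt e p' q -> far_pt e p' q' ->
  xorb (xorb (crosses (p - q) (p' - q)) (crosses (p - q') (p' - q')))
       (xorb (crosses (q - p) (q' - p)) (crosses (q - p') (q' - p'))) =
  xorb (xorb (upper (p - q)) (upper (p' - q)))
       (xorb (upper (p - q')) (upper (p' - q'))).
Proof.
case: p p' q q' => [a b] [a' b'] [c d] [c' d'].
rewrite /near_pt /crosses /= => /andP[ha hb] /andP[hc hd] f1 f2 f3 f4.
have e0 : 0 < e by apply: le_lt_trans ha.
have upN x y z t (f : far_pt e (x, y) (z, t)) := upper_opp e0 f.
rewrite (upN a b c d) // (upN a b c' d') // (upN a' b' c d) // (upN a' b' c' d') //.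
have U x y z t : 0 < y - t -> upper ((x, y) - (z, t)) = true.
  by rewrite /upper /= => ->.
have L x y z t : y - t < 0 -> upper ((x, y) - (z, t)) = false.
  by rewrite /upper /= => h; rewrite (lt_gtF h) (lt_eqF h).
(* Case of a half plane to the left or right: either only the terms in [p - q] or only those in
   [q - p] count, and by [upN] both kinds add up to the right-hand side. *)
have X : (0 < a - c) = (0 < a - c') -> 
         (0 < c - a) = ~~ (0 < a - c) -> (0 < c - a') = ~~ (0 < a - c) ->
  xorb (xorb (xorb (upper ((a, b) - (c, d))) (upper ((a', b') - (c, d))) && (0 < a - c))
     (xorb (upper ((a, b) - (c', d'))) (upper ((a', b') - (c', d'))) && (0 < a - c')))
    (xorb (xorb (~~ upper ((a, b) - (c, d))) (~~ upper ((a, b) - (c', d'))) && (0 < c - a))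
     (xorb (~~ upper ((a', b') - (c, d))) (~~ upper ((a', b') - (c', d'))) && (0 < c - a'))) =
  xorb (xorb (upper ((a, b) - (c, d))) (upper ((a', b') - (c, d))))
    (xorb (upper ((a, b) - (c', d'))) (upper ((a', b') - (c', d')))).
  move=> <- -> ->; btauto.
move: ha hb hc hd; rewrite !ltr_norml => /andP[a1 a2] /andP[b1 b2] /andP[c1 c2] /andP[d1 d2].
have Y : `|b - d| < 2 * e -> 
  (0 < a - c) = (0 < a - c') /\ (0 < c - a) = ~~ (0 < a - c) /\ (0 < c - a') = ~~ (0 < a - c).
  move=> hy; have {}hx : 4 * e <= `|a - c| by move: f1; rewrite /far_pt /= => /orP[//|h]; lra.
  move: hx; rewrite ler_normr => /orP[h|h].
    by split; [|split]; apply/idP/idP; rewrite -?leNgt; clear - h a1 a2 c1 c2 e0; lra.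
  by split; [|split]; apply/idP/idP; rewrite -?leNgt; clear - h a1 a2 c1 c2 e0; lra.
(* If the second coordinate has size at least [2 * e], all four differences are on one side and
   every term vanishes; if not, the first has size at least [4 * e]. *)
have [hy|/Y[h1 [h2 h3]]] := lerP (2 * e) `|b - d|; last exact: X.
move: hy; rewrite ler_normr => /orP[h|h].
  by rewrite !U //=; clear - h b1 b2 d1 d2 e0; lra.
by rewrite !L //=; clear - h b1 b2 d1 d2 e0; lra.
Qed.

Definition fine_chain e p s := path (near_pt e) p s.
Definition far_chains e p s q t := all (fun x => all (far_pt e x) (q :: t)) (p :: s).

(** [crossing_cell] is summed over the steps of the first chain, and [winding_pair] sums the result
    over those of the second: in the grid of pairs p_i, q_j the inner grid lines occur twice and
    cancel, which leaves the four sides and the four corners. *)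
Lemma winding_strip e p s q q' : fine_chain e p s -> near_pt e q q' ->
  all (fun x => far_pt e x q && far_pt e x q') (p :: s) ->
  xorb (xorb (winding q p s) (winding q' p s))
       (xorb (crosses (q - p) (q' - p)) (crosses (q - last p s) (q' - last p s))) =
  xorb (xorb (upper (p - q)) (upper (p - q')))
       (xorb (upper (last p s - q)) (upper (last p s - q'))).
Proof.
elim: s p => [|p' s IHs] p /=.
  by move=> _ _ _; btauto.
move=> /andP[pp' ss] qq' /and3P[/andP[f1 f2] /andP[f3 f4] fs].
have := IHs p' ss qq'; rewrite /= f3 f4 => /(_ fs) E1.
have E2 := crossing_cell pp' qq' f1 f2 f3 f4.
have : forall x y z t : bool, x = y -> z = t -> xorb x z = xorb y t by move=> x y z t -> ->.
move=> /(_ _ _ _ _ E1 E2).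
set l := last p' s.
have M : forall x y z t : bool, xorb (xorb x y) (xorb z t) = false -> x = y -> z = t.
  by move=> [] [] [] [].
apply: M; btauto.
Qed.

Lemma winding_pair e p s q t : fine_chain e p s -> fine_chain e q t ->
  far_chains e p s q t ->
  xorb (xorb (winding q p s) (winding (last q t) p s))
       (xorb (winding p q t) (winding (last p s) q t)) =
  xorb (xorb (upper (p - q)) (upper (p - last q t)))
       (xorb (upper (last p s - q)) (upper (last p s - last q t))).
Proof.
move=> ps; elim: t q => [|q' t IHt] q.
  by move=> _ _ /=; btauto.
rewrite [X in X -> _]/= => /andP[qq' tt] far.
have far' : far_chains e p s q' t.
  by apply: sub_all far => x /= /and3P[_ -> ->].
have E1 := IHt q' tt far'.
have E2 : xorb (xorb (winding q p s) (winding q' p s))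
       (xorb (crosses (q - p) (q' - p)) (crosses (q - last p s) (q' - last p s))) =
  xorb (xorb (upper (p - q)) (upper (p - q')))
       (xorb (upper (last p s - q)) (upper (last p s - q'))).
  by apply: winding_strip (ps) qq' _; apply: sub_all far => x /= /and3P[-> ->].
have : forall x y z t : bool, x = y -> z = t -> xorb x z = xorb y t by move=> x y z u -> ->.
move=> /(_ _ _ _ _ E1 E2) /=.
set l := last q' t; set l' := last p s.
have M : forall x y z t : bool, xorb (xorb x y) (xorb z t) = false -> x = y -> z = t.
  by move=> [] [] [] [].
apply: M; btauto.
Qed.

End CrossingParity.

(* [w] stands for the winding of the chain of an edge around a vertex, [u] for the
   side of a difference of vertices.  Summed over all pairs of independent edges,
   each [w] occurs twice and cancels, while the antisymmetric [u] have an odd sum. *)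
Lemma k33_parity (wx wy : 'I_3 -> 'I_3 -> 'I_3 -> bool) (uxx uxy uyx uyy : 'I_3 -> 'I_3 -> bool) :
  (forall i j, uyx j i = ~~ uxy i j) ->
  (forall j j', j != j' -> uyy j j' = ~~ uyy j' j) ->
  (forall i i' j j', i != i' -> j != j' ->
    xorb (xorb (wx i j i') (wy i j j')) (xorb (wx i' j' i) (wy i' j' j)) =
    xorb (xorb (uxx i i') (uxy i j')) (xorb (uyx j i') (uyy j j'))) ->
  False.
Proof.
move=> Hyx Hyy H.
pose z : 'I_3 := inord 0; pose o : 'I_3 := inord 1; pose t : 'I_3 := inord 2.
have [zo [zt ot]] : z != o /\ z != t /\ o != t by rewrite -!val_eqE /= !inordK.
have [oz [tz to]] : o != z /\ t != z /\ t != o by rewrite ![_ == z]eq_sym [t == o]eq_sym.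
pose F i i' j j' := xorb (xorb (xorb (wx i j i') (wy i j j')) (xorb (wx i' j' i) (wy i' j' j)))
   (xorb (xorb (uxx i i') (uxy i j')) (xorb (uyx j i') (uyy j j'))).
have F0 i i' j j' : i != i' -> j != j' -> F i i' j j' = false.
  by move=> ii jj; rewrite /F H //; btauto.
(* With [i] before [i'] and ordered pairs [j], [j'], each of the 18 pairs of independent edges of
   K_{3,3} is counted once. *)
pose S i i' := xorb (xorb (xorb (F i i' z o) (F i i' o z)) (xorb (F i i' z t) (F i i' t z)))
                (xorb (F i i' o t) (F i i' t o)).
have S0 i i' : i != i' -> S i i' = false by move=> ii; rewrite /S !F0.
have : xorb (S z o) (xorb (S z t) (S o t)) = true.
  rewrite /S /F !Hyx (Hyy o z) // (Hyy t z) // (Hyy t o) //; btauto.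
by rewrite !S0.
Qed.

Lemma k5_parity (w : 'I_5 -> 'I_5 -> 'I_5 -> bool) (u : 'I_5 -> 'I_5 -> bool) :
  (forall i j, i != j -> u j i = ~~ u i j) ->
  (forall i j k l : 'I_5, (i < j)%N -> (k < l)%N ->
     i != k -> i != l -> j != k -> j != l ->
    xorb (xorb (w i j k) (w i j l)) (xorb (w k l i) (w k l j)) =
    xorb (xorb (u i k) (u i l)) (xorb (u j k) (u j l))) ->
  False.
Proof.
move=> Hu H; pose n (k : nat) : 'I_5 := inord k.
pose F i j k l := xorb (xorb (xorb (w i j k) (w i j l)) (xorb (w k l i) (w k l j)))
    (xorb (xorb (u i k) (u i l)) (xorb (u j k) (u j l))).
have F0 i j k l : [&& (i < j), (k < l), i != k, i != l, j != k, j != l,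
     (i < 5), (j < 5), (k < 5) & (l < 5)]%N -> F (n i) (n j) (n k) (n l) = false.
  case/and5P=> h1 h2 h3 h4 /and5P[h5 h6 h7 h8 /andP[h9 h10]].
  by rewrite /F H -?val_eqE /= ?inordK //; btauto.
have Hn i j : (i < j < 5)%N -> u (n j) (n i) = ~~ u (n i) (n j).
  move=> /andP[ij j5]; apply: Hu; rewrite -val_eqE /= !inordK //; first by rewrite ltn_eqF.
  exact: ltn_trans j5.
(* The three ways to split four vertices into two edges; over the five quadruples these are the 15
   pairs of independent edges of K_5. *)
pose S a b c d := xorb (F (n a) (n b) (n c) (n d)) (xorb (F (n a) (n c) (n b) (n d)) (F (n a) (n d) (n b) (n c))).
have : xorb (S 0 1 2 3) (xorb (xorb (S 0 1 2 4) (S 0 1 3 4)) (xorb (S 0 2 3 4) (S 1 2 3 4))) = true.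
  rewrite /S /F (Hn 1 2) // (Hn 2 3) // (Hn 1 3) // (Hn 2 4) // (Hn 3 4) // (Hn 1 4) //; btauto.
by rewrite /S !F0.
Qed.

(** * Non-planarity of K_{3,3} and K_5 for separated chainable sets *)

Section NonPlanarity.
Variable R : realType.
Implicit Types (p q : R * R) (K : set (R * R)).

(** A weak form of being joined by a curve in [K]. It follows from connectedness, composes along
    unions, and provides the chains of the parity count. *)
Definition chainable K p q := forall e, 0 < e ->
  exists s, [/\ fine_chain e p s, last p s = q & forall x, x \in p :: s -> K x].

Definition far_apart K K' := exists2 e : R, 0 < e &
  forall x y, K x -> K' y -> far_pt e x y.

Lemma far_pt_le e e' p q : e <= e' -> far_pt e' p q -> far_pt e p q.
Proof.
move=> ee; rewrite /far_pt => /orP[] h; apply/orP; [left|right];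
by apply: le_trans h; rewrite ler_pM2l.
Qed.

Lemma common_radius (I : finType) (P : I -> R -> Prop) :
  (forall i e e', e <= e' -> P i e' -> P i e) ->
  (forall i, exists2 e, 0 < e & P i e) -> exists2 e, 0 < e & forall i, P i e.
Proof.
move=> Pm Pe; have /choice[e eP] : forall i, exists e, 0 < e /\ P i e.
  by move=> i; have [e] := Pe i; exists e.
exists (\big[Num.min/1]_i e i).
  by elim/big_ind: _ => // [x y x0 y0|i _]; [rewrite lt_min x0 | have [] := eP i].
by move=> i; apply: Pm (eP i).2; apply: bigmin_le_cond.
Qed.

Theorem k33_nonplanar (X Y : 'I_3 -> R * R) (K : 'I_3 -> 'I_3 -> set (R * R)) :
  (forall i j, chainable (K i j) (X i) (Y j)) ->
  (forall i i' j j', i != i' -> j != j' -> far_apart (K i j) (K i' j')) -> False.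
Proof.
move=> chK sepK.
have [e e0 far] : exists2 e : R, 0 < e & forall z : ('I_3 * 'I_3) * ('I_3 * 'I_3),
    z.1.1 != z.2.1 -> z.1.2 != z.2.2 ->
    forall x y, K z.1.1 z.1.2 x -> K z.2.1 z.2.2 y -> far_pt e x y.
  apply: common_radius => [z e e' ee' h n1 n2 x y Kx Ky|z].
    by apply: far_pt_le ee' _; apply: h.
  have [n1|n1] := eqVneq z.1.1 z.2.1; first by exists 1.
  have [n2|n2] := eqVneq z.1.2 z.2.2; first by exists 1.
  by have [e e0 h] := sepK _ _ _ _ n1 n2; exists e.
have /choice[s sP] : forall z : 'I_3 * 'I_3, exists s,
    [/\ fine_chain e (X z.1) s, last (X z.1) s = Y z.2 &
        forall x, x \in X z.1 :: s -> K z.1 z.2 x] by move=> z; apply: chK.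
have fine i j : fine_chain e (X i) (s (i, j)) by have [] := sP (i, j).
have lst i j : last (X i) (s (i, j)) = Y j by have [] := sP (i, j).
have inK i j x : x \in X i :: s (i, j) -> K i j x by have [_ _] := sP (i, j); apply.
have XK i j : K i j (X i) by apply: inK; rewrite mem_head.
have YK i j : K i j (Y j) by apply: inK; rewrite -(lst i j) mem_last.
(* [upper] is known to be antisymmetric only for points far apart. Two vertices are known to be so
   once they are placed on independent edges, which takes a second index. *)
have other (i : 'I_3) : exists i' : 'I_3, i != i'.
  by exists (if i == 0 then 1 else 0); case: (eqVneq i 0) => [->|].
apply: (@k33_parity (fun i j i' => winding (X i') (X i) (s (i, j)))
   (fun i j j' => winding (Y j') (X i) (s (i, j)))
   (fun i i' => upper (X i - X i')) (fun i j => upper (X i - Y j))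
   (fun j i => upper (Y j - X i)) (fun j j' => upper (Y j - Y j'))).
- move=> i j; have [i' ii'] := other i; have [j' jj'] := other j.
  apply: upper_opp e0 _; apply: (far ((i, j'), (i', j))) => //=.
  by rewrite eq_sym.
- move=> j j' jj'; have [i' ii'] := other 0.
  apply: upper_opp e0 _; apply: (far ((0, j'), (i', j))) => //=; first by rewrite eq_sym.
- move=> i i' j j' ii' jj'.
  have := winding_pair (fine i j) (fine i' j').
  rewrite !lst; apply; apply/allP => x xs; apply/allP => y ys.
  by apply: (far ((i, j), (i', j'))) => //=; apply: inK.
Qed.

Theorem k5_nonplanar (X : 'I_5 -> R * R) (K : 'I_5 -> 'I_5 -> set (R * R)) :
  (forall i j : 'I_5, (i < j)%N -> chainable (K i j) (X i) (X j)) ->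
  (forall i j k l : 'I_5, (i < j)%N -> (k < l)%N ->
     i != k -> i != l -> j != k -> j != l -> far_apart (K i j) (K k l)) -> False.
Proof.
move=> chK sepK.
have [e e0 far] : exists2 e : R, 0 < e & forall z : ('I_5 * 'I_5) * ('I_5 * 'I_5),
    (z.1.1 < z.1.2)%N && (z.2.1 < z.2.2)%N ->
    [&& z.1.1 != z.2.1, z.1.1 != z.2.2, z.1.2 != z.2.1 & z.1.2 != z.2.2] ->
    forall x y, K z.1.1 z.1.2 x -> K z.2.1 z.2.2 y -> far_pt e x y.
  apply: common_radius => [z e e' ee' h n1 n2 x y Kx Ky|z].
    by apply: far_pt_le ee' _; apply: h.
  case lz: ((z.1.1 < z.1.2)%N && (z.2.1 < z.2.2)%N); last by exists 1.
  case nz: [&& z.1.1 != z.2.1, z.1.1 != z.2.2, z.1.2 != z.2.1 & z.1.2 != z.2.2]; last by exists 1.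
  move/andP: lz => [l1 l2]; move/and4P: nz => [n1 n2 n3 n4].
  by have [e e0 h] := sepK _ _ _ _ l1 l2 n1 n2 n3 n4; exists e.
have /choice[s sP] : forall z : 'I_5 * 'I_5, exists s, (z.1 < z.2)%N ->
    [/\ fine_chain e (X z.1) s, last (X z.1) s = X z.2 &
        forall x, x \in X z.1 :: s -> K z.1 z.2 x].
  move=> z; case lz: (z.1 < z.2)%N; last by exists [::].
  by have [s sP] := chK _ _ lz _ e0; exists s.
have fine (i j : 'I_5) : (i < j)%N -> fine_chain e (X i) (s (i, j)) by move=> /(sP (i, j))[].
have lst (i j : 'I_5) : (i < j)%N -> last (X i) (s (i, j)) = X j by move=> /(sP (i, j))[].
have inK (i j : 'I_5) x : (i < j)%N -> x \in X i :: s (i, j) -> K i j x.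
  by move=> /(sP (i, j))[_ _]; apply.
have K1 (i j : 'I_5) : (i < j)%N -> K i j (X i) by move=> ij; apply: inK; rewrite ?mem_head.
have K2 (i j : 'I_5) : (i < j)%N -> K i j (X j).
  by move=> ij; apply: inK; rewrite -?(lst i j) ?mem_last.
have avoid (t : seq 'I_5) : (size t < 5)%N -> exists k, k \notin t.
  move=> st; have := cardC (mem t); rewrite card_ord => h.
  have : (0 < #|[predC t]|)%N.
    apply: (@leq_trans (5 - size t)); first by rewrite subn_gt0.
    by rewrite leq_subLR; apply: leq_trans (leq_add (card_size t) (leqnn _)); rewrite h.
  by move=> /card_gt0P[k]; exists k.
(* Sets are given for increasing indices, so the edge through [i] and [k] is taken with its ends
   sorted; with two spare vertices this puts any [X i], [X j] on independent edges. *)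
have ends (i k : 'I_5) : i != k -> exists a b : 'I_5,
    [/\ (a < b)%N, forall x, x \in [:: a; b] -> x \in [:: i; k] & K a b (X i)].
  move=> ik; case: (ltngtP i k) => [h|h|h].
  - by exists i, k; split => //; apply: K1.
  - by exists k, i; split => // [x|]; [rewrite !inE orbC | apply: K2].
  - by move: ik; rewrite (val_inj h) eqxx.
apply: (@k5_parity (fun i j k => winding (X k) (X i) (s (i, j)))
   (fun i j => upper (X i - X j))).
- move=> i j ij; apply: upper_opp e0 _.
  have [k] := avoid [:: i; j] isT; rewrite !inE negb_or => /andP[ki kj].
  have [l] := avoid [:: i; j; k] isT; rewrite !inE !negb_or => /and3P[li lj lk].
  have [|a [b [ab abP Ki]]] := ends i k; first by rewrite eq_sym.
  have [|c [d [cd cdP Kj]]] := ends j l; first by rewrite eq_sym.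
  have neq x y : x \in [:: a; b] -> y \in [:: c; d] -> x != y.
    move=> /abP xik /cdP; apply: contraTneq => <-; move: xik; rewrite !inE !negb_or.
    by case/orP => /eqP ->; rewrite ?ij ?kj /= eq_sym ?li ?lk.
  apply: (far ((a, b), (c, d))) => //=; first by rewrite ab cd.
  by apply/and4P; split; apply: neq; rewrite !inE eqxx ?orbT.
- move=> i j k l ij kl ik il jk jl.
  have := winding_pair (fine i j ij) (fine k l kl).
  rewrite !lst // => ->; first by btauto.
  apply/allP => x xs; apply/allP => y ys.
  by apply: (far ((i, j), (k, l))) => //=; rewrite ?ij ?kl ?ik ?il ?jk ?jl //; apply: inK.
Qed.
End NonPlanarity.

(** * Connectedness, compactness and segments in the plane *)

Section ChainableSets.
Variable R : realType.
Implicit Types (p q : R * R) (K A : set (R * R)).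

Lemma near_ptE e p q : near_pt e p q <-> ball p e q.
Proof. by rewrite /near_pt; split => [/andP//|[h1 h2]]; apply/andP. Qed.

Lemma open_setP A p : open A -> A p -> exists2 e : R, 0 < e & ball p e `<=` A.
Proof. by move=> oA Ap; have /nbhs_ballP[e] := open_nbhs_nbhs (conj oA Ap); exists e. Qed.

(** [P] is locally constant on [K]: balls around the points with [P], and around those without it,
    make [P] both open and closed relative to [K]. *)
Lemma connected_induction (K : set (R * R)) (P : R * R -> Prop) : connected K ->
  (forall x, K x -> exists2 e : R, 0 < e & forall y, K y -> ball x e y -> (P x <-> P y)) ->
  forall x y, K x -> K y -> P x -> P y.
Proof.
move=> cK loc x y Kx Ky Px.
have /choice[e eP] : forall z, exists e : R, K z -> 0 < e /\
    forall y, K y -> ball z e y -> (P z <-> P y).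
  by move=> z; have [/loc[e]|] := pselect (K z); [exists e | exists 0].
pose U (Q : R * R -> Prop) := \bigcup_(z in [set z | K z /\ Q z]) ball z (e z).
have oU Q : open (U Q) by apply: bigcup_open => z [Kz _]; apply: ball_open.
have UP Q z : K z -> Q z -> U Q z.
  by move=> Kz Qz; exists z => //; apply: ballxx; have [] := eP z Kz.
have UPK z : K z -> U P z -> P z.
  by move=> Kz [t [Kt Pt]] /((eP t Kt).2 z Kz)[h _]; apply: h.
have UNPK z : K z -> U (fun z => ~ P z) z -> ~ P z.
  by move=> Kz [t [Kt Pt]] /((eP t Kt).2 z Kz)[_ h] /h.
suff : K `&` [set z | P z] = K by move=> h; move: Ky; rewrite -h => -[].
apply: cK.
- by exists x.
- exists (U P); first exact: oU.
  by rewrite predeqE => z; split => -[Kz h]; split => //; [apply: UP | apply: UPK].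
- exists (~` U (fun z => ~ P z)); first by apply: open_closedC; apply: oU.
  rewrite predeqE => z; split => -[Kz h]; split => //.
    by move=> /(UNPK z Kz).
  by apply: contrapT => nP; apply: h; apply: UP.
Qed.

Lemma fine_chain_cat e p s t : fine_chain e p (s ++ t) = fine_chain e p s && fine_chain e (last p s) t.
Proof. exact: cat_path. Qed.

Lemma chainable_trans K p q r : chainable K p q -> chainable K q r -> chainable K p r.
Proof.
move=> pq qr e e0; have [s [s1 s2 s3]] := pq e e0; have [t [t1 t2 t3]] := qr e e0.
exists (s ++ t); split; first by rewrite fine_chain_cat s1 s2.
  by rewrite last_cat s2.
move=> x; rewrite -cat_cons mem_cat => /orP[/s3//|xt].
by apply: t3; rewrite inE xt orbT.
Qed.

Lemma chainableW K K' p q : K `<=` K' -> chainable K p q -> chainable K' p q.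
Proof.
move=> KK pq e e0; have [s [s1 s2 s3]] := pq e e0.
by exists s; split => // x /s3 /KK.
Qed.

Lemma connected_chainable K p q : connected K -> K p -> K q -> chainable K p q.
Proof.
move=> cK Kp Kq e e0.
pose P q := exists s, [/\ fine_chain e p s, last p s = q &
   forall x, x \in p :: s -> K x].
have Pp : P p by exists [::]; split => // x; rewrite inE => /eqP ->.
apply: (connected_induction (P := P) cK _ Kp Kq Pp) => x Kx.
have ext a b : K b -> near_pt e a b -> P a -> P b.
  move=> Kb ab [s [s1 s2 s3]]; exists (rcons s b); split.
  - by rewrite /fine_chain rcons_path; apply/andP; rewrite s2.
  - by rewrite last_rcons.
  - by move=> z; rewrite -rcons_cons mem_rcons inE => /orP[/eqP -> //|/s3].
exists e => // y Ky xy; split; apply: ext => //; apply/near_ptE => //.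
exact: ball_sym.
Qed.

(** The set of differences is compact, hence closed, and misses 0; so it misses a whole ball around
    0. *)
Lemma compact_far_apart K K' : compact K -> compact K' -> K `&` K' = set0 -> far_apart K K'.
Proof.
move=> cK cK' KK'.
pose D := (fun z : (R * R) * (R * R) => z.1 - z.2) @` (K `*` K').
have cD : compact D.
  apply: continuous_compact; last exact: compact_setX.
  apply: continuous_subspaceT => z; apply: cvgB; [exact: cvg_fst|exact: cvg_snd].
have clD : closed D by apply: compact_closed cD; apply: norm_hausdorff.
have [|e e0 eD] := @open_setP (~` D) 0 (closed_openC clD).
  move=> [[x y] [/= Kx Ky]] /eqP; rewrite subr_eq0 => /eqP xy.
  have : (K `&` K') x by split => //; rewrite xy.
  by rewrite KK'.
exists (e / 4); first by rewrite divr_gt0.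
move=> x y Kx Ky; apply: contrapT => /negP; rewrite /far_pt negb_or -!ltNge => /andP[h1 h2].
apply: (eD (x - y)); last by exists (x, y).
have e4 : 4 * (e / 4) = e by field.
by split => /=; rewrite /ball /= sub0r normrN -[X in _ < X]e4.
Qed.

Definition seg p q : set (R * R) := (fun t : R => (p.1 + t * (q.1 - p.1), p.2 + t * (q.2 - p.2))) @` `[0, 1].

Lemma seg_continuous p q : continuous (fun t : R => (p.1 + t * (q.1 - p.1), p.2 + t * (q.2 - p.2))).
Proof.
have h (a b : R) : continuous (fun t : R => a + t * b).
  by move=> t; apply: cvgD; [exact: cvg_cst | apply: cvgMr_tmp; apply: cvg_id].
by move=> t; exact: (cvg_pair (h _ _ t) (h _ _ t)).
Qed.

Lemma unit_itv_connected : connected (`[0, 1]%classic : set R).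
Proof. by apply/connected_intervalP; apply: interval_is_interval. Qed.

Lemma seg_compact p q : compact (seg p q).
Proof.
apply: continuous_compact; last exact: segment_compact.
by apply: continuous_subspaceT; apply: seg_continuous.
Qed.

Lemma seg_chainable p q : chainable (seg p q) p q.
Proof.
apply: connected_chainable.
- apply: connected_continuous_connected; first exact: unit_itv_connected.
  by apply: continuous_subspaceT; apply: seg_continuous.
- exists 0; first by rewrite /= in_itv /= lexx ler01.
  by rewrite !mul0r !addr0; case: p.
- exists 1; first by rewrite /= in_itv /= lexx ler01.
  by rewrite !mul1r !subrKC; case: q.
Qed.

Lemma seg_ball (x p q : R * R) (e : R) : ball x e p -> ball x e q -> seg p q `<=` ball x e.
Proof.
move=> [p1 p2] [q1 q2] z [t t01 <-].
have /andP[t0 t1] : 0 <= t <= 1 by move: t01; rewrite /= in_itv.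
have conv (a b c : R) : `|a - b| < e -> `|a - c| < e -> `|a - (b + t * (c - b))| < e.
  move=> h1 h2; have -> : a - (b + t * (c - b)) = (1 - t) * (a - b) + t * (a - c) by ring.
  apply: le_lt_trans (ler_normD _ _) _; rewrite !normrM (ger0_norm t0) ger0_norm ?subr_ge0 //.
  have [->|tN0] := eqVneq t 0; first by rewrite subr0 mul1r mul0r addr0.
  have tgt : 0 < t by rewrite lt_neqAle eq_sym tN0.
  have : t * `|a - c| < t * e by rewrite ltr_pM2l.
  have : (1 - t) * `|a - b| <= (1 - t) * e by rewrite ler_wpM2l ?subr_ge0 // ltW.
  by move: (t * _) ((1 - t) * _) => u v; lra.
by split; apply: conv.
Qed.
End ChainableSets.

(** * Outerplanar drawings *)
Section Drawing.
Variables (R : realType) (G : sgraph) (p : G -> R * R) (c : G -> G -> R -> R * R).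
Hypothesis D : plane_drawing p c.
Implicit Types (x y z : G) (s t : seq G).

Definition arc_set x y : set (R * R) := c x y @` `[0, 1].

Lemma arc_compact x y : edge x y -> compact (arc_set x y).
Proof.
move=> xy; apply: continuous_compact; last exact: segment_compact.
exact: drawing_continuous D _ _ xy.
Qed.

Lemma arc_chainable x y : edge x y -> chainable (arc_set x y) (p x) (p y).
Proof.
move=> xy; have [c0 c1] := drawing_ends D xy.
apply: connected_chainable.
- apply: connected_continuous_connected; first exact: unit_itv_connected.
  exact: drawing_continuous D _ _ xy.
- by exists 0; rewrite //= in_itv /= lexx ler01.
- by exists 1; rewrite //= in_itv /= lexx ler01.
Qed.

Lemma arc_setP x y w : edge x y -> arc_set x y w ->
  [\/ w = p x, w = p y | (c x y @` `]0, 1[) w].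
Proof.
move=> xy [t t01 <-]; have [c0 c1] := drawing_ends D xy.
have /andP[t0 t1] : 0 <= t <= 1 by move: t01; rewrite /= in_itv.
have [->|tN0] := eqVneq t 0; first by rewrite c0; apply: Or31.
have [->|tN1] := eqVneq t 1; first by rewrite c1; apply: Or32.
by apply: Or33; exists t => //; rewrite /= in_itv /= !lt_neqAle t0 t1 tN1 eq_sym tN0.
Qed.

Lemma arc_avoids x y z : edge x y -> z != x -> z != y -> ~ arc_set x y (p z).
Proof.
move=> xy zx zy /(arc_setP xy)[/(drawing_vertex_inj D)/eqP|/(drawing_vertex_inj D)/eqP|].
- by rewrite (negbTE zx).
- by rewrite (negbTE zy).
- by move=> h; apply: (drawing_avoids_vertices D xy h).
Qed.

Lemma arc_disjoint x y x' y' : edge x y -> edge x' y' ->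
  x != x' -> x != y' -> y != x' -> y != y' -> arc_set x y `&` arc_set x' y' = set0.
Proof.
move=> e e' n1 n2 n3 n4; rewrite -subset0 => w [w1 w2].
case: (arc_setP e w1) => [h|h|h].
- by move: w2; rewrite h => /(arc_avoids e' n1 n2).
- by move: w2; rewrite h => /(arc_avoids e' n3 n4).
case: (arc_setP e' w2) => [h'|h'|h'].
- by move: w1; rewrite h'; apply: arc_avoids => //; rewrite eq_sym.
- by move: w1; rewrite h'; apply: arc_avoids => //; rewrite eq_sym.
have xy' : [set x; y]%SET != [set x'; y']%SET.
  apply/negP => /eqP/setP/(_ x); rewrite !inE eqxx /= => /esym.
  by rewrite (negbTE n1) (negbTE n2).
by rewrite -(drawing_no_crossing D e e' xy').
Qed.

Fixpoint walk_set x s : set (R * R) :=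
  if s is y :: s' then arc_set x y `|` walk_set y s' else set0.

Lemma walk_compact x s : path (@edge G) x s -> compact (walk_set x s).
Proof.
elim: s x => [|y s IHs] x /=; first by move=> _; apply: compact0.
by move=> /andP[xy ys]; apply: compactU; [apply: arc_compact | apply: IHs].
Qed.

Lemma walk_chainable x s : s != [::] -> path (@edge G) x s ->
  chainable (walk_set x s) (p x) (p (last x s)).
Proof.
elim: s x => [//|y s IHs] x _ /= /andP[xy ys].
have [->/=|sN] := eqVneq s [::].
  by rewrite setU0; apply: arc_chainable.
apply: chainable_trans (chainableW (@subsetUl _ _ _) (arc_chainable xy)) _.
exact: chainableW (@subsetUr _ _ _) (IHs _ sN ys).
Qed.

Lemma walk_setP x s w : path (@edge G) x s -> walk_set x s w ->
  exists a b, [/\ a \in x :: s, b \in x :: s, edge a b & arc_set a b w].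
Proof.
elim: s x => [//|y s IHs] x /= /andP[xy ys] [h|h].
  by exists x, y; split => //; rewrite !inE eqxx ?orbT.
have [a [b [ha hb hab h']]] := IHs y ys h.
by exists a, b; split => //; rewrite inE (ha, hb) orbT.
Qed.

Lemma walk_far_apart x s y t : path (@edge G) x s -> path (@edge G) y t ->
  (forall z, z \in x :: s -> z \notin y :: t) -> far_apart (walk_set x s) (walk_set y t).
Proof.
move=> xs yt dis; apply: compact_far_apart; try exact: walk_compact.
rewrite -subset0 => w [/(walk_setP xs)[a [b [ha hb ab wab]]]].
move=> /(walk_setP yt)[a' [b' [ha' hb' ab' wab']]].
have ne u v : u \in x :: s -> v \in y :: t -> u != v.
  by move=> us vt; apply: contraTneq vt => <-; apply: dis.
by rewrite -(@arc_disjoint a b a' b') //; exact: ne.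
Qed.

(* a family of curves from a common point [q] to all vertices, as good as new
   edges for the parity argument *)
Definition outer_fan q (O : G -> set (R * R)) := forall x,
  [/\ compact (O x), chainable (O x) q (p x) &
      forall y z, edge y z -> x != y -> x != z -> O x `&` arc_set y z = set0].

Lemma fan_far_apart q O x y s : outer_fan q O -> path (@edge G) y s ->
  x \notin y :: s -> far_apart (O x) (walk_set y s).
Proof.
move=> oO ys xys; have [cO _ dis] := oO x.
apply: compact_far_apart => //; first exact: walk_compact.
rewrite -subset0 => w [wO /(walk_setP ys)[a [b [ha hb ab wab]]]].
rewrite -(dis a b ab) //.
  by apply: contraNneq xys => ->.
by apply: contraNneq xys => ->.
Qed.

Lemma far_apart_sym (K K' : set (R * R)) : far_apart K K' -> far_apart K' K.
Proof.
move=> [e e0 h]; exists e => // x y Kx Ky.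
by have := h y x Ky Kx; rewrite /far_pt distrC [in X in _ || X]distrC.
Qed.

Lemma compact_avoids_ball (K : set (R * R)) w : compact K -> ~ K w ->
  exists2 e : R, 0 < e & forall v, ball w e v -> ~ K v.
Proof.
move=> cK nK; have cl : closed K by apply: compact_closed cK; apply: norm_hausdorff.
by have [e e0 h] := open_setP (closed_openC cl) nK; exists e => // v /h.
Qed.

Lemma support_ball w : ~ drawing_support p c w ->
  exists2 e : R, 0 < e & forall v, ball w e v -> ~ drawing_support p c v.
Proof.
move=> nw.
have sub e e' (v : R * R) : e <= e' -> ball w e v -> ball w e' v.
  by move=> ee; apply: le_ball.
have [e1 e10 h1] : exists2 e : R, 0 < e & forall z : G * G, edge z.1 z.2 ->
    forall v, ball w e v -> ~ arc_set z.1 z.2 v.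
  apply: common_radius => [z e e' ee h zz v /(sub _ _ _ ee)|z]; first exact: h.
  have [zz|] := boolP (edge z.1 z.2); last by exists 1.
  have [|e e0 h] := @compact_avoids_ball (arc_set z.1 z.2) w (arc_compact zz).
    by move=> h; apply: nw; right; exists z.1, z.2.
  by exists e.
have [e2 e20 h2] : exists2 e : R, 0 < e & forall x, forall v, ball w e v -> v != p x.
  apply: common_radius => [z e e' ee h v /(sub _ _ _ ee)|z]; first exact: h.
  have [|e e0 h] := @compact_avoids_ball [set p z] w (@compact_set1 _ (p z)).
    by move=> h; apply: nw; left; exists z.
  by exists e => // v /h hv; apply/eqP.
exists (Num.min e1 e2); first by rewrite lt_min e10.
move=> v wv [[x _ xv]|[x [y [xy]]]].
  by have := h2 x v (sub _ _ _ _ wv); rewrite xv eqxx ge_min lexx orbT; move=> /(_ isT).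
by apply: (h1 (x, y) xy); apply: sub wv; rewrite ge_min lexx.
Qed.

(** Within the face, being linked to [q] by a compact chainable set off the drawing is locally
    constant, hence holds throughout. Compactness later gives a positive distance to the edges. As
    [p x] is on the frontier, a short segment from a point of the face completes the link. *)
Lemma face_outer_fan F : face (drawing_support p c) F ->
  (forall x, frontier F (p x)) -> exists q O, outer_fan q O.
Proof.
move=> [q nq FE] Ffr; exists q.
have FnD w : F w -> ~ drawing_support p c w.
  by rewrite FE => -[B [Bq BD cB] Bw]; apply: BD.
have Fq : F q by rewrite FE; apply: connected_component_refl.
have cF : connected F by rewrite FE; apply: component_connected.
pose L w := exists K, [/\ compact K, K `&` drawing_support p c = set0 & chainable K q w].
have linked w : F w -> L w.
  move=> Fw; apply: (connected_induction (P := L) cF _ Fq Fw); last first.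
    exists (seg q q); split; [exact: seg_compact| |exact: seg_chainable].
    rewrite -subset0 => v [qv]; move=> Dv; have [e e0 h] := support_ball nq.
    by apply: h Dv; apply: (seg_ball (p := q) (q := q)) qv; apply: ballxx.
  move=> x Fx; have [e e0 h] := support_ball (FnD x Fx).
  exists e => // y Fy xy.
  have ext a b : ball x e a -> ball x e b -> L a -> L b.
    move=> xa xb [K [cK KD qa]]; exists (K `|` seg a b); split.
    - by apply: compactU => //; apply: seg_compact.
    - rewrite setIUl KD set0U -subset0 => v [/(seg_ball xa xb)/h].
      by [].
    - apply: chainable_trans (chainableW (@subsetUl _ _ _) qa) _.
      exact: chainableW (@subsetUr _ _ _) (@seg_chainable _ a b).
  by split; apply: ext => //; exact: ballxx.
suff H : forall x, exists O, [/\ compact O, chainable O q (p x) &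
      forall y z, edge y z -> x != y -> x != z -> O `&` arc_set y z = set0].
  by have /choice[S HS] := H; exists S.
move=> x.
(* Only edges away from [x] are to be avoided; the final segment to [p x] may meet those at [x]. *)
have [r r0 hr] : exists2 r : R, 0 < r & forall z : G * G, edge z.1 z.2 ->
    x != z.1 -> x != z.2 -> forall v, ball (p x) r v -> ~ arc_set z.1 z.2 v.
  apply: common_radius => [z e e' ee h zz n1 n2 v /(le_ball ee)|z]; first exact: h.
  have [zz|] := boolP (edge z.1 z.2); last by exists 1.
  have [->|n1] := eqVneq x z.1; first by exists 1 => // _; rewrite ?eqxx.
  have [->|n2] := eqVneq x z.2; first by exists 1 => // _ _; rewrite ?eqxx.
  have [e e0 h] := @compact_avoids_ball (arc_set z.1 z.2) (p x) (arc_compact zz) (arc_avoids zz n1 n2).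
  by exists e.
have [clF _] := Ffr x.
have [w [Fw xw]] := clF (ball (p x) r) (nbhsx_ballx _ _ r0).
have [K [cK KD qw]] := linked w Fw.
exists (K `|` seg w (p x)); split.
- by apply: compactU => //; apply: seg_compact.
- apply: chainable_trans (chainableW (@subsetUl _ _ _) qw) _.
  exact: chainableW (@subsetUr _ _ _) (@seg_chainable _ w (p x)).
- move=> y z yz xy xz; rewrite -subset0 => v [[Kv|sv] Av].
    have : (K `&` drawing_support p c) v by split => //; right; exists y, z.
    by rewrite KD.
  by apply: (hr (y, z) yz xy xz v _ Av); apply: (seg_ball xw) sv; apply: ballxx.
Qed.
End Drawing.

(** * Subdivisions of K_{2,3} and K_4 in outerplanar graphs *)

Section ForbiddenSubdivisions.
Variables (R : realType) (G : sgraph).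

(** The outer point [q], joined to [a], [b], [c] by the fan of curves, makes a K_{3,3} with sides
    [q], [u], [z] and [a], [b], [c]. Only the branch from [z] to [c] is subdivided, which is the
    case that [double_unique] produces. *)
Lemma outerplanar_no_k23 (u z a b c : G) (s : seq G) : outerplanar R G ->
  uniq [:: u; z; a; b; c] -> edge u a -> edge u b -> edge u c -> edge z a -> edge z b ->
  path (@edge G) z (rcons s c) -> (forall v, v \in s -> v \notin [:: u; a; b]) -> False.
Proof.
move=> [p [d [D [F [faceF _ Ffr]]]]] un ua ub uc za zb zc hs.
have [q [S HS]] := face_outer_fan D faceF Ffr.
pose y (j : 'I_3) := nth a [:: a; b; c] j.
(* The indices 0, 1, [ord_max] on this side stand for [q], [u], [z]. *)
pose w (i j : 'I_3) : seq G := if i == 1 then [:: y j] else if j == ord_max then rcons s c else [:: y j].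
pose x (i : 'I_3) := if i == 1 then u else z.
pose X (i : 'I_3) := if i == 0 then q else p (x i).
pose K (i j : 'I_3) := if i == 0 then S (y j) else walk_set d (x i) (w i j).
have yin j : y j \in [:: a; b; c] by apply: mem_nth.
have yE (j : 'I_3) : [\/ j = 0 /\ y j = a, j = 1 /\ y j = b | j = ord_max /\ y j = c].
  rewrite /y; case: j => [[|[|[|//]]] jj]; [apply: Or31|apply: Or32|apply: Or33];
  by split => //; apply: val_inj.
have iE (i : 'I_3) : i != 0 -> i = 1 \/ i = ord_max.
  by case: i => [[|[|[|//]]] jj] // _; [left|right]; apply: val_inj.
have wP i j : i != 0 -> [/\ path (@edge G) (x i) (w i j), w i j != [::] & last (x i) (w i j) = y j].
  rewrite /w /x; case/iE => -> /=.
    by split => //=; rewrite andbT; case: (yE j) => -[_ ->].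
  case: (yE j) => -[-> ->] /=.
  - by rewrite za.
  - by rewrite zb.
  - by split=> //; [case: (s) | rewrite last_rcons].
have memw i j v : i != 0 -> v \in x i :: w i j ->
    [\/ v = x i, v = y j | [/\ i = ord_max, j = ord_max & v \in s]].
  rewrite /w /x; case/iE => -> /=.
    by rewrite !inE => /orP[/eqP->|/eqP->]; [apply: Or31|apply: Or32].
  case: (yE j) => -[-> ->] /=.
  - by rewrite !inE => /orP[/eqP->|/eqP->]; [apply: Or31|apply: Or32].
  - by rewrite !inE => /orP[/eqP->|/eqP->]; [apply: Or31|apply: Or32].
  - rewrite inE mem_rcons inE => /or3P[/eqP->|/eqP->|vs]; [apply: Or31|apply: Or32|apply: Or33] => //.
have yinj : injective y.
  move=> j j' /eqP; rewrite /y nth_uniq ?size_tuple //; first by move/eqP/val_inj.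
  by move: un => /= /and3P[_ _].
have xy i j : x i != y j.
  rewrite /x; move: un; rewrite /= !inE !negb_or.
  case/and5P=> /and4P[h1 h2 h3 h4] /and3P[h5 h6 h7] _ _ _.
  by case: (yE j) => -[_ ->]; case: ifP.
have uz : u != z by move: un; rewrite /= !inE !negb_or => /and5P[/and4P[]].
have ys j : j != ord_max -> y j \notin s.
  case: (yE j) => -[-> ->] // _; apply/negP => /hs; rewrite !inE eqxx ?orbT //.
have xs i : i != ord_max -> i != 0 -> x i \notin s.
  move=> im /iE[] e; last by move: im; rewrite e eqxx.
  by rewrite /x e /=; apply/negP => /hs; rewrite !inE eqxx.
have walk_avoid i j j' : i != 0 -> j != j' -> y j' \notin x i :: w i j.
  move=> i0 jj; apply/negP => /(memw _ _ _ i0)[/eqP|/yinj/eqP|[_ e h]].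
  - by rewrite eq_sym (negbTE (xy _ _)).
  - by rewrite eq_sym (negbTE jj).
  - by move: h; apply/negP; apply: ys; rewrite -e eq_sym.
have walk_sep i i' j j' : i != 0 -> i' != 0 -> i != i' -> j != j' ->
    forall v, v \in x i :: w i j -> v \notin x i' :: w i' j'.
  move=> i0 i'0 ii jj v hv; apply/negP => hv'.
  have xx : x i != x i'.
    move: ii; rewrite /x; case/iE: i0 => ->; case/iE: i'0 => -> //= _.
    by rewrite eq_sym.
  case: (memw _ _ _ i0 hv) => [e|e|[ei ej vs]].
  - case: (memw _ _ _ i'0 hv') => [e'|e'|[ei' ej' vs]].
    + by move: xx; rewrite -e e' eqxx.
    + by move: (xy i j'); rewrite -e e' eqxx.
    + by move: vs; rewrite e; apply/negP; apply: xs => //; rewrite -ei'.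
  - by move: hv'; rewrite e; apply/negP; apply: walk_avoid => //; rewrite eq_sym.
  - case: (memw _ _ _ i'0 hv') => [e'|e'|[ei' ej' _]].
    + by move: vs; rewrite e'; apply/negP; apply: xs => //; rewrite -ei eq_sym.
    + by move: vs; rewrite e'; apply/negP; apply: ys => //; rewrite -ej eq_sym.
    + by move: ii; rewrite ei ei' eqxx.
apply: (@k33_nonplanar R X (fun j => p (y j)) K) => [i j|i i' j j' ii jj].
- rewrite /X /K; case: (eqVneq i 0) => [_|i0]; first by have [] := HS (y j).
  have [wp wN <-] := wP i j i0; exact: walk_chainable.
- rewrite /K; case: (eqVneq i 0) => [i0|i0]; case: (eqVneq i' 0) => [i'0|i'0].
  + by move: ii; rewrite i0 i'0 eqxx.
  + by have [wp wN _] := wP i' j' i'0; apply: fan_far_apart HS wp _ => //; apply: walk_avoid => //; rewrite eq_sym.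
  + have [wp wN _] := wP i j i0; apply: far_apart_sym.
    by apply: fan_far_apart HS wp _ => //; apply: walk_avoid.
  + have [wp wN _] := wP i j i0; have [wp' wN' _] := wP i' j' i'0.
    by apply: (walk_far_apart D wp wp'); apply: walk_sep.
Qed.

Lemma outerplanar_no_k4 (b : nat -> G) (s : nat -> nat -> seq G) : outerplanar R G ->
  (forall i j, (i < j < 4)%N ->
     [/\ s i j != [::], path (@edge G) (b i) (s i j) & last (b i) (s i j) = b j]) ->
  (forall i j k l, (i < j < 4)%N -> (k < l < 4)%N -> i != k -> i != l -> j != k -> j != l ->
     forall v, v \in b i :: s i j -> v \notin b k :: s k l) -> False.
Proof.
move=> [p [d [D [F [faceF _ Ffr]]]]] Hs dis.
have [q [S HS]] := face_outer_fan D faceF Ffr.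
(* [b k] is an end of the path between it and the fourth branch vertex, and that path is disjoint
   from [s i j]. *)
have avoid i j k : (i < j < 4)%N -> (k < 4)%N -> k != i -> k != j -> b k \notin b i :: s i j.
  move=> ij k4 ki kj.
  have [l [l4 li lj lk]] : exists l, [/\ (l < 4)%N, l != i, l != j & l != k].
    by exists (6 - i - j - k)%N; split; clear -ij k4 ki kj; lia.
  have [kl|lk'] := ltnP k l.
    by apply/negP => /(dis i j k l); rewrite mem_head => h; apply/negP: isT; apply: h; lia.
  have lk2 : (l < k < 4)%N by lia.
  have [_ _ e] := Hs l k lk2.
  by apply/negP => /(dis i j l k); rewrite -e mem_last => h; apply/negP: isT; apply: h; lia.
(* Vertex 0 of K_5 is the outer point, hence the shift of the indices of [b] and [s]. *)
apply: (@k5_nonplanar R (fun i => if i == 0 then q else p (b i.-1))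
  (fun i j => if i == 0 then S (b j.-1) else walk_set d (b i.-1) (s i.-1 j.-1))).
- move=> i j ij; have j0 : (j == 0) = false by rewrite -val_eqE /=; lia.
  rewrite j0; case: eqP => [_|/eqP]; first by have [] := HS (b j.-1).
  rewrite -val_eqE /= => i0; have ij' : (i.-1 < j.-1 < 4)%N by have := ltn_ord j; lia.
  by have [sN ps <-] := Hs _ _ ij'; apply: walk_chainable.
- move=> i j k l ij kl; rewrite -!val_eqE /= => ik il jk jl.
  have j5 := ltn_ord j; have l5 := ltn_ord l.
  case: (eqVneq (i : nat) 0%N) => [i0|i0]; case: (eqVneq (k : nat) 0%N) => [k0|k0].
  + by move: ik; rewrite i0 k0 eqxx.
  + have kl' : (k.-1 < l.-1 < 4)%N by lia.
    have [_ wp _] := Hs _ _ kl'.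
    by apply: (fan_far_apart D HS wp); apply: avoid => //; lia.
  + have ij' : (i.-1 < j.-1 < 4)%N by lia.
    have [_ wp _] := Hs _ _ ij'; apply: far_apart_sym.
    by apply: (fan_far_apart D HS wp); apply: avoid => //; lia.
  + have ij' : (i.-1 < j.-1 < 4)%N by lia.
    have kl' : (k.-1 < l.-1 < 4)%N by lia.
    have [_ wp _] := Hs _ _ ij'; have [_ wp' _] := Hs _ _ kl'.
    by apply: (walk_far_apart D wp wp'); apply: dis => //; lia.
Qed.
End ForbiddenSubdivisions.

(** * Extremality of the fan *)
Section EdgeBound.
Variable G : sgraph.

(** The conclusion of [outerplanar_no_k4], isolated so that the combinatorial part is free of
    drawings. Paths with a common branch vertex may meet elsewhere, since the parity count only sees
    independent pairs. *)
Definition no_k4_subdivision := forall (b : nat -> G) (s : nat -> nat -> seq G),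
  (forall i j, (i < j < 4)%N ->
     [/\ s i j != [::], path (@edge G) (b i) (s i j) & last (b i) (s i j) = b j]) ->
  (forall i j k l, (i < j < 4)%N -> (k < l < 4)%N -> i != k -> i != l -> j != k -> j != l ->
     forall v, v \in b i :: s i j -> v \notin b k :: s k l) -> False.

Definition no_k23_subdivision := forall (u z a b c : G) (s : seq G),
  uniq [:: u; z; a; b; c] -> edge u a -> edge u b -> edge u c -> edge z a -> edge z b ->
  path (@edge G) z (rcons s c) -> (forall v, v \in s -> v \notin [:: u; a; b]) -> False.

Definition nbrs (X : {set G}) (x : G) : {set G} := [set y in X | edge x y].
Definition deg (X : {set G}) (x : G) : nat := #|nbrs X x|.

Lemma degE (X : {set G}) x : deg X x = (\sum_(y in X) edge x y)%N.
Proof.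
rewrite /deg -sum1dep_card big_mkcondr.
by apply: eq_bigr => y _; case: edge.
Qed.

Lemma deg_setD1 (X : {set G}) x y : x \in X -> deg X y = (deg (X :\ x) y + edge y x)%N.
Proof. by move=> xX; rewrite !degE (big_setD1 x xX) addnC. Qed.

Lemma sum_deg_setD1 (X : {set G}) x : x \in X ->
  (\sum_(y in X) deg X y = \sum_(y in X :\ x) deg (X :\ x) y + 2 * deg X x)%N.
Proof.
move=> xX; rewrite (big_setD1 x xX) /= (eq_bigr _ (fun y _ => deg_setD1 y xX)).
rewrite big_split /= addnCA mul2n -addnn; congr (_ + (_ + _))%N.
rewrite [RHS]degE (big_setD1 x xX) /= edge_irrefl.
by apply: eq_bigr => y _; rewrite edge_sym.
Qed.

(** The branch vertices are [v 0], [v i.-1], [v i] and [v m], with [m] beyond [i] but not beyond [j]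
    or [t]. Two branches to [v m] start with the chords to [v j] and [v t] and follow the path
    backwards; the others are the chord from [v 0] to [v i] and stretches of the path. *)
Lemma k4_of_crossing (v : nat -> G) (N i j t : nat) :
  (forall k, (k.+1 < N)%N -> edge (v k) (v k.+1)) ->
  (forall k l, (k < N)%N -> (l < N)%N -> v k = v l -> k = l) ->
  (1 < i)%N -> (i < j < N)%N -> (i < t < N)%N ->
  edge (v 0) (v i) -> edge (v 0) (v j) -> edge (v i.-1) (v t) ->
  ~ no_k4_subdivision.
Proof.
move=> ve vi i1 ij it ei ej et.
have [m m3] : exists m, (m <= j)%N && (m <= t)%N && (i < m)%N by exists (minn j t); lia.
have up a n : (a + n < N)%N -> path (@edge G) (v a) (map v (iota a.+1 n)) /\
    last (v a) (map v (iota a.+1 n)) = v (a + n)%N.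
  elim: n a => [|n IHn] a aN; first by rewrite addn0.
  have [p1 p2] := IHn a.+1 ltac:(lia); split => /=; last by rewrite p2 addSnnS.
  by rewrite p1 andbT ve //; lia.
have down a n : (a + n < N)%N -> path (@edge G) (v (a + n)%N) (map v (rev (iota a n))) /\
    last (v (a + n)%N) (map v (rev (iota a n))) = v a.
  elim: n => [|n IHn] aN; first by rewrite addn0.
  have [p1 p2] := IHn ltac:(lia).
  rewrite -addn1 iotaD rev_cat /= addn1 addnS p1 p2 andbT; split => //.
  by rewrite edge_sym ve //; lia.
(* The default value of [nth] supplies [m] as the position of the fourth branch vertex. *)
pose bi k := nth m [:: 0; i.-1; i]%N k.
pose ix k l := match k, l with
  | 0, 1 => iota 1 i.-1
  | 0, 2 => [:: i]
  | 0, 3 => rev (iota m (j.+1 - m))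
  | 1, 2 => [:: i]
  | 1, 3 => rev (iota m (t.+1 - m))
  | _, _ => iota i.+1 (m - i)
  end%N.
pose six := [:: (0, 1); (0, 2); (0, 3); (1, 2); (1, 3); (2, 3)]%N.
have sixP k l : (k < l < 4)%N -> (k, l) \in six.
  by case: k => [|[|[|[|k]]]]; case: l => [|[|[|[|l]]]] // ?; exfalso; lia.
move=> H; apply: (H (v \o bi) (fun k l => map v (ix k l))).
- move=> k l /sixP.
  have e1 : (i.-1).+1 = i by lia.
  have jump a c : (m <= c < N)%N -> edge (v a) (v c) -> [/\ [seq v x | x <- rev (iota m (c.+1 - m))] != [::],
      path (@edge G) (v a) [seq v x | x <- rev (iota m (c.+1 - m))] &
      last (v a) [seq v x | x <- rev (iota m (c.+1 - m))] = v m].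
    move=> mc ac; have -> : (c.+1 - m = (c - m) + 1)%N by lia.
    have [p1 p2] := down m (c - m)%N ltac:(lia).
    have e : (m + (c - m) = c)%N by lia.
    rewrite iotaD rev_cat /=; rewrite e in p1 p2 *.
    by rewrite ac p1 p2.
  rewrite !inE => /or4P[/eqP[-> ->]|/eqP[-> ->]|/eqP[-> ->]|/or3P[/eqP[-> ->]|/eqP[-> ->]|/eqP[-> ->]]]; rewrite /ix /bi /=.
  + have [p1 p2] := up 0 i.-1 ltac:(lia); split => //.
    by rewrite -size_eq0 size_map size_iota; lia.
  + by rewrite ei.
  + by apply: jump => //; lia.
  + by split => //=; rewrite -{2}e1 ve //; lia.
  + by apply: jump => //; lia.
  + have [p1 p2] := up i (m - i)%N ltac:(lia); split => //.
      by rewrite -size_eq0 size_map size_iota; lia.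
    by rewrite p2; congr v; lia.
- move=> k l k' l' kl kl' n1 n2 n3 n4 w.
  rewrite /comp -!map_cons => /mapP[a ha ->]; apply/negP => /mapP[c hc e].
  (* A range of positions for each branch reduces disjointness to arithmetic. *)
  pose Q k l x := match k, l with
    | 0, 1 => x < i
    | 0, 2 => (x == 0) || (x == i)
    | 0, 3 => (x == 0) || (m <= x <= j)
    | 1, 2 => (x == i.-1) || (x == i)
    | 1, 3 => (x == i.-1) || (m <= x <= t)
    | _, _ => i <= x <= m
    end%N.
  have memQ k0 l0 x : (k0 < l0 < 4)%N -> x \in bi k0 :: ix k0 l0 -> Q k0 l0 x.
    move=> /sixP; rewrite !inE.
    move=> /or4P[/eqP[-> ->]|/eqP[-> ->]|/eqP[-> ->]|/or3P[/eqP[-> ->]|/eqP[-> ->]|/eqP[-> ->]]];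
      rewrite /ix /bi /Q /= ?inE ?mem_rev ?mem_iota; clear -i1 ij it m3; lia.
  have Qbnd k0 l0 x : (k0 < l0 < 4)%N -> Q k0 l0 x -> (x < N)%N.
    move=> /sixP; rewrite !inE.
    by move=> /or4P[/eqP[-> ->]|/eqP[-> ->]|/eqP[-> ->]|/or3P[/eqP[-> ->]|/eqP[-> ->]|/eqP[-> ->]]];
      rewrite /Q; clear -i1 ij it m3; lia.
  have Qa := memQ _ _ _ kl ha; have Qc := memQ _ _ _ kl' hc.
  have ac : a = c by apply: vi e; [apply: Qbnd Qa | apply: Qbnd Qc].
  move: kl kl' n1 n2 n3 n4 Qa Qc => /sixP kl /sixP kl'; rewrite -{}ac.
  move: kl kl'; rewrite !inE.
  clear -i1 ij it m3; move=>
    /or4P[/eqP[-> ->]|/eqP[-> ->]|/eqP[-> ->]|/or3P[/eqP[-> ->]|/eqP[-> ->]|/eqP[-> ->]]]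
    /or4P[/eqP[-> ->]|/eqP[-> ->]|/eqP[-> ->]|/or3P[/eqP[-> ->]|/eqP[-> ->]|/eqP[-> ->]]] //= _ _ _ _; rewrite /Q; lia.
Qed.

(* Take a longest path [s] whose first vertex has a neighbour [s_i] with [i >= 2]
   as small as possible.  Reversing the initial segment gives another longest path,
   starting at [s_(i-1)]; by minimality its remaining neighbours lie beyond [s_i]. *)
Lemma low_degree_vertex (X : {set G}) : no_k4_subdivision -> (0 < #|X|)%N ->
  exists2 x, x \in X & (deg X x <= 2)%N.
Proof.
move=> noK4 X0; apply: contrapT => nlow.
have big x : x \in X -> (2 < deg X x)%N.
  by move=> xX; rewrite ltnNge; apply/negP => h; apply: nlow; exists x.
have [x0 x0X] := card_gt0P X0.
pose P s := [&& uniq s, all (mem X) s & sorted (@edge G) s].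
pose E n := [exists s : n.-tuple G, P s].
have E1 : exists n, E n.
  by exists 1%N; apply/existsP; exists [tuple x0]; rewrite /P /= ?inE x0X.
have Ebnd n : E n -> (n <= #|G|)%N.
  case/existsP=> s /andP[us _]; rewrite -(size_tuple s) -(card_uniqP us); exact: max_card.
have [N EN Nmax] := ex_maxnP E1 Ebnd.
have maxP s : P s -> (size s <= N)%N.
  by move=> Ps; apply: Nmax; apply/existsP; exists (in_tuple s).
have nbr_in s y : P s -> size s = N -> y \in nbrs X (nth x0 s 0) -> y \in s.
  have Px : P [:: x0] by rewrite /P /= x0X.
  case: s => [|x s]; first by move=> _ N0; have := maxP _ Px; rewrite -N0.
  move=> /and3P[us as_ ss] sN; rewrite inE /= => /andP[yX xy].
  apply: contraT => ys.
  suff /maxP : P (y :: x :: s) by rewrite /= -sN /= ltnn.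
  by apply/and3P; split; [rewrite cons_uniq ys | rewrite /= yX | rewrite /= edge_sym xy].
have two s : P s -> size s = N -> exists j1 j2, [/\ (1 < j1 < j2)%N, (j2 < N)%N,
    edge (nth x0 s 0) (nth x0 s j1) & edge (nth x0 s 0) (nth x0 s j2)].
  move=> Ps sN.
  have hd : nth x0 s 0 \in X.
    by case/and3P: Ps => _; case: s sN => [|x s] //= _ /andP[].
  have : (1 < #|nbrs X (nth x0 s 0) :\ nth x0 s 1|)%N.
    have := big _ hd; rewrite /deg (cardsD1 (nth x0 s 1)).
    by case: (_ \in nbrs _ _) => /=; lia.
  move=> /card_gt1P[y1 [y2 [h1 h2 y12]]].
  have idx y : y \in nbrs X (nth x0 s 0) :\ nth x0 s 1 ->
      [/\ (1 < index y s < N)%N, edge (nth x0 s 0) y & y \in s].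
    rewrite in_setD1 => /andP[y1' yn]; have ys := nbr_in _ _ Ps sN yn.
    have xy : edge (nth x0 s 0) y by move: yn; rewrite inE => /andP[].
    split => //; rewrite -sN index_mem ys andbT.
    case e: (index y s) => [|[|k]] //.
      by move: xy; rewrite -e nth_index // edge_irrefl.
    by move: y1'; rewrite -e nth_index // eqxx.
  have [i1 e1 s1] := idx _ h1; have [i2 e2 s2] := idx _ h2.
  case: (ltngtP (index y1 s) (index y2 s)) => h.
  - by exists (index y1 s), (index y2 s); rewrite !nth_index //; split => //; clear -i1 i2 h; lia.
  - by exists (index y2 s), (index y1 s); rewrite !nth_index //; split => //; clear -i1 i2 h; lia.
  - by move: y12; rewrite -(nth_index x0 s1) h nth_index ?eqxx.
pose Q i := [exists s : N.-tuple G, [&& P s, (1 < i < N)%N & edge (nth x0 s 0) (nth x0 s i)]].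
have QP s i : P s -> size s = N -> (1 < i < N)%N -> edge (nth x0 s 0) (nth x0 s i) -> Q i.
  move=> Ps sN iN e; have sN' : size s == N by apply/eqP.
  by apply/existsP; exists (Tuple sN'); rewrite /= Ps iN.
have exQ : exists i, Q i.
  have [s Ps] := existsP EN; have [j1 [j2 [h1 h2 h3 h4]]] := two s Ps (size_tuple s).
  by exists j1; apply: (QP s) => //; [rewrite size_tuple | clear -h1 h2; lia].
have [i /existsP[s /and3P[Ps iN ei]] imin] := ex_minnP exQ.
have sN := size_tuple s.
have [j1 [j [h1 h2 ej1 ej]]] := two s Ps sN.
have ij : (i < j)%N.
  by apply: (@leq_ltn_trans j1); [apply: imin; apply: (QP s) => //; clear -h1 h2; lia | clear -h1; lia].
pose s' := rev (take i s) ++ drop i s.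
have szt : size (take i s) = i by rewrite size_takel // sN; clear -iN; lia.
have nth' k : nth x0 s' k = if (k < i)%N then nth x0 s (i - k.+1) else nth x0 s k.
  rewrite nth_cat size_rev szt; case: ltnP => ki.
    by rewrite nth_rev szt // nth_take //; clear -ki; lia.
  by rewrite nth_drop subnKC.
have sN' : size s' = N by rewrite size_cat size_rev -size_cat cat_take_drop.
have ps' : perm_eq s' s by rewrite -[X in perm_eq _ X](cat_take_drop i s) perm_cat2r perm_rev.
have Ps' : P s'.
  case/and3P: Ps => us as_ /(sortedP x0) ss; apply/and3P; split.
  - by rewrite (perm_uniq ps').
  - by rewrite (perm_all _ ps').
  - apply/(sortedP x0) => k; rewrite sN' => kN; rewrite !nth'.
    case: (ltngtP k.+1 i) => ki.
    + rewrite edge_sym; have -> : (i - k.+1 = (i - k.+2).+1)%N by clear -ki; lia.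
      by apply: ss; rewrite sN; clear -ki iN; lia.
    + by apply: ss; rewrite sN.
    + by rewrite ki subnn.
have [t1 [t [k1 k2 et1 et]]] := two s' Ps' sN'.
have it : (i < t)%N.
  have : (i <= t1)%N by apply: imin; apply: (QP s') => //; clear -k1 k2; lia.
  by clear -k1; lia.
case/and3P: Ps => us _ ss.
apply: (@k4_of_crossing (nth x0 s) N i j t) noK4 => //; try (clear -iN ij h2 it k2; lia).
- by move=> k kN; apply: (sortedP x0 ss); rewrite sN.
- by move=> k l kN lN /eqP; rewrite nth_uniq ?sN // => /eqP.
- have i0 : (0 < i)%N by clear -iN; lia.
  by move: et; rewrite !nth' i0 subn1 ltnNge ltnW.
Qed.

(** Deleting a vertex of degree at most 2 removes at most two edges, so the bound 2n - 3 on the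
    number of edges follows by induction; it is doubled here into a degree sum. *)
Lemma edge_bound (X : {set G}) : no_k4_subdivision -> (1 < #|X|)%N ->
  (\sum_(x in X) deg X x + 6 <= 4 * #|X|)%N.
Proof.
move=> noK4; have [n] := ubnP #|X|; elim: n X => // n IHn X Xn X1.
have [x xX dx] := low_degree_vertex noK4 (ltnW X1).
pose Y := X :\ x.
have XY : #|X| = #|Y|.+1 by rewrite (cardsD1 x) xX.
have sE := sum_deg_setD1 xX; rewrite -/Y in sE.
have [Y1|Y1] := ltnP 1 #|Y|.
  have := IHn Y ltac:(lia) Y1; rewrite sE XY.
  by move: (deg X x) (\sum_(y in Y) _)%N dx => a b; clear; lia.
have Y1' : #|Y| = 1%N by lia.
have [y Yy] : exists y, Y = [set y]%SET by apply/cards1P; rewrite Y1'.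
have := deg_setD1 x xX; rewrite -/Y sE XY Y1' -/Y !Yy big_set1 edge_irrefl addn0.
rewrite !degE !big_set1 edge_irrefl => ->.
by case: edge.
Qed.

End EdgeBound.

(** * Neighbours and non-neighbours of a vertex *)

Section Neighbourhood.
Variable G : sgraph.
Hypotheses (noK4 : no_k4_subdivision G) (noK23 : no_k23_subdivision G).
Variables (S : {set G}) (u : G).
Hypothesis uS : u \in S.

Definition far_part : {set G} := [set z in S | (z != u) && ~~ edge u z].

Local Notation N := (nbrs S u).
Local Notation W := far_part.

Lemma nbrsP z : z \in N -> [/\ z \in S, edge u z & z != u].
Proof.
rewrite inE => /andP[zS uz]; split => //.
by apply: contraTneq uz => ->; rewrite edge_irrefl.
Qed.

(** Three common neighbours of [u] and [z] would form a K_{2,3}. *)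
Lemma deg_nbrs_le2 z : z != u -> (deg N z <= 2)%N.
Proof.
move=> zu; rewrite leqNgt; apply/negP => /card_gt2P[a [b [c [[ha hb hc] [ab bc ca]]]]].
move: ha hb hc; rewrite !inE => /andP[/andP[aS ua] za] /andP[/andP[bS ub] zb] /andP[/andP[cS uc] zc].
have ne (x y : G) : edge x y -> x != y by apply: contraTneq => ->; rewrite edge_irrefl.
apply: (@noK23 u z a b c [::]) => //=; last by rewrite zc.
rewrite !inE !negb_or (eq_sym u z) zu (eq_sym a c) ab bc ca.
by rewrite (ne _ _ ua) (ne _ _ ub) (ne _ _ uc) (ne _ _ za) (ne _ _ zb) (ne _ _ zc).
Qed.

Lemma card_parts : #|S| = (1 + #|N| + #|W|)%N.
Proof.
rewrite (cardsD1 u) uS -addnA; congr (_ + _)%N.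
rewrite -cardsUI [X in (_ + X)%N]eq_card0 ?addn0 => [|z].
  apply: eq_card => z; rewrite !inE; case: (eqVneq z u) => [->|zu] /=.
    by rewrite edge_irrefl andbF.
  by case: (z \in S) => //=; rewrite orbN.
by rewrite !inE; case: (edge u z); rewrite ?andbF.
Qed.

(** The vertex [u] contributes #|N| edges to [u |: N], so [edge_bound] leaves at most #|N| - 1 edges
    inside [N], as in a forest. *)
Lemma sum_deg_nbrs : (0 < #|N|)%N -> (\sum_(z in N) deg N z + 2 <= 2 * #|N|)%N.
Proof.
move=> N0; have uN : u \notin N by rewrite inE edge_irrefl andbF.
have E : #|u |: N| = #|N|.+1 by rewrite cardsU1 uN.
have := @edge_bound G (u |: N) noK4; rewrite E => /(_ ltac:(lia)).
rewrite (sum_deg_setD1 (setU11 u N)) setU1K //.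
have -> : deg (u |: N) u = #|N|.
  by apply: eq_card => z; rewrite !inE; case: (eqVneq z u) => [->|_] /=; [rewrite edge_irrefl !andbF | case: (z \in S); case: edge].
by move: (\sum_(z in N) _)%N #|N| N0 => a b; clear; lia.
Qed.

Definition edge_in (X : {set G}) : rel G := fun x y => [&& edge x y, x \in X & y \in X].

Lemma path_edge_in (X : {set G}) x s : path (edge_in X) x s -> path (@edge G) x s && all (mem X) s.
Proof.
elim: s x => //= y s IHs x /andP[/and3P[xy _ yX] /IHs/andP[ps as_]].
by rewrite xy ps yX as_.
Qed.

(** If [z] and [z'] have the same two neighbours [a], [b] in [N], then [a] and [b] have the common
    neighbours [u], [z], [z']. Otherwise [z'] has another neighbour [c] in [N], and the path from
    [z] through [z'] to [c] subdivides a branch of a K_{2,3} on [u], [z] and [a], [b], [c]. *)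
Lemma double_unique z z' : z \in W -> connect (edge_in W) z z' ->
  deg N z = 2%N -> deg N z' = 2%N -> z' \in W -> z = z'.
Proof.
move=> zW /connectP[p pp z'E] dz dz' z'W; apply/eqP/contraT => zz'.
have /andP[pe pW] := path_edge_in pp.
have /cards2P[a [b [ab Nz]]] : #|nbrs N z| == 2%N by rewrite -/(deg N z) dz.
have NW x y : x \in N -> y \in W -> x != y.
  rewrite !inE => /andP[_ ux] /and3P[_ _ nuy]; apply: contraNneq nuy => <-.
  by [].
have inN x y : x \in nbrs N y -> x \in N /\ edge y x.
  by move=> h; move: h; rewrite inE => /andP[].
have [aN za] : a \in N /\ edge z a by apply: inN; rewrite Nz !inE eqxx.
have [bN zb] : b \in N /\ edge z b by apply: inN; rewrite Nz !inE eqxx orbT.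
have [aS ua au] := nbrsP aN; have [bS ub bu] := nbrsP bN.
have uW x : x \in W -> x != u by rewrite inE => /and3P[].
have [sub|/subsetPn[c]] := boolP (nbrs N z' \subset nbrs N z).
  have e : nbrs N z' = nbrs N z.
    by apply/eqP; rewrite eqEcard sub; rewrite -/(deg N z) -/(deg N z') dz dz'.
  have [_ z'a] : a \in N /\ edge z' a by apply: inN; rewrite e Nz !inE eqxx.
  have [_ z'b] : b \in N /\ edge z' b by apply: inN; rewrite e Nz !inE eqxx orbT.
  have flip x y : edge x y -> edge y x by rewrite edge_sym.
  exfalso; apply: (@noK23 a b u z z' [::]) => //=; try exact: flip.
    2: by rewrite flip.
  rewrite !inE !negb_or ab au bu zz' (eq_sym u z) (eq_sym u z') !uW //.
  by rewrite !NW.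
rewrite inE => /andP[cN z'c] cz; have [cS uc cu] := nbrsP cN.
exfalso; apply: (@noK23 u z a b c p) => //=.
- rewrite !inE !negb_or eq_sym uW // (eq_sym u) au (eq_sym u) bu (eq_sym u) cu ab /=.
  rewrite !(eq_sym z) (NW _ _ aN zW) (NW _ _ bN zW) (NW _ _ cN zW) /=.
  by apply/andP; split; rewrite ?andbT; apply: contraNneq cz => <-; rewrite Nz !inE eqxx ?orbT.
- by rewrite rcons_path pe -z'E.
- move=> v /(allP pW) vW; rewrite !inE !negb_or uW //=.
  by rewrite !(eq_sym v) (NW _ _ aN vW) (NW _ _ bN vW).
Qed.
End Neighbourhood.

Section FarWeights.
Variables (R : realType) (G : sgraph).
Hypotheses (noK4 : no_k4_subdivision G) (noK23 : no_k23_subdivision G).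
Variables (S : {set G}) (u : G).
Hypothesis uS : u \in S.
Variables (l : R) (w : G -> R).
Hypotheses (w_ge0 : forall z, 0 <= w z) (w_le1 : forall z, w z <= 1).
Hypothesis w_eigen : forall z, z \in S -> l * w z = \sum_(y in S) (edge z y)%:R * w y.

Local Notation N := (nbrs S u).
Local Notation W := (far_part S u).

Lemma weight_le_deg z : z \in S -> l * w z <= (deg S z)%:R.
Proof.
move=> zS; rewrite w_eigen // degE natr_sum ler_sum // => y _.
by rewrite ler_piMr // ler0n.
Qed.

(** Each weight satisfies [l * w z <= deg S z], and at most one vertex of [C] has two neighbours in
    [N]. So the sum is at most #|C| + 1, plus twice the number of edges inside [C], plus one further
    weight for that vertex. *)
Lemma far_component_bound (C : {set G}) : 29 / 5 <= l -> C \subset W -> (0 < #|C|)%N ->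
  (forall z y, z \in C -> y \in W -> edge z y -> y \in C) ->
  (forall z y, z \in C -> y \in C -> connect (edge_in W) z y) ->
  l * (\sum_(z in C) (deg N z)%:R * w z) + 3 / 2 < l * #|C|%:R.
Proof.
move=> l_big.
(* The cases of 1, 2 and at least 3 vertices. In the first two the further weight is bounded by a
   degree, for totals of 4 and 8. In the third it is bounded by [l], the rest by 5#|C| - 5 through
   [edge_bound]; this is the case that needs l > 23/4. *)
have l1 : 4 + 3 / 2 < l by lra.
have l2 : 8 + 3 / 2 < l * 2%:R by lra.
have l3 a b : a <= 5 * b - 5 -> 3 <= b -> a + l + 3 / 2 < l * b by nra.
move=> /fintype.subsetP CW C0 Ccl Cconn.
have Wu z : z \in W -> [/\ z \in S, z != u & ~~ edge u z].
  by rewrite inE => /and3P[].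
pose T := [set z in C | deg N z == 2%N].
have T1 : (#|T| <= 1)%N.
  apply/card_le1P => z; rewrite inE => /andP[zC /eqP dz] y.
  rewrite !inE; apply/andP/eqP => [[yC /eqP dy]|->]; last by rewrite zC dz.
  by apply/esym; apply: (@double_unique G noK23 S u) => //; [apply: CW | apply: Cconn | apply: CW].
have e_le z : z \in C -> (deg N z <= 1 + (z \in T))%N.
  move=> zC; have [_ zu _] := Wu _ (CW _ zC).
  have := @deg_nbrs_le2 G noK23 S u z zu; rewrite inE zC /=.
  by case: ltngtP => //=; lia.
have degS z : z \in C -> deg S z = (deg N z + deg C z)%N.
  move=> zC; have [zS zu nuz] := Wu _ (CW _ zC).
  rewrite /deg -cardsUI [X in (_ + X)%N]eq_card0 ?addn0 => [|y]; last first.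
    rewrite !inE; case: (boolP (y \in C)) => [/CW/Wu[_ _ /negbTE ->]|]; last by rewrite !andbF.
    by rewrite !andbF.
  apply: eq_card => y; rewrite !inE; case: (boolP (edge z y)) => zy; rewrite ?andbF //= !andbT.
  have yu : y != u by apply: contraTneq zy => ->; rewrite edge_sym.
  case: (boolP (y \in C)) => [/CW/Wu[-> _ _]|yC]; first by rewrite orbT.
  rewrite orbF; case: (boolP (y \in S)) => //= yS; apply/esym.
  by apply: contraNT yC => nuy; apply: (Ccl z) => //; rewrite inE yS yu.
have degC z : z \in C -> (deg C z < #|C|)%N.
  move=> zC; apply: proper_card; apply/fintype.properP; split; first by apply/fintype.subsetP => y; rewrite inE => /andP[].
  by exists z => //; rewrite inE edge_irrefl andbF.
pose s := #|C|; pose D := (\sum_(z in C) deg C z)%N.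
have D1 : (D <= s * s.-1)%N.
  rewrite /s -sum_nat_const leq_sum // => z zC.
  by rewrite -ltnS (ltn_predK (degC z zC)) degC.
have D2 : (1 < s)%N -> (D + 6 <= 4 * s)%N by apply: edge_bound.
have sb : (\sum_(z in C) (deg N z + deg C z) <= s + 1 + D)%N.
  rewrite big_split leq_add2r /=; apply: leq_trans (leq_sum _ e_le) _.
  rewrite big_split sum1_card leq_add2l; apply: leq_trans T1.
  by rewrite -sum1_card [leqRHS]big_mkcond [leqLHS]big_mkcond leq_sum // => z _; case: ifP; case: ifP.
(* [M] bounds the second copy of the weight of the vertex with two neighbours in [N]. *)
have key (M : R) : 0 <= M -> (forall z, z \in C -> l * w z <= M) ->
    l * (\sum_(z in C) (deg N z)%:R * w z) <= (s + 1 + D)%:R + M.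
  move=> M0 hM.
  have l0 : 0 <= l by apply: le_trans l_big; rewrite divr_ge0.
  apply: (@le_trans _ _ (\sum_(z in C) l * w z + \sum_(z in T) l * w z)).
    rewrite [X in _ <= _ + X]big_mkcond [X in _ <= X + _]big_mkcond -big_split /=.
    rewrite mulr_sumr big_mkcond ler_sum // => z _.
    case: ifP => zC; last by rewrite inE zC addr0.
    have lw0 : 0 <= l * w z by rewrite mulr_ge0.
    rewrite mulrCA; apply: (@le_trans _ _ ((1 + (z \in T))%:R * (l * w z))).
      by rewrite ler_wpM2r // ler_nat e_le.
    by rewrite natrD mulrDl mul1r lerD2l; case: (z \in T); rewrite ?mul1r ?mul0r.
  apply: lerD.
    apply: (@le_trans _ _ (\sum_(z in C) (deg N z + deg C z)%:R)).
      apply: ler_sum => z zC; rewrite -degS //; apply: weight_le_deg.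
      by have [] := Wu _ (CW _ zC).
    by rewrite -natr_sum ler_nat.
  apply: (@le_trans _ _ (\sum_(z in T) M)).
    by apply: ler_sum => z; rewrite inE => /andP[zC _]; apply: hM.
  by rewrite sumr_const -mulr_natr ler_piMr // lern1.
have small (z : G) : z \in C -> l * w z <= (1 + s)%:R.
  move=> zC; have [zS zu _] := Wu _ (CW _ zC).
  apply: le_trans (weight_le_deg zS) _; rewrite ler_nat degS //.
  have := @deg_nbrs_le2 G noK23 S u z zu; have := degC z zC; rewrite -/s.
  by move: (deg _ z) (deg _ z) => a b; clear; lia.
have l0 : 0 <= l by apply: le_trans l_big; rewrite divr_ge0.
rewrite -/s.
have [s1|[s2|s3]] : s = 1%N \/ s = 2%N \/ (2 < s)%N.
  by move: (C0 : (0 < s)%N); clearbody s; clear; lia.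
- have := key _ _ small; rewrite ler0n => /(_ isT) h; apply: (le_lt_trans (lerD h (lexx _))).
  have D3 : D = 0%N by move: D1; rewrite s1 /=; clear; lia.
  apply: (@le_lt_trans _ _ (4 + 3 / 2 : R)); last by rewrite s1 mulr1.
  by rewrite lerD2r -natrD ler_nat s1 D3.
- have := key _ _ small; rewrite ler0n => /(_ isT) h; apply: (le_lt_trans (lerD h (lexx _))).
  have D3 : (D <= 2)%N by move: D1; rewrite s2.
  apply: (@le_lt_trans _ _ (8 + 3 / 2 : R)); last by rewrite s2.
  by rewrite lerD2r -natrD ler_nat s2; clear -D3; clearbody D; lia.
- have := key l l0 (fun z _ => ler_piMr l0 (w_le1 z)) => h.
  apply: (le_lt_trans (lerD h (lexx _))).
  have D3 : (s + 1 + D + 5 <= 5 * s)%N by have := D2 (ltnW s3); clearbody D s; clear; lia.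
  have {}D3 : (s + 1 + D)%:R <= 5 * s%:R - 5 :> R.
    by rewrite lerBrDr -natrD -natrM ler_nat.
  have s3' : 3 <= s%:R :> R by rewrite ler_nat.
  exact: l3.
Qed.

Lemma far_part_bound : 29 / 5 <= l -> (0 < #|W|)%N ->
  l * (\sum_(z in W) (deg N z)%:R * w z) + 3 / 2 < l * #|W|%:R.
Proof.
move=> l_big.
(* Such an [X] is a union of components of [W]; each component leaves a margin of 3/2, of which one
   is kept. *)
suff H n (X : {set G}) : (#|X| < n)%N -> X \subset W ->
    (forall z y, z \in X -> y \in W -> edge z y -> y \in X) ->
    (0 < #|X|)%N -> l * (\sum_(z in X) (deg N z)%:R * w z) + 3 / 2 < l * #|X|%:R.
  by apply: (H #|W|.+1).
elim: n X => // n IHn X Xn XW Xcl X0.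
have [z0 z0X] := card_gt0P X0.
have z0W := fintype.subsetP XW _ z0X.
have sym : connect_sym (edge_in W).
  apply: sym_connect_sym => x y; rewrite /edge_in edge_sym.
  by rewrite [(x \in _) && _]andbC.
pose C := [set y in X | connect (edge_in W) z0 y].
have CX : C \subset X by apply/fintype.subsetP => y; rewrite inE => /andP[].
have z0C : z0 \in C by rewrite inE z0X connect0.
have Cpos : (0 < #|C|)%N by apply/card_gt0P; exists z0.
have step z y : z \in X -> y \in W -> edge z y -> edge_in W z y.
  by move=> zX yW zy; rewrite /edge_in zy yW (fintype.subsetP XW).
have Ccl z y : z \in C -> y \in W -> edge z y -> y \in C.
  rewrite inE => /andP[zX z0z] yW zy; rewrite inE (Xcl _ _ zX yW zy) /=.
  by apply: connect_trans z0z _; apply: connect1; apply: step.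
have Cb : l * (\sum_(z in C) (deg N z)%:R * w z) + 3 / 2 < l * #|C|%:R.
  apply: far_component_bound => //; first exact: fintype.subset_trans XW.
  move=> z y; rewrite !inE => /andP[_ z0z] /andP[_ z0y].
  by apply: connect_trans z0y; rewrite sym.
pose Y := X :\: C.
have XE : #|X| = (#|C| + #|Y|)%N by rewrite -(cardsID C X) (finset.setIidPr CX).
have sE : \sum_(z in X) (deg N z)%:R * w z =
    \sum_(z in C) (deg N z)%:R * w z + \sum_(z in Y) (deg N z)%:R * w z.
  by rewrite (big_setID C) (finset.setIidPr CX).
have [Y0|Y0] := posnP #|Y|.
  rewrite XE sE Y0 addn0 (cards0_eq Y0) big_set0 addr0; exact: Cb.
have Yb : l * (\sum_(z in Y) (deg N z)%:R * w z) + 3 / 2 < l * #|Y|%:R.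
  apply: IHn => //.
  - by move: Xn Cpos; rewrite XE; clear; lia.
  - by apply: fintype.subset_trans XW; apply: finset.subsetDl.
  - move=> z y; rewrite !finset.in_setD => /andP[zC zX] yW zy.
    rewrite (Xcl _ _ zX yW zy) andbT; apply: contra zC => yC.
    by apply: (Ccl y) => //; [apply: (fintype.subsetP XW) | rewrite edge_sym].
rewrite XE sE natrD !mulrDr; move: Cb Yb.
move: (l * _) (l * _) (l * _) (l * _) => a b c d; lra.
Qed.
End FarWeights.

(** * Recognizing an induced path by its degrees *)

Section InducedPath.
Variable G : sgraph.

Definition induced_path (s : seq G) := uniq s /\ forall x0 i j, (i < size s)%N -> (j < size s)%N ->
  edge (nth x0 s i) (nth x0 s j) = (i.+1 == j) || (j.+1 == i).

Lemma induced_path_rev s : induced_path s -> induced_path (rev s).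
Proof.
move=> [us es]; split; first by rewrite rev_uniq.
move=> x0 i j; rewrite size_rev => si sj; rewrite !nth_rev // es; clear -si sj; lia.
Qed.

Lemma induced_path_cons x y s : induced_path (y :: s) -> x \notin y :: s ->
  (forall z, z \in y :: s -> edge x z = (z == y)) -> induced_path (x :: y :: s).
Proof.
move=> [us es] xs exs; split; first by rewrite /= in us *; rewrite xs.
have uy : y \notin s by move: us => /= /andP[].
move=> x0 [|i] [|j] //= si sj.
- by rewrite edge_irrefl.
- rewrite exs ?mem_nth // eqSS orbF; case: j sj => [|j] /= sj; first by rewrite eqxx.
  by apply/negbTE; apply: contraNneq uy => <-; apply: mem_nth.
- rewrite edge_sym exs ?mem_nth // eqSS; case: i si => [|i] /= si; first by rewrite eqxx.
  by apply/negbTE; apply: contraNneq uy => <-; apply: mem_nth.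
- by rewrite es.
Qed.

Lemma even_sum_deg (X : {set G}) : ~~ odd (\sum_(x in X) deg X x).
Proof.
have [n] := ubnP #|X|; elim: n X => // n IHn X Xn.
have [/cards0_eq ->|/card_gt0P[x xX]] := posnP #|X|; first by rewrite big_set0.
rewrite (sum_deg_setD1 xX) oddD oddM /= addbF; apply: IHn.
by move: Xn; rewrite (cardsD1 x X) xX.
Qed.

(* the hypotheses say that [G[X]] is a forest, of maximum degree 2, and connected *)
Lemma induced_path_of_degrees (X : {set G}) :
  (forall Y : {set G}, Y \subset X -> (0 < #|Y|)%N -> (\sum_(z in Y) deg Y z + 2 <= 2 * #|Y|)%N) ->
  (forall z, z \in X -> (deg X z <= 2)%N) -> (\sum_(z in X) deg X z + 2 = 2 * #|X|)%N ->
  exists2 s, induced_path s & s =i X.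
Proof.
have [n] := ubnP #|X|; elim: n X => // n IHn X Xn forest dX sX.
have X0 : (0 < #|X|)%N by move: sX; case: #|X|; rewrite // muln0 addn2.
have [X1|X1] := leqP #|X| 1.
  have /cards1P[x ->] : #|X| == 1%N by rewrite eqn_leq X1.
  exists [:: x]; last by move=> y; rewrite !inE.
  by split => // x0 [|i] [|j] //= _ _; rewrite edge_irrefl.
have [x xX dx] : exists2 x, x \in X & (deg X x <= 1)%N.
  apply: contrapT => h; have : (\sum_(z in X) 2 <= \sum_(z in X) deg X z)%N.
    by apply: leq_sum => z zX; rewrite ltnNge; apply/negP => h'; apply: h; exists z.
  by rewrite sum_nat_const; move: sX; move: (\sum_(z in X) _)%N #|X| => a b; clear; lia.
pose Y := X :\ x.
have XY : #|X| = #|Y|.+1 by rewrite (cardsD1 x) xX.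
have Y0 : (0 < #|Y|)%N by move: X1; rewrite XY.
have YX : Y \subset X by apply: finset.subsetDl.
have sE := sum_deg_setD1 xX; rewrite -/Y in sE.
have [dx1 sY] : deg X x = 1%N /\ (\sum_(z in Y) deg Y z + 2 = 2 * #|Y|)%N.
  move: (forest Y YX Y0) sX dx; rewrite sE XY.
  by move: (deg X x) (\sum_(z in Y) _)%N #|Y| => a b c; clear; lia.
have [s ps sYE] : exists2 s, induced_path s & s =i Y.
  apply: IHn => //; first by move: Xn; rewrite XY.
    by move=> Z ZY; apply: forest; apply: fintype.subset_trans ZY YX.
  move=> z zY; apply: leq_trans (dX z _); last exact: (fintype.subsetP YX).
  by rewrite (deg_setD1 z xX) leq_addr.
have /cards1P[y Ny] : #|nbrs X x| == 1%N by rewrite -/(deg X x) dx1.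
have [yX xy] : y \in X /\ edge x y.
  have : y \in nbrs X x by rewrite Ny finset.inE.
  by rewrite finset.inE => /andP[].
have exz z : z \in Y -> edge x z = (z == y).
  move=> zY; have := fintype.subsetP YX z zY => zX.
  have : (z \in nbrs X x) = (z == y) by rewrite Ny finset.inE.
  by rewrite finset.inE zX.
have yx : y != x by apply: contraTneq xy => ->; rewrite edge_irrefl.
have yY : y \in Y by rewrite finset.in_setD1 yx.
have dy : (deg Y y <= 1)%N.
  by have := dX y yX; rewrite (deg_setD1 y xX) -/Y edge_sym xy addn1.
have final t : induced_path t -> t =i Y -> index y t = 0%N ->
    exists2 s, induced_path s & s =i X.
  case: t => [|a t] pt tY; first by move: yY; rewrite -tY.
  rewrite /=; case: eqP => // ay _; subst a.
  exists (x :: y :: t).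
    apply: induced_path_cons => //; first by rewrite tY finset.in_setD1 eqxx.
    by move=> z; rewrite tY; apply: exz.
  move=> z; rewrite inE tY finset.in_setD1; case: (eqVneq z x) => [->|] //=.
have ys : y \in s by rewrite sYE.
have [us es] := ps.
pose j := index y s; have js : (j < size s)%N by rewrite index_mem.
have sj : nth x s j = y by apply: nth_index.
have [j0|j0] := posnP j; first exact: (final s).
have [je|je] := eqVneq j.+1 (size s).
  apply: (final (rev s)); first exact: induced_path_rev.
    by move=> z; rewrite mem_rev.
  have : nth x (rev s) 0 = y by rewrite nth_rev -?je ?subn1 //= -sj; congr nth.
  by move=> <-; rewrite index_uniq ?rev_uniq // size_rev -je.
(* At an inner position [y] would have two neighbours on the path, besides the deleted leaf [x]. *)
exfalso; move: dy; rewrite leqNgt => /negP; apply; apply/card_gt1P.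
have je' : (j.+1 < size s)%N by rewrite ltn_neqAle je.
have jp : (j.-1 < size s)%N by apply: leq_ltn_trans (leq_pred _) js.
have e1 := es x j j.-1 js jp; have e2 := es x j j.+1 js je'.
rewrite sj prednK // eqxx orbT in e1; rewrite sj eqxx in e2.
exists (nth x s j.-1), (nth x s j.+1); split.
- by rewrite finset.inE -sYE mem_nth.
- by rewrite finset.inE -sYE mem_nth.
- by rewrite nth_uniq //; clear -j0; lia.
Qed.
End InducedPath.

Section FanExtremal.
Variables (R : realType) (G : sgraph).

Definition fan_set (S : {set G}) (u : G) (s : seq G) :=
  [/\ u \in S, induced_path s, s =i S :\ u & forall z, z \in S :\ u -> edge u z].

(* [l ^+ 2 - 2 * l] is the degree of the vertex [u] of largest weight, minus the
   defect of [G[N]] from being 2-regular, plus the contribution of the vertices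
   outside [N]; the hypothesis on [k] leaves no room unless all of [S] is
   adjacent to [u] and [G[N]] misses 2-regularity at two path ends only. *)
Theorem fan_of_large_eigenvalue (S : {set G}) (k : nat) (l : R) (w : G -> R) :
  no_k4_subdivision G -> no_k23_subdivision G ->
  29 / 5 <= l -> k%:R <= l ^+ 2 - 2 * l + 7 / 2 / l -> (#|S| <= k.+1)%N ->
  (forall z, 0 <= w z) -> (forall z, z \notin S -> w z = 0) -> (exists z, w z != 0) ->
  (forall z, z \in S -> l * w z = \sum_(y in S) (edge z y)%:R * w y) ->
  #|S| = k.+1 /\ exists u s, fan_set S u s.
Proof.
move=> noK4 noK23 l_big kl Sk w0 wS [z0 wz0] weig.
pose u := [arg max_(z > z0) w z]%O.
have wu z : w z <= w u by rewrite /u; case: Order.TotalTheory.arg_maxP => // j _; apply.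
have wu_gt0 : 0 < w u by apply: lt_le_trans (wu z0); rewrite lt_neqAle eq_sym wz0 w0.
have uS : u \in S by apply: contraTT wu_gt0 => /wS ->; rewrite ltxx.
pose v z := w z / w u.
have v0 z : 0 <= v z by rewrite divr_ge0 // ltW.
have v1 z : v z <= 1 by rewrite ler_pdivrMr // mul1r.
have vu : v u = 1 by rewrite /v divff // gt_eqF.
have veig z : z \in S -> l * v z = \sum_(y in S) (edge z y)%:R * v y.
  by move=> zS; rewrite /v mulrA weig // mulr_suml; apply: eq_bigr => y _; rewrite mulrA.
pose N := nbrs S u; pose W := far_part S u.
have l_gt0 : 0 < l by lra.
have parts F : \sum_(z in S) F z = F u + \sum_(z in N) F z + \sum_(z in W) F z :> R.
  rewrite (big_setD1 u uS) /= -addrA; congr (_ + _).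
  rewrite (big_setID [set z | edge u z]) /=; congr (_ + _); apply: eq_bigl => z.
    rewrite !inE; case: (eqVneq z u) => [->|_] //=; by rewrite edge_irrefl andbF.
  by rewrite !inE; case: (z \in S); case: (edge u z); case: (z == u).
have lN : l = \sum_(z in N) v z.
  rewrite -[l]mulr1 -vu veig // parts edge_irrefl mul0r add0r [X in _ + X]big1 ?addr0.
    by apply: eq_bigr => z; rewrite inE => /andP[_ ->]; rewrite mul1r.
  by move=> z; rewrite inE => /and3P[_ _ /negbTE ->]; rewrite mul0r.
have degR (X : {set G}) z : (deg X z)%:R = \sum_(y in X) (edge z y)%:R :> R.
  by rewrite degE natr_sum.
pose E := \sum_(z in W) (deg N z)%:R * v z.
pose Dn := \sum_(z in N) (deg N z)%:R * v z.
have l2 : l * l = #|N|%:R + Dn + E.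
  rewrite {2}lN mulr_sumr (eq_bigr (fun z => \sum_(y in S) (edge z y)%:R * v y)); last first.
    by move=> z; rewrite inE => /andP[zS _]; apply: veig.
  rewrite exchange_big /= (eq_bigr (fun y => (deg N y)%:R * v y)); last first.
    by move=> y _; rewrite degR mulr_suml; apply: eq_bigr => z _; rewrite edge_sym.
  rewrite parts vu mulr1; congr (_%:R + _ + _).
  by apply: eq_card => z; rewrite !inE; case: edge; rewrite ?andbF ?andbT.
have N0 : (0 < #|N|)%N.
  rewrite lt0n; apply: contraTneq l_gt0 => /cards0_eq N0.
  by rewrite lN N0 big_set0 ltxx.
have dN2 z : z \in N -> (deg N z <= 2)%N.
  by move=> /nbrsP[_ _ zu]; apply: deg_nbrs_le2.
have vN z : z \in N -> 1 <= l * v z.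
  move=> zN; have [zS uz zu] := nbrsP zN.
  rewrite veig // (bigD1 u) //= edge_sym uz vu mulr1 lerDl sumr_ge0 // => y _.
  by rewrite mulr_ge0.
pose q := (\sum_(z in N) deg N z)%N.
have q2 : (q + 2 <= 2 * #|N|)%N by apply: sum_deg_nbrs.
(* Each (2 - deg)(l v - 1) is nonnegative: a neighbour of [u] has degree at most 2 in [N], and l v
   >= 1 because it is adjacent to [u], whose weight is 1. *)
have lD : l * Dn <= 2 * l * l - (2 * #|N|%:R - q%:R).
  have : 0 <= \sum_(z in N) (2 - (deg N z)%:R) * (l * v z - 1).
    apply: sumr_ge0 => z zN; rewrite mulr_ge0 ?subr_ge0 ?vN //.
    by rewrite (ler_nat R _ 2) dN2.
  rewrite (eq_bigr (fun z => 2 * l * v z - (l * ((deg N z)%:R * v z)) - 2 + (deg N z)%:R)); last first.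
    by move=> z _; ring.
  rewrite !big_split /= !sumrN -!mulr_sumr -lN -/Dn sumr_const -natr_sum -/q -[2 *+ _]mulr_natr.
  by move=> h; lra.
have sN : (#|S| = 1 + #|N| + #|W|)%N by apply: card_parts.
have kl' : l * k%:R <= l * l * l - 2 * l * l + 7 / 2.
  have -> : l * l * l - 2 * l * l + 7 / 2 = l * (l ^+ 2 - 2 * l + 7 / 2 / l).
    by field; rewrite gt_eqF.
  by rewrite ler_pM2l.
have lll : l * l * l = l * #|N|%:R + l * Dn + l * E by rewrite -!mulrDr l2 mulrC.
(* The deficit 2 of a forest on [N] and the strict margin 3/2 of [far_part_bound] together exhaust
   7/2. *)
have W0 : #|W| = 0%N.
  apply/eqP; rewrite -leqn0 leqNgt; apply/negP => W0.
  have Eb : l * E + 3 / 2 < l * #|W|%:R by apply: far_part_bound.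
  have h1 : l * (#|N|%:R + #|W|%:R) <= l * k%:R.
    by rewrite ler_pM2l // -natrD ler_nat; move: Sk; rewrite sN; clear; lia.
  have h2 : q%:R + 2 <= 2 * #|N|%:R :> R by rewrite -natrD -natrM ler_nat.
  move: h1; rewrite mulrDr => h1.
  by lra.
have E0 : E = 0 by rewrite /E (cards0_eq W0) big_set0.
have Nk : #|N| = k.
  apply/eqP; rewrite eqn_leq; apply/andP; split; first by move: Sk; rewrite sN W0; clear; lia.
  rewrite leqNgt; apply/negP => Nk.
  have h1 : l * (#|N|%:R + 1) <= l * k%:R by rewrite ler_pM2l // natr1 ler_nat.
  have h2 : q%:R + 2 <= 2 * #|N|%:R :> R by rewrite -natrD -natrM ler_nat.
  by rewrite mulrDr in h1; rewrite E0 in lll; lra.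
(* The deficit 2#|N| - q is at least 2 and at most 7/2; 3 is excluded because degree sums are
   even. *)
have q3 : (q + 2 = 2 * #|N|)%N.
  have h : 2 * #|N|%:R - q%:R <= 7 / 2 :> R.
    by rewrite -Nk in kl'; rewrite E0 in lll; lra.
  have h4 : (2 * #|N| < q + 4)%N.
    by rewrite -(ltr_nat R) natrD natrM; lra.
  have := even_sum_deg N; rewrite -/q.
  by move: q2 h4; clear; lia.
split; first by rewrite sN W0 Nk; clear; lia.
have NE : N = S :\ u.
  apply/setP => z; rewrite !inE; case: (eqVneq z u) => [->|zu]; first by rewrite edge_irrefl andbF.
  case zS: (z \in S) => //=; have : z \notin W by rewrite (cards0_eq W0) inE.
  by rewrite inE zS zu /= negbK.
(* The forest condition on a subset [Y] of [N] is [sum_deg_nbrs] for the set [u |: Y]. *)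
have [|s ps sE] := @induced_path_of_degrees G N _ dN2 q3.
  move=> Y YN Y0.
  have uY : u \notin Y by apply/negP => /(fintype.subsetP YN); rewrite inE edge_irrefl andbF.
  have := @sum_deg_nbrs G noK4 (u |: Y) u.
  have -> : nbrs (u |: Y) u = Y.
    apply/setP => z; rewrite !inE; case: (eqVneq z u) => [->|zu] /=.
      by rewrite edge_irrefl (negbTE uY).
    case zY: (z \in Y) => //=; have := fintype.subsetP YN z zY.
    by rewrite inE => /andP[].
  by apply => //; apply: setU11.
exists u, s; split => //; first by rewrite -NE.
by move=> z; rewrite -NE inE => /andP[].
Qed.
End FanExtremal.

(** * Spectra and quadratic forms *)
Section SpectralTheorem.
Variable R : realType.

(** Over the complex numbers the matrix is hermitian, so its spectral diagonal is real; an entry of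
    it is a root of the characteristic polynomial, which descends to [R]. *)
Lemma sym_eigenvalue n (A : 'M[R]_n.+1) : A^T = A -> exists a, eigenvalue A a.
Proof.
move=> sA; pose f := real_complex R : {rmorphism R -> R[i]}.
pose Ac := map_mx f A.
have hA : Ac \is hermsymmx.
  apply: realsym_hermsym.
    apply/is_hermitianmxP; rewrite expr0 scale1r map_mx_id // /Ac map_trmx sA.
    by [].
  by apply/mxOverP => i j; rewrite mxE; apply/complex_realP; exists (A i j).
have /mxOverP/(_ 0 0)/complex_realP[k hk] := hermitian_spectral_diag_real hA.
have /hermitian_normalmx/orthomx_spectralP AE := hA.
exists k; rewrite eigenvalue_root_char -(fmorph_root f) map_char_poly -/Ac.
rewrite -eigenvalue_root_char; apply/eigenvalueP.
have Pu := spectral_unit Ac.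
exists (row 0 (spectralmx Ac)).
  rewrite -row_mul {2}AE !mulmxA mulmxV // mul1mx.
  apply/rowP => j; rewrite !mxE (bigD1 0) //= big1 ?addr0; last first.
    by move=> i i0; rewrite mxE eq_sym (negbTE i0) mulr0n mul0r.
  by rewrite mxE eqxx mulr1n hk.
apply/negP => /eqP r0; have := congr1 (mulmx^~ (invmx (spectralmx Ac))) r0.
rewrite -row_mul mulmxV // mul0mx => /rowP/(_ 0).
by rewrite !mxE eqxx => /eqP; rewrite oner_eq0.
Qed.

Lemma dot_ge0 n (v : 'rV[R]_n) : 0 <= (v *m v^T) 0 0.
Proof. by rewrite mxE sumr_ge0 // => i _; rewrite mxE -expr2 sqr_ge0. Qed.

Lemma dot_eq0 n (v : 'rV[R]_n) : ((v *m v^T) 0 0 == 0) = (v == 0).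
Proof.
apply/eqP/eqP => [|->]; last by rewrite mul0mx mxE.
rewrite mxE => h; apply/rowP => i; rewrite mxE.
have := psumr_eq0P _ h => /(_ _ i isT); rewrite mxE -expr2 => hi.
by apply/eqP; rewrite -sqrf_eq0 hi // => j _; rewrite mxE -expr2 sqr_ge0.
Qed.

(* Householder reflection exchanging [v] and the first basis vector *)
Lemma orthogonal_first_row n (v : 'rV[R]_n.+1) : v *m v^T = 1%:M ->
  exists2 Q : 'M[R]_n.+1, Q *m Q^T = 1%:M & row 0 Q = v.
Proof.
move=> v1; pose e : 'rV[R]_n.+1 := delta_mx 0 0; pose w := v - e.
have [w0|wN0] := eqVneq w 0.
  exists 1%:M; first by rewrite trmx1 mulmx1.
  by rewrite row1; apply/esym/eqP; rewrite -subr_eq0 -/e -/w w0.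
pose c := (w *m w^T) 0 0.
have cN0 : c != 0 by rewrite dot_eq0.
have cE : w *m w^T = c%:M by rewrite [LHS]mx11_scalar.
have ee : e *m e^T = 1%:M by rewrite trmx_delta mul_delta_mx [LHS]mx11_scalar mxE.
have ve : v *m e^T = (v 0 0)%:M.
  by rewrite [LHS]mx11_scalar trmx_delta -colE !mxE.
have ev : e *m v^T = (v 0 0)%:M by rewrite -[LHS]trmxK trmx_mul trmxK ve tr_scalar_mx.
have ew : e *m w^T = (- (c / 2))%:M.
  have: w *m w^T = c%:M by [].
  rewrite /w linearB /= mulmxBl !mulmxBr v1 ve ev ee => /matrixP/(_ 0 0).
  rewrite !mxE /= !mulr1n => h; apply/matrixP => i j; rewrite !mxE !ord1 /= !mulr1n -h.
  by field.
pose Q := 1%:M - (2 / c) *: (w^T *m w).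
have QT : Q^T = Q by rewrite /Q linearB linearZ /= trmx1 trmx_mul trmxK.
exists Q.
  have: (w^T *m w) *m (w^T *m w) = c *: (w^T *m w).
    by rewrite mulmxA -[w^T *m w *m w^T]mulmxA cE mul_mx_scalar -scalemxAl.
  rewrite QT /Q; move: (w^T *m w) => S SS.
  rewrite mulmxBl mul1mx mulmxBr mulmx1 -scalemxAl -scalemxAr SS !scalerA.
  by apply/matrixP => i j; rewrite !mxE; field.
rewrite rowE -/e /Q mulmxBr mulmx1 -scalemxAr mulmxA ew mul_scalar_mx scalerA.
have -> : 2 / c * - (c / 2) = -1 by field.
by rewrite scaleN1r opprK /w addrC subrK.
Qed.

(** Deflation: in an orthonormal basis that starts with an eigenvector, symmetry splits the matrix
    into a scalar and a smaller symmetric block. *)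
Theorem sym_diagonalizable n (A : 'M[R]_n) : A^T = A ->
  exists (P : 'M[R]_n) (d : 'rV[R]_n),
    P *m P^T = 1%:M /\ P *m A = diag_mx d *m P.
Proof.
elim: n A => [|n IHn] A sA.
  by exists 1%:M, 0; split; apply/matrixP => -[].
have [a /eigenvalueP[u uA uN0]] := sym_eigenvalue sA.
pose c := (u *m u^T) 0 0.
have c_gt0 : 0 < c by rewrite lt_neqAle eq_sym dot_eq0 uN0 dot_ge0.
pose v := (Num.sqrt c)^-1 *: u.
have v1 : v *m v^T = 1%:M.
  rewrite /v linearZ /= -scalemxAl -scalemxAr scalerA [u *m _]mx11_scalar -/c.
  rewrite scale_scalar_mx -invfM -expr2 sqr_sqrtr ?ltW // mulVf ?gt_eqF //.
have vA : v *m A = a *: v by rewrite /v -scalemxAl uA scalerA mulrC -scalerA.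
have [Q Q1 Q0] := orthogonal_first_row v1.
have Q1' : Q^T *m Q = 1%:M by apply: mulmx1C.
have [B defB] : exists B : 'M[R]_(1 + n), B = Q *m A *m Q^T by eexists.
have sB : B^T = B by rewrite defB !trmx_mul trmxK sA mulmxA.
have B0 j : B 0 j = a * (0 == j)%:R.
  have : row 0 B = a *: row 0 1%:M.
    by rewrite defB !row_mul Q0 vA -scalemxAl -Q0 -row_mul Q1.
  by move/rowP/(_ j); rewrite !mxE.
pose B' : 'M[R]_n := drsubmx B.
have BE : B = block_mx a%:M 0 0 B'.
  rewrite -[B]submxK; congr block_mx.
  - by apply/matrixP => i j; rewrite !ord1 !mxE /= mulr1n lshift0 B0 eqxx mulr1.
  - by apply/matrixP => i j; rewrite !ord1 !mxE lshift0 B0 mulr0.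
  - apply/matrixP => i j; rewrite !ord1 !mxE lshift0.
    by rewrite -[B]sB mxE B0 mulr0.
have sB' : B'^T = B' by rewrite /B' trmx_drsub sB.
have [P' [d' [P1 PB]]] := IHn B' sB'.
pose P0 : 'M[R]_(1 + n) := block_mx 1%:M 0 0 P'.
have P01 : P0 *m P0^T = 1%:M.
  rewrite /P0 tr_block_mx mulmx_block !trmx0 !mulmx0 !mul0mx !addr0 !add0r.
  by rewrite trmx1 mulmx1 P1 -scalar_mx_block.
exists (P0 *m Q), (row_mx a%:M d'); split.
  by rewrite trmx_mul mulmxA -[P0 *m Q *m _]mulmxA Q1 mulmx1.
have -> : P0 *m Q *m A = P0 *m B *m Q.
  by rewrite defB !mulmxA -[_ *m Q^T *m Q]mulmxA Q1' mulmx1.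
rewrite mulmxA; congr (_ *m _).
rewrite BE /P0 mulmx_block !mulmx0 !mul0mx !addr0 !add0r mul1mx PB.
have -> : @diag_mx R (1 + n) (row_mx a%:M d') = block_mx a%:M 0 0 (diag_mx d').
  by rewrite diag_mx_row; congr block_mx; apply/matrixP => i j; rewrite !ord1 !mxE eqxx.
rewrite [RHS](@mulmx_block _ 1 n 1 n 1 n).
by rewrite !mulmx0 !mul0mx !addr0 !add0r mulmx1.
Qed.
End SpectralTheorem.

Section Spectrum.
Variable R : realType.

Lemma char_poly_similar (n : nat) (A B P : 'M[R]_n) :
  P \in unitmx -> P *m A = B *m P -> char_poly A = char_poly B.
Proof.
move=> uP PA; pose Q := map_mx polyC P.
have QN0 : \det Q != 0.
  by rewrite det_map_mx polyC_eq0 -unitfE -unitmxE.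
apply: (mulfI QN0); rewrite /char_poly [RHS]mulrC -!det_mulmx; congr (\det _).
rewrite /char_poly_mx mulmxBr mulmxBl scalar_mxC; congr (_ - _).
by rewrite /Q -!map_mxM PA.
Qed.

Lemma spectrum_eq (n : nat) (A : 'M[R]_n) (s : seq R) : sorted >=%R s ->
  char_poly A = \prod_(x <- s) ('X - x%:P) -> spectrum A = s.
Proof.
move=> ss As; pose Q := [set t : seq R | sorted >=%R t /\
                             char_poly A = \prod_(x <- t) ('X - x%:P)].
have [st At] : Q (spectrum A) by apply: xgetPex; exists s.
have ge_anti : antisymmetric (>=%R : rel R) by move=> x y; rewrite andbC; exact: le_anti.
apply: (sorted_eq ge_trans ge_anti st ss).
by apply: prod_XsubC_eq; rewrite -At As.
Qed.

Lemma spectrum_orthonormal (n : nat) (A : 'M[R]_n) : A^T = A ->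
  exists (P : 'M[R]_n) (d : 'rV[R]_n) (I : seq 'I_n),
    [/\ P *m P^T = 1%:M, P *m A = diag_mx d *m P, perm_eq I (enum 'I_n),
        spectrum A = [seq d 0 i | i <- I] & sorted >=%R (spectrum A)].
Proof.
move=> sA; have [P [d [P1 PA]]] := sym_diagonalizable sA.
have uP : P \in unitmx by have [] := mulmx1_unit P1.
pose I := sort (fun i j => d 0 i >= d 0 j) (enum 'I_n).
exists P, d, I.
have sI : sorted >=%R [seq d 0 i | i <- I].
  rewrite sorted_map; apply: sort_sorted => i j; exact: le_total.
have pI : perm_eq I (enum 'I_n) by rewrite perm_sort.
have -> : spectrum A = [seq d 0 i | i <- I]; last by [].
apply: spectrum_eq => //; rewrite (char_poly_similar uP PA) big_map (perm_big _ pI) /=.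
rewrite char_poly_trig ?diag_mx_is_trig // big_enum /=.
by apply: eq_bigr => i _; rewrite mxE eqxx mulr1n.
Qed.
End Spectrum.

Section Operators.
Variable R : realType.
Variable T : finType.
Implicit Types (a : T -> T -> R) (f g : T -> R).

Definition apply_op a f : T -> R := fun x => \sum_y a x y * f y.
Definition dotp f g : R := \sum_x f x * g x.
Definition qform a f : R := dotp f (apply_op a f).
Definition op_mx a : 'M[R]_#|T| := \matrix_(i, j) a (enum_val i) (enum_val j).
Definition fun_row f : 'rV[R]_#|T| := \row_i f (enum_val i).
Definition row_fun (v : 'rV[R]_#|T|) : T -> R := fun x => v 0 (enum_rank x).

Lemma fun_rowK f : row_fun (fun_row f) =1 f.
Proof. by move=> x; rewrite /row_fun mxE enum_rankK. Qed.

Lemma row_funK v : fun_row (row_fun v) = v.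
Proof. by apply/rowP => i; rewrite mxE /row_fun enum_valK. Qed.

Lemma sum_enum_val (F : T -> R) : \sum_(i < #|T|) F (enum_val i) = \sum_x F x.
Proof. by rewrite -(big_enum_val F). Qed.

Lemma dotp_row f g : (fun_row f *m (fun_row g)^T) 0 0 = dotp f g.
Proof. by rewrite mxE /dotp -sum_enum_val; apply: eq_bigr => i _; rewrite !mxE. Qed.

Lemma dotp_gt0 f x : f x != 0 -> 0 < dotp f f.
Proof.
move=> fx; rewrite /dotp (bigD1 x) //= ltr_pwDl //.
  by rewrite -expr2 exprn_even_gt0.
by apply: sumr_ge0 => y _; rewrite -expr2 sqr_ge0.
Qed.

Lemma dotpC f g : dotp f g = dotp g f.
Proof. by apply: eq_bigr => x _; rewrite mulrC. Qed.

Lemma eq_dotp f f' g g' : f =1 f' -> g =1 g' -> dotp f g = dotp f' g'.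
Proof. by move=> e e'; apply: eq_bigr => x _; rewrite e e'. Qed.

Lemma op_mx_sym a : (forall x y, a x y = a y x) -> (op_mx a)^T = op_mx a.
Proof. by move=> sa; apply/matrixP => i j; rewrite !mxE sa. Qed.

Lemma fun_row_mul a f : (forall x y, a x y = a y x) ->
  fun_row f *m op_mx a = fun_row (apply_op a f).
Proof.
move=> sa; apply/rowP => j; rewrite !mxE /apply_op -sum_enum_val.
by apply: eq_bigr => i _; rewrite !mxE mulrC sa.
Qed.

Lemma apply_op_dotp a f g : (forall x y, a x y = a y x) ->
  dotp (apply_op a f) g = dotp f (apply_op a g).
Proof.
move=> sa; rewrite /dotp /apply_op.
under eq_bigr do rewrite mulr_suml.
under [RHS]eq_bigr do rewrite mulr_sumr.
rewrite exchange_big /=; apply: eq_bigr => x _; apply: eq_bigr => y _.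
by rewrite (sa x y); ring.
Qed.

Lemma qform_norm a f : (forall x y, x != y -> 0 <= a x y) ->
  qform a f <= qform a (fun x => `|f x|).
Proof.
move=> a0; rewrite /qform /dotp /apply_op; apply: ler_sum => x _.
rewrite !mulr_sumr; apply: ler_sum => y _.
rewrite mulrCA [leRHS]mulrCA -normrM.
have [->|xy] := eqVneq x y; last by rewrite ler_wpM2l ?a0 // ler_norm.
by rewrite ger0_norm // -expr2 sqr_ge0.
Qed.

Lemma op_spectrum a : (forall x y, a x y = a y x) ->
  exists (u : 'I_#|T| -> T -> R) (d : 'I_#|T| -> R) (I : seq 'I_#|T|),
  [/\ forall i j, dotp (u i) (u j) = (i == j)%:R,
      forall i x, apply_op a (u i) x = d i * u i x,
      perm_eq I (enum 'I_#|T|),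
      spectrum (op_mx a) = map d I /\ sorted >=%R (map d I) &
      forall f, qform a f = \sum_i d i * dotp f (u i) ^+ 2 /\
                dotp f f = \sum_i dotp f (u i) ^+ 2].
Proof.
move=> sa; have [P [d [I [P1 PA pI sE ss]]]] := spectrum_orthonormal (op_mx_sym sa).
have P1' := mulmx1C P1.
pose u i := row_fun (row i P); exists u, (d 0), I.
have uE i : fun_row (u i) = row i P by rewrite row_funK.
have dE f i : dotp f (u i) = (fun_row f *m P^T) 0 i.
  by rewrite -dotp_row uE tr_row !mxE; apply: eq_bigr => j _; rewrite !mxE.
split => //; [| | by rewrite -sE |].
- by move=> i j; rewrite dE uE -row_mul P1 !mxE.
- move=> i x; have : fun_row (apply_op a (u i)) = d 0 i *: row i P.
    rewrite -fun_row_mul // uE -row_mul PA; apply/rowP => j.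
    rewrite !mxE (bigD1 i) //= big1 ?addr0 => [|k ki]; first by rewrite mxE eqxx mulr1n.
    by rewrite mxE eq_sym (negbTE ki) mulr0n mul0r.
  by move=> h; rewrite -[LHS](fun_rowK _ x) h /u /row_fun !mxE.
- move=> f; set c := fun_row f *m P^T.
  have e : fun_row f = c *m P by rewrite /c -mulmxA P1' mulmx1.
  split.
    rewrite /qform dotpC -dotp_row -fun_row_mul //.
    have -> : fun_row f *m op_mx a *m (fun_row f)^T = c *m diag_mx (d : 'rV_ _) *m c^T.
      by rewrite e trmx_mul -[c *m P *m _]mulmxA PA !mulmxA -[_ *m P *m P^T]mulmxA P1 mulmx1.
    rewrite mul_mx_diag mxE; apply: eq_bigr => i _; rewrite !mxE dE /c !mxE.
    by ring.
  rewrite -dotp_row e trmx_mul mulmxA -[c *m P *m _]mulmxA P1 mulmx1 mxE.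
  by apply: eq_bigr => i _; rewrite dE -/c [c^T _ _]mxE expr2.
Qed.

(* first-order condition for the Rayleigh quotient along a basis vector *)
Lemma maximizer_eigen a mu f : (forall x y, a x y = a y x) ->
  (forall g, qform a g <= mu * dotp g g) -> qform a f = mu * dotp f f ->
  forall x, apply_op a f x = mu * f x.
Proof.
move=> sa Hle Heq z.
pose e x : R := (x == z)%:R.
have dote g : dotp e g = g z.
  rewrite /dotp (bigD1 z) //= big1 ?addr0 /e ?eqxx ?mul1r // => x /negbTE ->.
  by rewrite mul0r.
have dotDl g h k t : dotp (fun x => g x + t * h x) k = dotp g k + t * dotp h k.
  by rewrite /dotp mulr_sumr -big_split; apply: eq_bigr => x _ /=; ring.
have appD g h t : apply_op a (fun x => g x + t * h x) =1
    (fun x => apply_op a g x + t * apply_op a h x).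
  by move=> x; rewrite /apply_op mulr_sumr -big_split; apply: eq_bigr => y _ /=; ring.
have dotDr g h k t : dotp k (fun x => g x + t * h x) = dotp k g + t * dotp k h.
  by rewrite dotpC dotDl !(dotpC k).
pose c := mu - apply_op a e z.
have c_ge0 : 0 <= c.
  by have := Hle e; rewrite /qform !dote /c subr_ge0 /e eqxx mulr1.
pose g := apply_op a f z - mu * f z.
have key t : 2 * t * g <= t ^+ 2 * c.
  have := Hle (fun x => f x + t * e x).
  rewrite /qform (eq_dotp (g' := fun x => apply_op a f x + t * apply_op a e x) (frefl _) (appD _ _ _)).
  rewrite !dotDl !dotDr !dote -(apply_op_dotp f e sa) (dotpC (apply_op a f)) dote.
  rewrite (dotpC f e) dote -/(qform a f) Heq /c /g.
  have -> : e z = 1 by rewrite /e eqxx.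
  by move=> h; lra.
have c1 : 0 < c + 1 by rewrite ltr_wpDl.
(* A small t of the sign of [g] makes the linear side of [key] win over the quadratic one unless [g]
   is 0; the denominator is [c + 1] since [c] may be 0. *)
have := key (g / (c + 1)).
have -> : 2 * (g / (c + 1)) * g = 2 * g ^+ 2 / (c + 1) by field; rewrite gt_eqF.
have -> : (g / (c + 1)) ^+ 2 * c = g ^+ 2 * c / (c + 1) ^+ 2 by field; rewrite gt_eqF.
rewrite ler_pdivrMr // => h.
have {}h : 2 * g ^+ 2 * (c + 1) <= g ^+ 2 * c.
  move: h; rewrite -mulrA mulrAC expr2 invfM => h.
  have : 2 * g ^+ 2 <= g ^+ 2 * c / (c + 1).
    by apply: le_trans h _; rewrite le_eqVlt; apply/orP; left; apply/eqP; field; rewrite gt_eqF.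
  by rewrite ler_pdivlMr.
have : g ^+ 2 <= 0 by have := sqr_ge0 g; nra.
move=> g0; have /eqP : g ^+ 2 == 0 by rewrite eq_le g0 sqr_ge0.
by move/eqP; rewrite sqrf_eq0 => /eqP; rewrite /g => /subr0_eq.
Qed.

(** Passing to absolute values does not lower the quadratic form, so those of a top eigenvector
    maximize it as well and form an eigenvector. Diagonal entries may be negative, as for a fan with
    weight -1. *)
Lemma perron (x0 : T) a : (forall x y, a x y = a y x) ->
  (forall x y, x != y -> 0 <= a x y) ->
  exists (mu : R) (f : T -> R),
    [/\ forall x, 0 <= f x, 0 < dotp f f, forall x, apply_op a f x = mu * f x &
        forall g, qform a g <= mu * dotp g g].
Proof.
move=> sa a0; have [u [d [I [ortho eig _ _ H]]]] := op_spectrum sa.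
have i0 := enum_rank x0.
pose m := [arg max_(i > i0) d i]%O.
have dm i : d i <= d m by rewrite /m; case: Order.TotalTheory.arg_maxP => // j _; apply.
have Hle g : qform a g <= d m * dotp g g.
  have [-> ->] := H g; rewrite mulr_sumr; apply: ler_sum => i _.
  by rewrite ler_wpM2r ?sqr_ge0.
pose f x := `|u m x|.
have ff : dotp f f = 1.
  have <- : dotp (u m) (u m) = 1 by rewrite ortho eqxx.
  by apply: eq_bigr => x _; rewrite -normrM ger0_norm // -expr2 sqr_ge0.
exists (d m), f; split => //.
- by move=> x; apply: normr_ge0.
- by rewrite ff.
- apply: maximizer_eigen => //; apply/eqP; rewrite eq_le Hle /= ff mulr1.
  apply: le_trans (qform_norm (u m) a0).
  rewrite /qform (eq_dotp (frefl _) (eig m)).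
  have -> : dotp (u m) (fun x => d m * u m x) = d m * dotp (u m) (u m).
    by rewrite /dotp mulr_sumr; apply: eq_bigr => x _; rewrite mulrCA.
  by rewrite ortho eqxx mulr1.
Qed.
End Operators.

(** * The second largest eigenvalue of a graph *)

Section SecondEigenvalue.
Variable R : realType.

Definition adj (G : sgraph) (x y : G) : R := (edge x y)%:R.

Lemma adj_sym (G : sgraph) (x y : G) : adj x y = adj y x.
Proof. by rewrite /adj edge_sym. Qed.

Lemma adjacency_op (G : sgraph) : adjacency R G = op_mx (@adj G).
Proof. by apply/matrixP => i j; rewrite !mxE. Qed.

Lemma spectrum_change_basis (m n : nat) (A : 'M[R]_m) (B : 'M[R]_n)
    (P : 'M[R]_(m, n)) (Q : 'M[R]_(n, m)) :
  m = n -> P *m Q = 1%:M -> A *m P = P *m B -> spectrum A = spectrum B.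
Proof.
move=> e; subst n => PQ AP; have QP := mulmx1C PQ.
have [uP uQ] := mulmx1_unit PQ.
have QA : Q *m A = B *m Q by rewrite -[Q *m A]mulmx1 -PQ mulmxA -[Q *m A *m P]mulmxA AP mulmxA QP mul1mx.
by rewrite /spectrum (char_poly_similar uQ QA).
Qed.

Lemma rho2_isomorphic (G H : sgraph) : isomorphic G H -> rho2 R G = rho2 R H.
Proof.
move=> [f bf ef]; have [g fK gK] := bf; rewrite /rho2; congr nth.
pose P : 'M[R]_(#|G|, #|H|) := \matrix_(i, j) (f (enum_val i) == enum_val j)%:R.
pose Q : 'M[R]_(#|H|, #|G|) := \matrix_(i, j) (enum_val i == f (enum_val j))%:R.
apply: (@spectrum_change_basis _ _ _ _ P Q).
- exact: bij_eq_card bf.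
- apply/matrixP => i j; rewrite !mxE (bigD1 (enum_rank (f (enum_val i)))) //=.
  rewrite !mxE enum_rankK eqxx mul1r big1 ?addr0.
    by rewrite (inj_eq (bij_inj bf)) (inj_eq enum_val_inj).
  move=> k; rewrite !mxE -(inj_eq enum_val_inj) enum_rankK eq_sym => /negbTE ->.
  by rewrite mul0r.
- apply/matrixP => i j; rewrite !mxE.
  rewrite (bigD1 (enum_rank (g (enum_val j)))) //= big1 ?addr0; last first.
    move=> k; rewrite !mxE -(inj_eq enum_val_inj) enum_rankK => /negbTE h.
    by rewrite (can2_eq fK gK) h mulr0.
  rewrite (bigD1 (enum_rank (f (enum_val i)))) //= big1 ?addr0; last first.
    move=> k; rewrite !mxE -(inj_eq enum_val_inj) enum_rankK eq_sym => /negbTE ->.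
    by rewrite mul0r.
  by rewrite !mxE !enum_rankK gK !eqxx mulr1 mul1r -[enum_val j in RHS]gK ef.
Qed.

Lemma rho2_eigenvectors (G : sgraph) : (1 < #|G|)%N ->
  exists (l : R) (v1 v2 : G -> R),
    [/\ rho2 R G <= l, dotp v1 v1 = 1 /\ dotp v2 v2 = 1, dotp v1 v2 = 0,
        forall x, apply_op (@adj G) v1 x = l * v1 x &
        forall x, apply_op (@adj G) v2 x = rho2 R G * v2 x].
Proof.
move=> G1; have [u [d [I [ortho eig pI [sE ss] _]]]] := op_spectrum (@adj_sym G).
rewrite /rho2 adjacency_op sE.
have : size I = #|G| by rewrite (perm_size pI) size_enum_ord.
have uI : uniq I by rewrite (perm_uniq pI) enum_uniq.
case: I {pI sE} ss uI => [|i0 [|i1 I]] ss uI sI; first [by exfalso; move: G1; rewrite -sI | idtac].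
exists (d i0), (u i0), (u i1); split => //=.
- by move: ss => /= /andP[].
- by rewrite !ortho !eqxx.
- by move: uI; rewrite ortho /= inE negb_or => /andP[/andP[/negbTE ->]].
Qed.

(** [f] shows that [r] is an eigenvalue, and [g] that some eigenvalue is larger. These have
    different indices in the spectrum, so the second entry is at least [r]. *)
Lemma rho2_lower_bound (G : sgraph) (r : R) (f g : G -> R) :
  0 < dotp f f -> (forall x, apply_op (@adj G) f x = r * f x) ->
  r * dotp g g < qform (@adj G) g -> r <= rho2 R G.
Proof.
move=> f0 fr gr.
have [u [d [I [ortho eig pI [sE ss] H]]]] := op_spectrum (@adj_sym G).
have mI i : i \in I by rewrite (perm_mem pI) mem_enum.
have [i di] : exists i, r < d i.
  apply/existsP; apply: contraLR gr => /existsPn h; rewrite -leNgt.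
  have [-> ->] := H g; rewrite mulr_sumr ler_sum // => i _.
  by rewrite ler_wpM2r ?sqr_ge0 // leNgt h.
have [j dj] : exists j, d j = r.
  have : exists j, dotp f (u j) != 0.
    apply/existsP; apply: contraLR f0 => /existsPn h; rewrite -leNgt.
    have [_ ->] := H f; rewrite big1 // => k _.
    by have := h k; rewrite negbK => /eqP ->; rewrite expr0n.
  move=> [j fj]; exists j; apply: (mulIf fj).
  have : dotp (apply_op (@adj G) f) (u j) = dotp f (apply_op (@adj G) (u j)).
    by apply: apply_op_dotp; apply: adj_sym.
  rewrite (eq_dotp fr (frefl (u j))) (eq_dotp (frefl f) (eig j)) => e.
  rewrite [RHS](_ : _ = \sum_x r * f x * u j x); last first.
    by rewrite mulr_sumr; apply: eq_bigr => x _; rewrite mulrA.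
  rewrite -/(dotp _ (u j)) e /dotp mulr_sumr; apply: eq_bigr => x _.
  by rewrite mulrCA.
have ij : i != j by apply: contraTneq di => ->; rewrite dj ltxx.
rewrite /rho2 adjacency_op sE.
move: (mI i) (mI j) ss; case: I {pI sE mI} => [|i0 [|i1 I]] //=.
  by rewrite !inE => /eqP ei /eqP ej; move: ij; rewrite ei ej eqxx.
rewrite !inE => hi hj /andP[h01 hp].
have all1 : all (fun x => d i1 >= x) (map d I).
  by have := order_path_min (@ge_trans _ R) hp.
have dle k : (k == i1) || (k \in I) -> d k <= d i1.
  by case/orP => [/eqP -> //|kI]; move/allP: all1; apply; rewrite map_f.
case/orP: hj => [/eqP ej|hj]; last by rewrite -dj dle.
case/orP: hi => [/eqP ei|hi]; last by apply: le_trans (dle _ hi); apply: ltW.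
by move: ij; rewrite ei ej eqxx.
Qed.
End SecondEigenvalue.

(** * Fans with a negative weight *)
Section FanOperator.
Variables (R : realType) (k : nat).
Implicit Types (v : fan k) (g : fan k -> R).

Definition fan_op v : fan k -> fan k -> R := fun x y => adj R x y - ((x == v) && (y == v))%:R.

Definition hub : fan k := inl ord0.
(** Values on the path, extended by 0 beyond it so that the equation at the last vertex looks like
    the others. *)
Definition rim g (n : nat) : R := oapp (fun j : 'I_k => g (inr j)) 0 (insub n).

Lemma rimE g (j : 'I_k) : rim g j = g (inr j).
Proof. by rewrite /rim insubT //= => jk; congr (g (inr _)); apply: val_inj. Qed.

Lemma rim_out g n : (k <= n)%N -> rim g n = 0.
Proof. by move=> kn; rewrite /rim insubN // -leqNgt. Qed.

Lemma fan_op_sym v x y : fan_op v x y = fan_op v y x.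
Proof. by rewrite /fan_op adj_sym andbC. Qed.

Lemma fan_op_off v x y : x != y -> 0 <= fan_op v x y.
Proof.
move=> xy; rewrite /fan_op (_ : _ && _ = false) ?subr0 ?ler0n //.
by apply/negbTE; apply: contraNN xy => /andP[/eqP -> /eqP ->].
Qed.

Lemma sum_fan (F : fan k -> R) : \sum_x F x = F hub + \sum_(i < k) F (inr i).
Proof. by rewrite big_sumType /= big_ord1. Qed.

Lemma apply_fan_op v g x :
  apply_op (fan_op v) g x = apply_op (@adj R (fan k)) g x - (x == v)%:R * g v.
Proof.
rewrite /apply_op /fan_op; under eq_bigr do rewrite mulrBl.
rewrite sumrB; congr (_ - _); rewrite (bigD1 v) //= eqxx andbT big1 ?addr0 //.
by move=> y /negbTE ->; rewrite andbF mul0r.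
Qed.

Lemma qform_fan_op v g : qform (fan_op v) g = qform (@adj R (fan k)) g - g v ^+ 2.
Proof.
rewrite /qform /dotp; under eq_bigr do rewrite apply_fan_op mulrBr.
rewrite sumrB; congr (_ - _); rewrite (bigD1 v) //= eqxx big1 ?addr0.
  by rewrite mul1r expr2.
by move=> y /negbTE ->; rewrite mul0r mulr0.
Qed.

Lemma apply_adj_hub g : apply_op (@adj R (fan k)) g hub = \sum_(i < k) g (inr i).
Proof.
rewrite /apply_op sum_fan /adj edge_irrefl mul0r add0r.
by apply: eq_bigr => i _; rewrite mul1r.
Qed.

Lemma sum_path_nbr (F : nat -> R) (i : nat) : (i < k)%N ->
  \sum_(j < k) ((i.+1 == j) || (j.+1 == i))%:R * F j =
  (if i is i'.+1 then F i' else 0) + (if (i.+1 < k)%N then F i.+1 else 0).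
Proof.
move=> ik.
have E (j : nat) : ((i.+1 == j) || (j.+1 == i))%:R * F j = (j.+1 == i)%:R * F j + (j == i.+1)%:R * F j.
  rewrite -mulrDl; congr (_ * _); rewrite eq_sym; case: (eqVneq j i.+1) => [->|] /=.
    by rewrite (_ : (i.+2 == i) = false) ?add0r //; apply/negbTE; clear; lia.
  by rewrite addr0.
under eq_bigr do rewrite E.
rewrite big_split; congr (_ + _).
  case: i ik {E} => [|i] ik; first by rewrite big1 // => j _; rewrite mul0r.
  rewrite (bigD1 (Ordinal (ltnW ik))) //= eqxx mul1r big1 ?addr0 // => j.
  by rewrite -val_eqE /= eqSS => /negbTE ->; rewrite mul0r.
case: ltnP => i1.
  rewrite (bigD1 (Ordinal i1)) //= eqxx mul1r big1 ?addr0 // => j.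
  by rewrite -val_eqE /= => /negbTE ->; rewrite mul0r.
rewrite big1 // => j _; have := ltn_ord j => jk.
by rewrite (_ : (j == i.+1 :> nat) = false) ?mul0r //; apply/negbTE; clear -i1 jk; lia.
Qed.

Lemma apply_adj_rim g (i : 'I_k) : apply_op (@adj R (fan k)) g (inr i) =
  g hub + (if (i : nat) is i'.+1 then rim g i' else 0) + rim g i.+1.
Proof.
rewrite /apply_op sum_fan /adj /= mul1r -addrA; congr (_ + _).
rewrite (eq_bigr (fun j : 'I_k => ((i.+1 == j) || (j.+1 == i))%:R * rim g j)); last first.
  by move=> j _; rewrite rimE.
rewrite sum_path_nbr //; congr (_ + _); case: ltnP => // h; by rewrite rim_out.
Qed.
End FanOperator.

Section RimEquations.
Variables (R : realType) (k i : nat) (r a : R) (f : nat -> R).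

(** The eigenvalue equations at the path vertices, with hub value [a] and the weight -1 at position
    [i]. Taking [i = k] puts no weight on the path, as when it is at the hub. *)
Definition rim_eqns := forall j, (j < k)%N ->
  r * f j = a + (if j is j'.+1 then f j' else 0) + f j.+1 - (j == i)%:R * f i.

(** At a largest value the equation gives r f <= a + 2 f. *)
Lemma rim_le (E : rim_eqns) : 2 < r -> 0 <= a -> (forall j, 0 <= f j) ->
  (forall j, (k <= j)%N -> f j = 0) -> forall j, f j * (r - 2) <= a.
Proof.
move=> r2 a0 f0 fout j.
have [jk|/fout ->] := ltnP j k; last by rewrite mul0r.
pose m := [arg max_(x > Ordinal jk) f x]%O.
have fm n : f n <= f m.
  have [nk|/fout ->] := ltnP n k; last exact: f0.
  by rewrite /m; case: Order.TotalTheory.arg_maxP => // x _ /(_ (Ordinal nk) isT).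
have Em := E m (ltn_ord m).
have h1 n : (if n is n'.+1 then f n' else 0) <= f m by case: n.
have {}h1 := h1 m.
have h2 := fm m.+1.
have h3 : 0 <= ((m : nat) == i)%:R * f i by rewrite mulr_ge0.
have h4 : f m * (r - 2) <= a.
  move: h1 Em; move: (if _ is j'.+1 then _ else _) => p h1 Em.
  by rewrite mulrBr mulrC Em; lra.
by apply: le_trans h4; rewrite ler_wpM2r // subr_ge0 ltW.
Qed.

(** For large [r] the two values differ only by about a / r^3, too little for bounding them
    separately. When i >= 2, assuming [f i <= f 0] and using the equations twice, twice [f i] plus
    [f i.-2] and [f i.+2] is at most the sum of three values near the end: about 4a/r against
    3a/r. *)
Lemma rim_end_lt (E : rim_eqns) : 11 / 2 <= r -> 0 < a -> (forall j, 0 <= f j) ->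
  (forall j, (k <= j)%N -> f j = 0) -> (0 < i)%N -> (i + 3 <= k)%N -> f 0 < f i.
Proof.
move=> r5 a0 f0 fout i0 ik.
have bnd : forall j, f j * (r - 2) <= a by apply: rim_le => //; lra.
rewrite ltNge; apply/negP => fi.
have E0 : r * f 0 = a + f 1.
  by rewrite E ?addr0; [rewrite (ltn_eqF i0) mul0r subr0 | clear -ik; lia].
have Ei : (r + 1) * f i = a + f i.-1 + f i.+1.
  have : (i < k)%N by clear -ik; lia.
  move=> /E; rewrite eqxx mul1r; case: (i) i0 => //= i' _ h.
  by rewrite mulrDl mul1r h subrK.
(* For i = 1 there is no value two places to the left. There [f 1 <= f 0] forces [f 2 <= f 0], and
   the equation at 2 then makes [f 3] nonpositive. *)
have [i1|i2] : i = 1%N \/ (1 < i)%N by clear -i0; lia.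
  have E2 : r * f 2 = a + f 1 + f 3.
    by rewrite E; [rewrite i1 mul0r subr0 | clear -i1 ik; lia].
  rewrite i1 /= in Ei fi.
  have E3 : 0 < f 3.
    have : a <= r * f 3 by rewrite E; [rewrite i1 mul0r subr0 -addrA lerDl addr_ge0 | clear -i1 ik; lia].
    by move=> h; have h' := lt_le_trans a0 h; rewrite -(pmulr_rgt0 _ (_ : 0 < r)) //; lra.
  move: E0 Ei E2 E3 fi; move: (f 0) (f 1%N) (f 2%N) (f 3%N) => x0 x1 x2 x3.
  move=> E0 Ei E2 E3 fi.
  have h1 : r * x1 <= r * x0 by rewrite ler_pM2l //; lra.
  have h2 : x2 <= x1 by lra.
  have h3 : r * x2 <= r * x0 by rewrite ler_pM2l //; lra.
  by lra.
have EE j : (j < k)%N -> j != i -> r * f j = a + (if j is j'.+1 then f j' else 0) + f j.+1.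
  by move=> jk /negbTE ji; rewrite E // ji mul0r subr0.
have E1 : r * f 1 = a + f 0 + f 2 by rewrite EE //; clear -i2 ik; lia.
have Em : r * f i.-1 = a + f i.-2 + f i.
  rewrite EE; [|clear -i2 ik; lia|clear -i2 ik; lia].
  by case: (i) i2 => [|[|]].
have Ep : r * f i.+1 = a + f i + f i.+2 by rewrite EE //; clear -i2 ik; lia.
have r0 : 0 < r by lra.
have low j : (j < k)%N -> j != i -> a <= r * f j.
  move=> jk ji; rewrite EE //; case: j {jk ji} => [|j]; rewrite -addrA lerDl addr_ge0 //.
have lm2 : a + f i.-1 <= r * f i.-2.
  rewrite EE; [|clear -i2 ik; lia|clear -i2 ik; lia].
  have -> : i.-2.+1 = i.-1 by clear -i2; lia.
  by rewrite lerD2r lerDl; case: (i.-2).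
have lp2 : a + f i.+1 <= r * f i.+2.
  rewrite EE; [|clear -i2 ik; lia|clear -i2 ik; lia].
  by rewrite lerDl.
have lm1 : a <= r * f i.-1 by rewrite Em -addrA lerDl addr_ge0.
have lp1 : a <= r * f i.+1 by rewrite Ep -addrA lerDl addr_ge0.
have lm2' : a <= r * f i.-2 by apply: le_trans lm2; rewrite lerDl.
have lp2' : a <= r * f i.+2 by apply: le_trans lp2; rewrite lerDl.
have b1 := bnd 1%N; have b2 := bnd 2%N.
have sum : 2 * f i + f i.-2 + f i.+2 <= f 0 + f 1 + f 2.
  have : (r + 1) * f i <= (r + 1) * f 0 by rewrite ler_pM2l //; lra.
  move=> h; have : f i.-1 + f i.+1 <= f 0 + f 1 by lra.
  by rewrite -(ler_pM2l r0) !mulrDr; lra.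
(* [A] is the upper bound of [rim_le]. [C] bounds the four values around [i] from below, each having
   a neighbour of value at least [B]. *)
pose A := a / (r - 2); pose B := a / r; pose C := (a + B) / r.
have r2 : 0 < r - 2 by lra.
have rN0 : r != 0 by rewrite gt_eqF.
have r2N0 : r - 2 != 0 by rewrite gt_eqF.
have AE : A * (r - 2) = a by rewrite /A divfK.
have BE : r * B = a by rewrite /B mulrC divfK.
have CE : r * C = a + B by rewrite /C mulrC divfK.
have A0 : 0 < A by rewrite divr_gt0.
have leC x y : a <= r * y -> a + y <= r * x -> C <= x.
  move=> h1 h2; rewrite -(ler_pM2l r0) CE; apply: le_trans h2; rewrite lerD2l.
  by rewrite -(ler_pM2l r0) BE.
have c1 := leC _ _ lm1 lm2; have c2 := leC _ _ lp1 lp2.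
have c3 : C <= f i.-1 by apply: leC lm2' _; rewrite Em lerDl.
have c4 : C <= f i.+1 by apply: leC lp2' _; rewrite Ep -addrA lerD2l lerDr.
have A1 : f 1 <= A by rewrite /A ler_pdivlMr.
have A2 : f 2 <= A by rewrite /A ler_pdivlMr.
move: sum E0 Ei c1 c2 c3 c4 A1 A2.
move: (f i) (f i.-1) (f i.+1) (f i.-2) (f i.+2) (f 0) (f 1%N) (f 2%N).
move=> y y1 y2 y3 y4 x0 x1 x2 sum E0 Ei c1 c2 c3 c4 A1 A2.
clear - r5 r0 r2 AE BE CE A0 sum E0 Ei c1 c2 c3 c4 A1 A2 a0.
have h1 : 2 * y + 2 * C <= x0 + 2 * A by lra.
have h2 : r * x0 <= a + A by lra.
have h3 : a + 2 * C <= (r + 1) * y by lra.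
have h4 : r * (r + 1) * (2 * y + 2 * C) <= r * (r + 1) * (x0 + 2 * A).
  by rewrite ler_pM2l // mulr_gt0 //; lra.
have h5 : 2 * r * (a + 2 * C) <= 2 * r * ((r + 1) * y) by rewrite ler_pM2l //; lra.
have h6 : (r + 1) * (r * x0) <= (r + 1) * (a + A) by rewrite ler_pM2l //; lra.
have h7 : (4 * r + 6) * a + (2 * r + 6) * B <= (r + 1) * a + (r + 1) * (2 * r + 1) * A.
  have e1 : 2 * r * (a + 2 * C) = 2 * r * a + 4 * (a + B) by rewrite -CE; ring.
  have e2 : r * (r + 1) * (2 * C) = 2 * (r + 1) * (a + B) by rewrite -CE; ring.
  have e3 : r * (r + 1) * (2 * y + 2 * C) = 2 * r * ((r + 1) * y) + r * (r + 1) * (2 * C) by ring.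
  have e4 : r * (r + 1) * (x0 + 2 * A) = (r + 1) * (r * x0) + 2 * r * (r + 1) * A by ring.
  by lra.
have h8 : r * ((4 * r + 6) * a + (2 * r + 6) * B) <= r * ((r + 1) * a + (r + 1) * (2 * r + 1) * A).
  by rewrite ler_pM2l.
have h9 : (r ^+ 3 - 2 * r ^+ 2 - 9 * r - 12) * A <= 0.
  have e1 : r * ((2 * r + 6) * B) = (2 * r + 6) * a by rewrite -[in RHS]BE; ring.
  have e2 : r * ((4 * r + 6) * a + (2 * r + 6) * B) = r * (4 * r + 6) * a + (2 * r + 6) * a.
    by rewrite -e1; ring.
  move: h8; rewrite e2 -AE => h8; lra.
have h10 : 0 < r ^+ 3 - 2 * r ^+ 2 - 9 * r - 12.
  have -> : r ^+ 3 - 2 * r ^+ 2 - 9 * r - 12 =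
    (r - 11 / 2) * (r * (r + 7 / 2) + 41 / 4) + 355 / 8 by field.
  apply: ltr_wpDl => //; apply: mulr_ge0; first by lra.
  by apply: addr_ge0; [apply: mulr_ge0; lra | lra].
by have := mulr_gt0 h10 A0; lra.
Qed.
End RimEquations.

Section FanEigenvectors.
Variables (R : realType) (k : nat).
Implicit Types (v : fan k) (y : fan k -> R) (r : R).

Lemma fan_eigen_rim (i : 'I_k) y r :
  (forall x, apply_op (fan_op R (inr i)) y x = r * y x) -> rim_eqns k i r (y (hub k)) (rim y).
Proof.
move=> eig j jk; have := eig (inr (Ordinal jk)).
rewrite apply_fan_op apply_adj_rim /= -[y (inr (Ordinal jk))]rimE -[y (inr i)]rimE /= => <-.
by congr (_ + _ - _).
Qed.

Lemma fan_eigen_rim_hub y r :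
  (forall x, apply_op (fan_op R (hub k)) y x = r * y x) -> rim_eqns k k r (y (hub k)) (rim y).
Proof.
move=> eig j jk; have := eig (inr (Ordinal jk)).
rewrite apply_fan_op apply_adj_rim /= -[y (inr (Ordinal jk))]rimE /= => <-.
by rewrite [rim y k]rim_out // mulr0 mul0r.
Qed.

Lemma fan_eigen_hub (i : 'I_k) y r :
  (forall x, apply_op (fan_op R (inr i)) y x = r * y x) ->
  r * y (hub k) = \sum_(j < k) rim y j.
Proof.
move=> eig; rewrite -(eig (hub k)) apply_fan_op apply_adj_hub mul0r subr0.
by apply: eq_bigr => j _; rewrite rimE.
Qed.

Lemma rim_ge0 y : (forall x, 0 <= y x) -> forall j, 0 <= rim y j.
Proof.
move=> y0 j; have [jk|/rim_out ->//] := ltnP j k.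
by rewrite -[j]/(val (Ordinal jk)) rimE.
Qed.

Lemma fan_hub_gt0 (i : nat) y r : rim_eqns k i r (y (hub k)) (rim y) ->
  2 < r -> (forall x, 0 <= y x) -> 0 < dotp y y -> 0 < y (hub k).
Proof.
move=> E r2 y0 yy; rewrite lt_neqAle y0 andbT; apply/eqP => h.
have b := rim_le E r2 (y0 _) (rim_ge0 y0) (@rim_out _ _ y).
have z j : rim y j = 0.
  apply/eqP; rewrite eq_le rim_ge0 // andbT -(pmulr_lle0 _ (_ : 0 < r - 2)) ?subr_gt0 //.
  by apply: le_trans (b j) _; rewrite -h.
move: yy; rewrite /dotp sum_fan -h mul0r add0r big1 ?ltxx // => j _.
by rewrite -rimE z mul0r.
Qed.

(* 24/5 is close to the square root of [k] at the worst case [k = 23]. *)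
Lemma fan_rho_ge (v : 'I_k) (r : R) : (23 <= k)%N ->
  (forall g, qform (fan_op R (inr v)) g <= r * dotp g g) -> 11 / 2 <= r.
Proof.
move=> k23 H; pose g (x : fan k) : R := if x is inl _ then 24 / 5 else 1.
have := H g; rewrite qform_fan_op /qform /dotp !sum_fan.
have -> : apply_op (@adj R (fan k)) g (hub k) = k%:R.
  by rewrite apply_adj_hub /= sumr_const card_ord.
have rg j : (j < k)%N -> rim g j = 1 by move=> jk; rewrite -[j]/(val (Ordinal jk)) rimE.
have -> : \sum_(i < k) g (inr i) * apply_op (@adj R (fan k)) g (inr i) =
    24 / 5 * k%:R + 2 * (k%:R - 1).
  rewrite (eq_bigr (fun i : 'I_k => 24 / 5 + (if (i : nat) is i'.+1 then rim g i' else 0) + rim g i.+1)); last first.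
    by move=> i _; rewrite mul1r apply_adj_rim.
  rewrite !big_split /= sumr_const card_ord -[24 / 5 *+ k]mulr_natr.
  case: k k23 g rg {H v} => // k' _ g rg.
  rewrite big_ord_recl /= add0r [X in _ + X]big_ord_recr /= rim_out // addr0.
  rewrite [X in _ + X + _](eq_bigr (fun=> 1)); last by move=> i _; apply: rg; rewrite ltnS; exact: ltnW (ltn_ord i).
  rewrite [X in _ + X](eq_bigr (fun=> 1)); last by move=> i _; apply: rg; rewrite ltnS.
  by rewrite sumr_const card_ord -natr1; ring.
have -> : \sum_(i < k) g (inr i) * g (inr i) = k%:R.
  by rewrite (eq_bigr (fun=> 1)) ?sumr_const ?card_ord // => i _; rewrite mulr1.
rewrite /= expr1n.
have : 23 <= k%:R :> R by rewrite ler_nat.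
move: (k%:R) => K K23 h.
have h1 : 11 / 2 * (24 / 5 * (24 / 5) + K) <= r * (24 / 5 * (24 / 5) + K) by lra.
by rewrite ler_pM2r in h1 => //; lra.
Qed.

Lemma sum_shiftl n (F : nat -> R) : (0 < n)%N ->
  \sum_(j < n) (if (j : nat) is j'.+1 then F j' else 0) = \sum_(j < n) F j - F n.-1.
Proof. by case: n => // n _; rewrite big_ord_recl big_ord_recr /= add0r addrK. Qed.

Lemma sum_shiftr n (F : nat -> R) : (0 < n)%N ->
  \sum_(j < n) F j.+1 = \sum_(j < n) F j - F 0%N + F n.
Proof. by case: n => // n _; rewrite big_ord_recr [in RHS]big_ord_recl /= [F 0%N + _]addrC addrK. Qed.

(** With f the path values and a the hub value, multiplying the hub equation by [r] and summing the
    path equations gives r^2 a = k a + 2 r a - 2 f(0) - f(k-1): both ends lack a neighbour, and the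
    first also carries the weight -1. The end values are bounded by means of the preliminary r >=
    11/2, and 29/5 comes out of the bound on [k]. *)
Lemma fan_rho_bounds (v : 'I_k) y r : (23 <= k)%N -> v = 0%N :> nat ->
  (forall x, 0 <= y x) -> 0 < dotp y y ->
  (forall x, apply_op (fan_op R (inr v)) y x = r * y x) ->
  (forall g, qform (fan_op R (inr v)) g <= r * dotp g g) ->
  29 / 5 <= r /\ k%:R <= r ^+ 2 - 2 * r + 7 / 2 / r.
Proof.
move=> k23 v0 y0 yy eig H.
have r5 := fan_rho_ge k23 H.
have r2 : 2 < r by lra.
have E := fan_eigen_rim eig.
have a0 := fan_hub_gt0 E r2 y0 yy.
have hE := fan_eigen_hub eig.
set a := y (hub k) in a0 E hE.
have b := rim_le E r2 (y0 _) (rim_ge0 y0) (@rim_out _ _ y).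
set f := rim y in E hE b.
have sumE : r * (r * a) = k%:R * a + 2 * (r * a) - 2 * f 0%N - f k.-1.
  rewrite {1}hE mulr_sumr.
  rewrite (eq_bigr (fun j : 'I_k => a + (if (j : nat) is j'.+1 then f j' else 0) + f j.+1 - ((j : nat) == v)%:R * f v)); last first.
    by move=> j _; rewrite E.
  rewrite !big_split /= sumrN sumr_const card_ord -[a *+ k]mulr_natl hE v0.
  rewrite sum_shiftl ?sum_shiftr; try (clear -k23; lia).
  rewrite (_ : f k = 0); last by apply: rim_out.
  have -> : \sum_(i < k) ((i : nat) == 0%N)%:R * f 0%N = f 0%N.
    rewrite (bigD1 v) //= v0 eqxx mul1r big1 ?addr0 // => j.
    by rewrite -val_eqE /= v0 => /negbTE ->; rewrite mul0r.
  by ring.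
have [f0E fkE] : (r + 1) * f 0%N = a + f 1%N /\ r * f k.-1 = a + f k.-2.
  split.
    have := E 0%N ltac:(lia); rewrite v0 eqxx mul1r addr0 => h.
    by rewrite mulrDl h mul1r subrK.
  have := E k.-1 ltac:(lia); rewrite v0.
  have -> : (k.-1 == 0%N) = false by clear -k23; lia.
  have -> : f k.-1.+1 = 0 by apply: rim_out; clear -k23; lia.
  rewrite mul0r subr0 addr0 => ->; congr (_ + _).
  by case: (k) k23 => [|[|]].
have r0 : 0 < r by lra.
have rN0 : r != 0 by rewrite gt_eqF.
have kb : k%:R <= r ^+ 2 - 2 * r + 7 / 2 / r.
  pose A := a / (r - 2).
  have r2' : 0 < r - 2 by lra.
  have AE : A * (r - 2) = a by rewrite /A divfK // gt_eqF.
  have A0 : 0 < A by rewrite divr_gt0.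
  have f1A : f 1%N <= A by rewrite /A ler_pdivlMr.
  have f2A : f k.-2 <= A by rewrite /A ler_pdivlMr.
  have h : 2 * (r * f 0%N) + r * f k.-1 <= 7 / 2 * a.
    rewrite -(ler_pM2l (_ : 0 < r + 1)); last by lra.
    have e1 : (r + 1) * (2 * (r * f 0%N) + r * f k.-1) = 2 * r * ((r + 1) * f 0%N) + (r + 1) * (r * f k.-1) by ring.
    rewrite e1 f0E fkE.
    apply: (@le_trans _ _ (2 * r * (a + A) + (r + 1) * (a + A))).
      by apply: lerD; rewrite ler_pM2l ?lerD2l //; lra.
    rewrite -AE -subr_ge0.
    have -> : (r + 1) * (7 / 2 * (A * (r - 2))) - (2 * r * (A * (r - 2) + A) + (r + 1) * (A * (r - 2) + A))
       = A * (1 / 2 * (r ^+ 2 - 3 * r - 12)) by field.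
    apply: mulr_ge0; first exact: ltW.
    by nra.
  rewrite -(ler_pM2r a0) -(ler_pM2l r0).
  have -> : r * ((r ^+ 2 - 2 * r + 7 / 2 / r) * a) = r * (r * (r * a)) - r * (2 * (r * a)) + 7 / 2 * a by field.
  by rewrite sumE; lra.
split => //.
(* For r < 29/5, r^2 - 2r is at most 551/25 and 7/(2r) at most 7/11, together less than 23. *)
rewrite leNgt; apply/negP => r58.
have K23 : 23 <= k%:R :> R by rewrite ler_nat.
have h1 : (r - 29 / 5) * (r + 19 / 5) <= 0.
  by rewrite mulr_le0_ge0 //; lra.
have h2 : 7 / 2 / r <= 7 / 11 by rewrite ler_pdivrMr //; lra.
have h3 : r ^+ 2 - 2 * r <= 551 / 25 by move: h1; rewrite mulrDl !mulrDr expr2; lra.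
by clear v0; move: kb; move: (7 / 2 / r) h2 => x h2 kb; lra.
Qed.
End FanEigenvectors.

Section Transport.
Variables (R : realType) (T T' : finType) (h : T -> T') (a : T -> T -> R) (a' : T' -> T' -> R).
Hypotheses (bh : bijective h) (ha : forall x y, a' (h x) (h y) = a x y).

Lemma dotp_bij (f g : T' -> R) : dotp f g = dotp (f \o h) (g \o h).
Proof. by rewrite /dotp (reindex h) //; apply: onW_bij. Qed.

Lemma apply_op_bij (g : T' -> R) x : apply_op a' g (h x) = apply_op a (g \o h) x.
Proof.
rewrite /apply_op (reindex h) /=; last exact: onW_bij.
by apply: eq_bigr => y _; rewrite ha.
Qed.

Lemma qform_bij (g : T' -> R) : qform a' g = qform a (g \o h).
Proof. by rewrite /qform dotp_bij; apply: eq_dotp => // x; exact: apply_op_bij. Qed.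
End Transport.

Section FanEnds.
Variables (R : realType) (k : nat).

Definition fan_rev (x : fan k) : fan k :=
  match x with inl c => inl c | inr i => inr (rev_ord i) end.

Lemma fan_revK : involutive fan_rev.
Proof. by case=> // i /=; rewrite rev_ordK. Qed.

Lemma fan_rev_bij : bijective fan_rev.
Proof. exact: inv_bij fan_revK. Qed.

Lemma fan_op_rev v x y : fan_op R (fan_rev v) (fan_rev x) (fan_rev y) = fan_op R v x y.
Proof.
rewrite /fan_op !(inj_eq (inv_inj fan_revK)); congr (_ - _); rewrite /adj.
case: x y => [x|x] [y|y] //=; congr ((_ : bool)%:R); rewrite /path_rel /=.
by have := ltn_ord x; have := ltn_ord y; clear; lia.
Qed.

(** Moving the weight -1 from [u] to the end [v1] raises the form at [y] by y(u)^2 - y(v1)^2. This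
    is positive by [rim_end_lt] on the path, after a reversal for [u] close to the far end, and by
    [rim_le] at the hub. *)
Lemma fan_op_not_end_lt (v1 : 'I_k) (u : fan k) (rho r : R) (y : fan k -> R) :
  (23 <= k)%N -> v1 = 0%N :> nat ->
  (forall g, qform (fan_op R (inr v1)) g <= rho * dotp g g) ->
  (forall i : 'I_k, u = inr i -> (0 < i < k.-1)%N) ->
  (forall x, 0 <= y x) -> 0 < dotp y y ->
  (forall x, apply_op (fan_op R u) y x = r * y x) -> r < rho.
Proof.
move=> k23 v10 H hu y0 yy eig; rewrite ltNge; apply/negP => rr.
have rho5 := fan_rho_ge k23 H.
(* The assumption [rho <= r], to be refuted, carries the lower bound over from [rho]. *)
have r5 : 11 / 2 <= r by lra.
have r2 : 2 < r by lra.
have key (u' : fan k) (z : fan k -> R) : (forall x, 0 <= z x) -> 0 < dotp z z ->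
    (forall x, apply_op (fan_op R u') z x = r * z x) -> z (inr v1) < z u' -> False.
  move=> z0 zz eigz lt; have := H z; apply/negP; rewrite -ltNge.
  rewrite qform_fan_op; have -> : qform (@adj R (fan k)) z = r * dotp z z + z u' ^+ 2.
    apply/eqP; rewrite -subr_eq -qform_fan_op; apply/eqP.
    rewrite /qform (eq_dotp (frefl z) eigz) /dotp mulr_sumr.
    by apply: eq_bigr => x _; rewrite mulrCA.
  have h1 : rho * dotp z z <= r * dotp z z by rewrite ler_pM2r.
  have h2 : z (inr v1) ^+ 2 < z u' ^+ 2 by rewrite ltr_pXn2r ?nnegrE.
  by lra.
have fan0 z : rim z 0 = z (inr v1) :> R by rewrite -rimE v10.
have near_end (i : 'I_k) (z : fan k -> R) : (forall x, 0 <= z x) -> 0 < dotp z z ->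
    (forall x, apply_op (fan_op R (inr i)) z x = r * z x) -> (0 < i)%N -> (i + 3 <= k)%N -> False.
  move=> z0 zz eigz i0 ik; apply: (key (inr i) z) => //.
  have E := fan_eigen_rim eigz.
  have a0 := fan_hub_gt0 E r2 z0 zz.
  have := rim_end_lt E r5 a0 (rim_ge0 z0) (@rim_out _ _ z) i0 ik.
  by rewrite fan0 rimE.
case: u hu eig => [c|i] hu eig.
  have ec : inl c = hub k by rewrite /hub; congr inl; apply: val_inj; case: c {eig hu} => -[].
  rewrite ec in eig; apply: (key (hub k) y) => //.
  have E := fan_eigen_rim_hub eig.
  have a0 := fan_hub_gt0 E r2 y0 yy.
  have := rim_le E r2 (ltW a0) (rim_ge0 y0) (@rim_out _ _ y) 0%N.
  rewrite fan0; have := y0 (inr v1); move: (y (inr v1)) (y (hub k)) a0 => b a a0 b0 h.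
  by nra.
have /andP[i0 ik] := hu i erefl.
have [ik3|ik3] := leqP (i + 3) k; first exact: (near_end i y).
apply: (near_end (rev_ord i) (y \o fan_rev)).
- by move=> x; apply: y0.
- by rewrite -dotp_bij //; exact: fan_rev_bij.
- move=> x; rewrite -[x]fan_revK.
  rewrite -(apply_op_bij fan_rev_bij (a' := fan_op R (inr i))) /= ?fan_revK ?eig //.
  move=> x' y'; have -> : inr i = fan_rev (inr (rev_ord i)) by rewrite /= rev_ordK.
  exact: fan_op_rev.
- by rewrite /= subn_gt0; move: ik; clear; lia.
- by have := ltn_ord i; rewrite /=; move: ik ik3 k23; clear; lia.
Qed.
End FanEnds.

(** * Two linked fans *)
Section TwoFans.
Variables (R : realType) (k : nat) (v1 : 'I_k) (rho : R).
Hypotheses (k23 : (23 <= k)%N) (v10 : v1 = 0%N :> nat).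
Hypothesis rho_max : forall g, qform (fan_op R (inr v1)) g <= rho * dotp g g.

Definition fan_end (a : fan k) := a = inr v1 \/ a = fan_rev (inr v1).

Lemma fan_end_max a g : fan_end a -> qform (fan_op R a) g <= rho * dotp g g.
Proof.
case=> ->; first exact: rho_max.
rewrite (qform_bij (fan_rev_bij k) (a := fan_op R (inr v1))); last exact: fan_op_rev.
by rewrite (dotp_bij (fan_rev_bij k)).
Qed.

Lemma fan_not_end_lt a g : ~ fan_end a -> 0 < dotp g g -> qform (fan_op R a) g < rho * dotp g g.
Proof.
move=> na gg.
have [r [y [y0 yy eig ray]]] := perron (hub k) (@fan_op_sym R k a) (@fan_op_off R k a).
apply: le_lt_trans (ray g) _; rewrite ltr_pM2r //.
apply: (fan_op_not_end_lt k23 v10 rho_max _ y0 yy eig) => i ai.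
have i0 : i != v1 by apply/eqP => iv; apply: na; left; rewrite ai iv.
have i1 : i != rev_ord v1 by apply/eqP => iv; apply: na; right; rewrite ai iv.
move: i0 i1; rewrite -!val_eqE /= v10.
by have := ltn_ord i; clear; lia.
Qed.

(** As y(a) z(b) >= y(a)^2, the edge from [a] to [b] alone lowers the form of [y] at least as much
    as a weight -1 at [a]. So [y] reaches the quotient [rho] for [fan_op R a], which makes [a] an
    end; equality then leaves nothing for other linking edges. *)
Lemma linked_fan_end (y z : fan k -> R) (B : fan k -> fan k -> bool) (l : R) a b :
  (forall x, 0 < y x) -> (forall x, 0 < z x) -> rho <= l ->
  l * dotp y y = qform (@adj R (fan k)) y - \sum_x \sum_t (B x t)%:R * (y x * z t) ->
  B a b -> y a <= z b ->
  [/\ fan_end a, z b = y a & forall x t, B x t -> x = a /\ t = b].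
Proof.
move=> y0 z0 rl El Bab yz.
pose rest := \sum_(p : fan k * fan k | p != (a, b)) (B p.1 p.2)%:R * (y p.1 * z p.2).
have rest0 : 0 <= rest by apply: sumr_ge0 => p _; rewrite mulr_ge0 // mulr_ge0 // ltW.
have SE : \sum_x \sum_t (B x t)%:R * (y x * z t) = y a * z b + rest.
  by rewrite pair_bigA (bigD1 (a, b)) //= Bab mul1r.
have yy : 0 < dotp y y by apply: (dotp_gt0 (x := a)); rewrite gt_eqF.
have h1 : y a ^+ 2 <= y a * z b by rewrite expr2 ler_pM2l.
have h2 : rho * dotp y y <= l * dotp y y by rewrite ler_pM2r.
have Qa : qform (fan_op R a) y = qform (@adj R (fan k)) y - y a ^+ 2 by apply: qform_fan_op.
have ea : fan_end a.
  apply: contrapT => /fan_not_end_lt/(_ yy); rewrite Qa => h3.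
  by rewrite SE in El; lra.
have h3 := fan_end_max y ea; rewrite Qa in h3; rewrite SE in El.
have e1 : y a * z b = y a ^+ 2 by lra.
have e2 : rest = 0 by lra.
split => //.
  by apply: (mulfI (lt0r_neq0 (y0 a))); rewrite e1 expr2.
move=> x t Bxt; apply/pair_equal_spec/eqP/contraT => ne.
have := psumr_eq0P (F := fun p : fan k * fan k => (B p.1 p.2)%:R * (y p.1 * z p.2)) _ e2.
move=> /(_ _ (x, t) ne) /=; rewrite Bxt mul1r => h.
have : 0 < y x * z t by rewrite mulr_gt0.
by rewrite h ?ltxx // => p _; rewrite mulr_ge0 // mulr_ge0 // ltW.
Qed.

(** [linked_fan_end] applies on the side of the smaller weight and shows the weights at [a] and [b]
    to be equal, so it applies on the other side too. *)
Lemma linked_fans (y z : fan k -> R) (B : fan k -> fan k -> bool) (l : R) :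
  (forall x, 0 < y x) -> (forall x, 0 < z x) -> rho <= l ->
  l * dotp y y = qform (@adj R (fan k)) y - \sum_x \sum_t (B x t)%:R * (y x * z t) ->
  l * dotp z z = qform (@adj R (fan k)) z - \sum_x \sum_t (B x t)%:R * (y x * z t) ->
  (exists a b, B a b) ->
  exists a b, [/\ fan_end a, fan_end b & forall x t, B x t = (x == a) && (t == b)].
Proof.
move=> y0 z0 rl Ey Ez [a [b Bab]].
have Ez' : l * dotp z z = qform (@adj R (fan k)) z - \sum_x \sum_t (B t x)%:R * (z x * y t).
  rewrite Ez exchange_big /=; congr (_ - _); apply: eq_bigr => x _; apply: eq_bigr => t _.
  by rewrite (mulrC (y t)).
suff [ea eb u] : [/\ fan_end a, fan_end b & forall x t, B x t -> x = a /\ t = b].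
  exists a, b; split => // x t; apply/idP/andP => [/u[-> ->]//|[/eqP -> /eqP -> //]].
have le_of_eq (c d : R) : c = d -> c <= d by move=> ->.
have [h|/ltW h] := lerP (y a) (z b).
  have [ea e u] := linked_fan_end y0 z0 rl Ey Bab h.
  by have [eb _ _] := linked_fan_end (B := fun x t => B t x) z0 y0 rl Ez' Bab (le_of_eq _ _ e).
have [eb e u] := linked_fan_end (B := fun x t => B t x) z0 y0 rl Ez' Bab h.
have [ea _ _] := linked_fan_end y0 z0 rl Ey Bab (le_of_eq _ _ e).
by split => // x t /u[-> ->].
Qed.
End TwoFans.

(** * From an eigenvector with both signs to two linked fans *)

Section Embedding.
Variable G : sgraph.

Lemma fan_embedding (S : {set G}) (u : G) (s : seq G) k : #|S| = k.+1 -> fan_set S u s ->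
  exists phi : fan k -> G, [/\ injective phi, forall z, z \in S <-> exists a, phi a = z &
    forall a b, edge (phi a) (phi b) = edge a b].
Proof.
move=> Sk [uS [us es] sE uE].
have sk : size s = k.
  have : #|S :\ u| = k by move: Sk; rewrite (cardsD1 u) uS => -[].
  by move=> <-; rewrite -(card_uniqP us); apply: eq_card => z; rewrite -sE.
pose phi (x : fan k) := match x with inl _ => u | inr i => nth u s i end.
have ins (i : 'I_k) : nth u s i \in S :\ u by rewrite -sE mem_nth // sk.
exists phi; split.
- case=> [a|i] [b|j] //=.
  + by move=> _; rewrite !ord1.
  + by move=> e; have := ins j; rewrite -e in_setD1 eqxx.
  + by move=> e; have := ins i; rewrite e in_setD1 eqxx.
  + by move=> /eqP; rewrite nth_uniq ?sk // => /eqP/val_inj ->.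
- move=> z; split => [zS|[[a|i] <-]] //=; last by have := ins i; rewrite in_setD1 => /andP[].
  have [->|zu] := eqVneq z u; first by exists (inl ord0).
  have zs : z \in s by rewrite sE in_setD1 zu.
  have zk : (index z s < k)%N by rewrite -sk index_mem.
  by exists (inr (Ordinal zk)); rewrite /= nth_index.
- case=> [a|i] [b|j] /=.
  + by rewrite edge_irrefl /complete_rel !ord1 eqxx.
  + by rewrite uE.
  + by rewrite edge_sym uE.
  + by rewrite es ?sk.
Qed.
End Embedding.

Section SignParts.
Variables (R : realType) (G : sgraph).

(** x^2 - 2x + 7/(2x) increases from 29/5 on, so the bound on [k] passes from [rho] to the largest
    eigenvalue of a sign part. *)
Lemma fan_bound_mono (k : nat) (r m : R) : 29 / 5 <= r -> r <= m ->
  k%:R <= r ^+ 2 - 2 * r + 7 / 2 / r -> k%:R <= m ^+ 2 - 2 * m + 7 / 2 / m.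
Proof.
move=> r5 rm h; apply: le_trans h _; rewrite -subr_ge0.
have r0 : 0 < r by lra.
have m0 : 0 < m by lra.
have -> : m ^+ 2 - 2 * m + 7 / 2 / m - (r ^+ 2 - 2 * r + 7 / 2 / r) =
   (m - r) * (m + r - 2 - 7 / 2 / (r * m)) by field; rewrite !gt_eqF.
apply: mulr_ge0; first by rewrite subr_ge0.
have h1 : 1 <= r * m by nra.
have : 7 / 2 / (r * m) <= 7 / 2 by rewrite ler_piMr // invf_le1 //; lra.
by move: (7 / 2 / (r * m)) => c hc; lra.
Qed.

(** The neighbours outside [X] have nonpositive entries, so the restriction of [x] to [X] has
    Rayleigh quotient at least [l]. A nonnegative top eigenvector of the adjacency inside [X] then
    feeds [fan_of_large_eigenvalue]. *)
Lemma positive_part_fan (k : nat) (r l : R) (x : G -> R) (X : {set G}) :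
  no_k4_subdivision G -> no_k23_subdivision G ->
  29 / 5 <= r -> k%:R <= r ^+ 2 - 2 * r + 7 / 2 / r -> r <= l ->
  (forall z, apply_op (@adj R G) x z = l * x z) ->
  (forall z, (z \in X) = (0 < x z)) -> (0 < #|X| <= k.+1)%N ->
  #|X| = k.+1 /\ exists u s, fan_set X u s.
Proof.
move=> noK4 noK23 r5 kr rl eig inX /andP[X0 Xk].
have [z0 z0X] := card_gt0P X0.
pose aX (p q : G) : R := [&& edge p q, p \in X & q \in X]%:R.
have symX p q : aX p q = aX q p by rewrite /aX edge_sym [X in _ && X]andbC.
have aX0 p q : p != q -> 0 <= aX p q by rewrite ler0n.
have [m [w [w0 ww weig ray]]] := perron z0 symX aX0.
pose xp z : R := if z \in X then x z else 0.
have xx : 0 < dotp xp xp.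
  by apply: (dotp_gt0 (x := z0)); rewrite /xp z0X gt_eqF // -inX.
have lm : l <= m.
  rewrite -(ler_pM2r xx); apply: le_trans (ray xp).
  rewrite /qform /dotp mulr_sumr; apply: ler_sum => z _.
  rewrite mulrCA /xp; case: ifP => zX; last by rewrite !mul0r.
  rewrite ler_pM2l -?inX // -eig; apply: ler_sum => y _.
  rewrite /aX /adj zX /=; case: ifP => yX; first by rewrite andbT.
  by rewrite mulr0 mulr_ge0_le0 ?ler0n // leNgt -inX yX.
have m5 : 29 / 5 <= m by lra.
apply: (@fan_of_large_eigenvalue R G X k m w) => //.
- by apply: fan_bound_mono kr => //; lra.
- move=> z zX; have : m * w z = 0.
    by rewrite -weig /apply_op big1 // => y _; rewrite /aX (negbTE zX) andbF mul0r.
  by move/eqP; rewrite mulf_eq0 => /orP[/eqP h|/eqP//]; lra.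
- apply: contrapT => h; move: ww; rewrite /dotp big1 ?ltxx // => z _.
  have -> : w z = 0 by apply/eqP/contraT => wz; case: h; exists z.
  by rewrite mul0r.
- move=> z zX; rewrite -weig [RHS]big_mkcond; apply: eq_bigr => y _.
  by rewrite /aX zX /=; case: ifP => yX; rewrite ?andbT ?andbF ?mul0r.
Qed.

Lemma eigen_positive (l : R) (f : G -> R) : connected_graph G ->
  (forall z, apply_op (@adj R G) f z = l * f z) ->
  (forall z, 0 <= f z) -> (exists z, f z != 0) -> forall z, 0 < f z.
Proof.
move=> [_ conn] eig f0 [z0 fz0] z.
have step p q : edge p q -> 0 < f p -> 0 < f q.
  move=> pq fp; rewrite lt_neqAle f0 andbT; apply/eqP => fq.
  have := eig q; rewrite -fq mulr0; apply/eqP; rewrite gt_eqF //.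
  rewrite /apply_op (bigD1 p) //= ltr_pwDl //.
    by rewrite /adj edge_sym pq mul1r.
  by apply: sumr_ge0 => y _; rewrite mulr_ge0 // ler0n.
have : 0 < f z0 by rewrite lt_neqAle eq_sym fz0 f0.
have /connectP[s ps ->] := conn z0 z.
elim: s z0 ps {fz0} => //= y s IHs z0 /andP[z0y ys] fz0.
by apply: IHs ys _; apply: step fz0.
Qed.

(** Connectedness makes an eigenvector of one sign nowhere zero, and two such vectors are not
    orthogonal; so one of the first two eigenvectors has both signs. Which one stays open, hence [l]
    in place of [rho2 R G]. *)
Lemma mixed_sign_eigenvector : connected_graph G -> (1 < #|G|)%N ->
  exists (l : R) (x : G -> R), [/\ rho2 R G <= l,
    forall z, apply_op (@adj R G) x z = l * x z, exists z, 0 < x z & exists z, x z < 0].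
Proof.
move=> conn G1; have [l [f [g [rl [ff gg] fg ef eg]]]] := rho2_eigenvectors R G1.
have nz (h : G -> R) : dotp h h = 1 -> exists z, h z != 0.
  move=> hh; apply: contrapT => H; have := oner_neq0 R; rewrite -hh /dotp big1 ?eqxx // => z _.
  have -> : h z = 0 by apply/eqP/contraT => hz; case: H; exists z.
  by rewrite mul0r.
have apN (m : R) (h : G -> R) : (forall z, apply_op (@adj R G) h z = m * h z) ->
    forall z, apply_op (@adj R G) (fun z => - h z) z = m * - h z.
  move=> H z; rewrite mulrN -H /apply_op -sumrN.
  by apply: eq_bigr => y _; rewrite mulrN.
have definite (m : R) (h : G -> R) : (forall z, apply_op (@adj R G) h z = m * h z) -> dotp h h = 1 ->
    [\/ (exists z, 0 < h z) /\ (exists z, h z < 0), forall z, 0 < h z | forall z, h z < 0].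
  move=> eh hh; have [p|np] := pselect (exists z, 0 < h z); have [n|nn] := pselect (exists z, h z < 0).
  - exact: Or31.
  - apply: Or32; apply: eigen_positive eh _ (nz h hh) => // z.
    by rewrite leNgt; apply/negP => hz; apply: nn; exists z.
  - apply: Or33 => z; rewrite -oppr_gt0; move: z; apply: (eigen_positive conn (apN _ _ eh)) => [z|].
      by rewrite oppr_ge0 leNgt; apply/negP => hz; apply: np; exists z.
    by have [z hz] := nz h hh; exists z; rewrite oppr_eq0.
  - have [z hz] := nz h hh; case: (ltgtP (h z) 0) => h0.
    + by case: nn; exists z.
    + by case: np; exists z.
    + by rewrite h0 eqxx in hz.
have [z0 _] := nz f ff.
have pos (h h' : G -> R) : (forall z, 0 < h z) -> (forall z, 0 < h' z) -> 0 < dotp h h'.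
  move=> p p'; rewrite /dotp (bigD1 z0) //= ltr_pwDl ?mulr_gt0 //.
  by apply: sumr_ge0 => z _; rewrite ltW // mulr_gt0.
have dotN (h h' : G -> R) : dotp (fun z => - h z) h' = - dotp h h'.
  by rewrite /dotp -sumrN; apply: eq_bigr => z _; rewrite mulNr.
case: (definite _ _ ef ff) => [[p n]|pf|nf]; first by exists l, f.
all: case: (definite _ _ eg gg) => [[p n]|pg|ng]; first by exists (rho2 R G), g; split.
- by have := pos _ _ pf pg; rewrite fg ltxx.
- have : 0 < dotp (fun z => - g z) f by apply: pos => // z; rewrite oppr_gt0.
  by rewrite dotN dotpC fg oppr0 ltxx.
- have : 0 < dotp (fun z => - f z) g by apply: pos => // z; rewrite oppr_gt0.
  by rewrite dotN fg oppr0 ltxx.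
- have : 0 < dotp (fun z => - g z) (fun z => - f z) by apply: pos => // z; rewrite oppr_gt0.
  by rewrite dotN dotpC dotN fg !oppr0 ltxx.
Qed.
End SignParts.

Section DoubleFan.
Variables (R : realType) (k : nat) (v1 : 'I_k).

Definition double_fan := @union_edge (fan k) (fan k) (fan_path v1) (fan_path v1).

Lemma sum_double_fan (F : double_fan -> R) :
  \sum_x F x = \sum_(x : fan k) F (inl x) + \sum_(x : fan k) F (inr x).
Proof. exact: big_sumType. Qed.

Lemma apply_double_fan (s : R) (y : fan k -> R) (x : fan k) :
  let g (z : double_fan) := match z with inl a => y a | inr a => s * y a end in
  apply_op (@adj R double_fan) g (inl x) =
    apply_op (@adj R (fan k)) y x + s * ((x == inr v1)%:R * y (inr v1)) /\
  apply_op (@adj R double_fan) g (inr x) =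
    s * apply_op (@adj R (fan k)) y x + (x == inr v1)%:R * y (inr v1).
Proof.
have D b : \sum_(t : fan k) ((x == inr v1) && (t == inr v1))%:R * (b * y t) =
    b * ((x == inr v1)%:R * y (inr v1)).
  rewrite (bigD1 (inr v1)) //= eqxx andbT big1 ?addr0; first by rewrite mulrCA.
  by move=> t /negbTE ->; rewrite andbF mul0r.
split; rewrite /apply_op sum_double_fan /adj /=.
  by congr (_ + _); exact: D.
rewrite addrC mulr_sumr; congr (_ + _).
  by apply: eq_bigr => t _; rewrite mulrCA.
rewrite -[RHS]mul1r -D; apply: eq_bigr => t _.
by rewrite mul1r andbC.
Qed.

(** With factor -1 on the second copy, [y] gives an eigenvector for [rho]; with factor 1 its
    Rayleigh quotient exceeds [rho], since the linking edge joins two vertices of nonzero value. So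
    [rho] is not the largest eigenvalue. *)
Lemma rho2_double_fan_ge (rho : R) (y : fan k -> R) : 0 < dotp y y -> y (inr v1) != 0 ->
  (forall x, apply_op (fan_op R (inr v1)) y x = rho * y x) -> rho <= rho2 R double_fan.
Proof.
move=> yy yv eig.
pose f s (z : double_fan) : R := match z with inl a => y a | inr a => s * y a end.
have E x : apply_op (@adj R (fan k)) y x = rho * y x + (x == inr v1)%:R * y (inr v1).
  by rewrite -eig apply_fan_op subrK.
have dE s : dotp (f s) (f s) = dotp y y + s ^+ 2 * dotp y y.
  rewrite /dotp sum_double_fan mulr_sumr; congr (_ + _).
  by apply: eq_bigr => x _ /=; ring.
apply: (@rho2_lower_bound _ _ _ (f (-1)) (f 1)).
- by rewrite dE; lra.
- case=> x; have [e1 e2] := apply_double_fan (-1) y x.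
    by rewrite [LHS]e1 E /=; ring.
  by rewrite [LHS]e2 E /=; ring.
have -> : qform (@adj R double_fan) (f 1) = rho * dotp (f 1) (f 1) + 4 * y (inr v1) ^+ 2.
  rewrite dE /qform /dotp sum_double_fan.
  under eq_bigr => x _ do rewrite (apply_double_fan 1 y x).1 E /=.
  under [X in _ + X = _]eq_bigr => x _ do rewrite (apply_double_fan 1 y x).2 E /=.
  have S : \sum_(x : fan k) y x * ((x == inr v1)%:R * y (inr v1)) = y (inr v1) ^+ 2.
    rewrite (bigD1 (inr v1)) //= eqxx mul1r big1 ?addr0 ?expr2 //.
    by move=> x /negbTE ->; rewrite mul0r mulr0.
  have S2 : \sum_(x : fan k) y x * (rho * y x) = rho * dotp y y.
    by rewrite /dotp mulr_sumr; apply: eq_bigr => x _; rewrite mulrCA.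
  rewrite (eq_bigr (fun x : fan k => y x * (rho * y x) + 2 * (y x * ((x == inr v1)%:R * y (inr v1))))); last first.
    by move=> x _; ring.
  rewrite [X in _ + X](eq_bigr (fun x : fan k => y x * (rho * y x) + 2 * (y x * ((x == inr v1)%:R * y (inr v1))))); last first.
    by move=> x _; ring.
  rewrite !big_split /= -!mulr_sumr S S2 -/(dotp y y); ring.
by rewrite ltrDl mulr_gt0 // exprn_even_gt0.
Qed.
End DoubleFan.

Lemma isomorphic_bij (G H : sgraph) (h : H -> G) : bijective h ->
  (forall x y, edge (h x) (h y) = edge x y) -> isomorphic G H.
Proof.
move=> bh eh; have [g hK gK] := bh; exists g; first by exists h.
by move=> x y; rewrite -eh !gK.
Qed.

Lemma exit_edge (G : sgraph) (P : pred G) (p q : G) : connect (@edge G) p q ->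
  P p -> ~~ P q -> exists a b, [/\ edge a b, P a & ~~ P b].
Proof.
move=> /connectP[s ps ->]; elim: s p ps => [|b s IHs] p /=; first by move=> _ ->.
move=> /andP[pb bs] Pp; have [Pb|nPb] := boolP (P b); first exact: IHs.
by exists p, b.
Qed.

Lemma fan_end_automorphism (k : nat) (v1 : 'I_k) (a : fan k) : fan_end v1 a ->
  exists s : fan k -> fan k,
    [/\ bijective s, s (inr v1) = a & forall x y, edge (s x) (s y) = edge x y].
Proof.
case=> ->; first by exists id; split => //; exists id.
exists (@fan_rev k); split; [exact: fan_rev_bij | by [] |].
case=> [x|x] [y|y] //=; rewrite /path_rel /=.
by have := ltn_ord x; have := ltn_ord y; clear; lia.
Qed.

Section Extremal.
Variables (R : realType) (G : sgraph) (k : nat) (v1 : 'I_k).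

Lemma isomorphic_double_fan (rho : R) (y : fan k -> R) :
  (23 <= k)%N -> v1 = 0%N :> nat ->
  (forall x, 0 <= y x) -> 0 < dotp y y ->
  (forall x, apply_op (fan_op R (inr v1)) y x = rho * y x) ->
  (forall g, qform (fan_op R (inr v1)) g <= rho * dotp g g) ->
  #|G| = (2 * k.+1)%N -> connected_graph G -> no_k4_subdivision G -> no_k23_subdivision G ->
  rho <= rho2 R G -> isomorphic G (double_fan v1).
Proof.
move=> k23 v10 y0 yy eigy ray nG conn noK4 noK23 rhoG.
have [rho5 krho] := fan_rho_bounds k23 v10 y0 yy eigy ray.
have [l [x [lG eig [p0 xp0] [q0 xq0]]]] := mixed_sign_eigenvector R conn (ltac:(rewrite nG; clear; lia)).
have rl : rho <= l by apply: le_trans lG.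
pose nx z := - x z.
have eigN z : apply_op (@adj R G) nx z = l * nx z.
  by rewrite /nx mulrN -eig /apply_op -sumrN; apply: eq_bigr => t _; rewrite mulrN.
pose P : {set G} := finset (fun z => 0 < x z).
pose Q : {set G} := finset (fun z => 0 < nx z).
have inP z : (z \in P) = (0 < x z) by rewrite finset.inE.
have inQ z : (z \in Q) = (0 < nx z) by rewrite finset.inE.
have PQ z : z \in P -> z \in Q -> False.
  by rewrite inP inQ /nx oppr_gt0 => h1 h2; have := lt_trans h1 h2; rewrite ltxx.
have cPQ : (#|P| + #|Q| <= 2 * k.+1)%N.
  rewrite -cardsUI [X in (_ + X)%N]eq_card0 ?addn0 -?nG ?max_card // => z.
  by rewrite finset.inE; apply/negP => /andP[/PQ h /h].
have P0 : (0 < #|P|)%N by apply/card_gt0P; exists p0; rewrite inP.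
have Q0 : (0 < #|Q|)%N by apply/card_gt0P; exists q0; rewrite inQ oppr_gt0.
have HP := positive_part_fan noK4 noK23 rho5 krho rl eig inP.
have HQ := positive_part_fan noK4 noK23 rho5 krho rl eigN inQ.
rewrite P0 /= in HP; rewrite Q0 /= in HQ.
(* If [Q] has at most k + 1 vertices, it has exactly that many, which bounds [P]; otherwise [P] has
   fewer. *)
have Pk : (#|P| <= k.+1)%N.
  have [h|h] := leqP #|Q| k.+1; first by move: (HQ h).1 cPQ; clear; lia.
  by move: h cPQ; clear; lia.
have [cP [u [s fP]]] := HP Pk.
have [|cQ [u' [s' fQ]]] := HQ; first by move: cPQ; rewrite cP; clear; lia.
have [phi [phi_inj phiP phiE]] := fan_embedding cP fP.
have [psi [psi_inj psiQ psiE]] := fan_embedding cQ fQ.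
have phi_in a : phi a \in P by apply/phiP; exists a.
have psi_in b : psi b \in Q by apply/psiQ; exists b.
pose h (c : fan k + fan k) := match c with inl a => phi a | inr b => psi b end.
have h_inj : injective h.
  move=> [a|a] [b|b] /= e.
  - by rewrite (phi_inj _ _ e).
  - by case: (PQ (phi a)); rewrite ?phi_in // e psi_in.
  - by case: (PQ (phi b)); rewrite ?phi_in // -e psi_in.
  - by rewrite (psi_inj _ _ e).
have cfan : #|fan k| = k.+1 by rewrite card_sum !card_ord.
have bh : bijective h.
  by apply: inj_card_bij h_inj _; rewrite nG card_sum cfan; clear; lia.
have sumG (F : G -> R) : \sum_z F z = \sum_a F (phi a) + \sum_b F (psi b).
  by rewrite (reindex h) ?big_sumType //; exact: onW_bij.
pose B a b := edge (phi a) (psi b).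
pose y1 a := x (phi a); pose z1 b := nx (psi b).
have y1_gt0 a : 0 < y1 a by rewrite /y1 -inP.
have z1_gt0 b : 0 < z1 b by rewrite /z1 -inQ.
(* The eigenvalue equation paired with the positive part of [x]; the entries across are negative,
   hence the minus sign before the linking edges. *)
have Ey : l * dotp y1 y1 = qform (@adj R (fan k)) y1 - \sum_a \sum_b (B a b)%:R * (y1 a * z1 b).
  rewrite /qform /dotp mulr_sumr -sumrB; apply: eq_bigr => a _.
  rewrite mulrCA {2}/y1 -eig {1}/apply_op sumG mulrDr; congr (_ * _ + _).
    by apply: eq_bigr => t _; rewrite /adj phiE.
  rewrite mulr_sumr -sumrN; apply: eq_bigr => b _.
  by rewrite /z1 /nx /adj /B; ring.
have Ez : l * dotp z1 z1 = qform (@adj R (fan k)) z1 - \sum_a \sum_b (B a b)%:R * (y1 a * z1 b).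
  rewrite exchange_big /qform /dotp mulr_sumr -sumrB; apply: eq_bigr => b _ /=.
  rewrite mulrCA {2}/z1 -eigN {1}/apply_op sumG mulrDr addrC; congr (_ * _ + _).
    by apply: eq_bigr => t _; rewrite /adj psiE.
  rewrite mulr_sumr -sumrN; apply: eq_bigr => a _.
  by rewrite /y1 /z1 /nx /adj /B edge_sym; ring.
have link : exists a b, B a b.
  have [||a [b [ab Pa nPb]]] := @exit_edge G (mem P) p0 q0 (conn.2 p0 q0); rewrite /= ?inP //.
    by rewrite -leNgt ltW.
  have [a' ea] := (phiP a).1 Pa; have [g hK gK] := bh.
  case e: (g b) => [c|c]; have := gK b; rewrite e /= => eb.
    by move: nPb; rewrite -eb /= phi_in.
  by exists a', c; rewrite /B ea eb.
have [a [b [ea eb EB]]] := linked_fans k23 v10 ray y1_gt0 z1_gt0 rl Ey Ez link.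
(* An automorphism of each fan carries [v1] to the end that the linking edge uses. *)
have [sa [bsa sa1 Esa]] := fan_end_automorphism ea.
have [sb [bsb sb1 Esb]] := fan_end_automorphism eb.
pose hh (c : double_fan v1) : G := match c with inl c => phi (sa c) | inr c => psi (sb c) end.
have hh_inj : injective hh.
  move=> [c|c] [d|d] /= e.
  - by rewrite (bij_inj bsa (phi_inj _ _ e)).
  - by have := h_inj (inl (sa c)) (inr (sb d)) e.
  - by have := h_inj (inr (sb c)) (inl (sa d)) e.
  - by rewrite (bij_inj bsb (psi_inj _ _ e)).
apply: (@isomorphic_bij _ _ hh).
  by apply: inj_card_bij hh_inj _; rewrite nG card_sum cfan; clear; lia.
have cross c d : edge (phi (sa c)) (psi (sb d)) = (c == inr v1) && (d == inr v1).
  by rewrite -/(B _ _) EB -sa1 -sb1 (inj_eq (bij_inj bsa)) (inj_eq (bij_inj bsb)).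
case=> [c|c] [d|d] /=.
- by rewrite phiE Esa.
- exact: cross.
- by rewrite edge_sym cross.
- by rewrite psiE Esb.
Qed.
End Extremal.

Theorem theorem5p10 (R : realType) (G : sgraph) (n : nat)
    (G_order : #|G| = n) (G_conn : connected_graph G)
    (G_outer : outerplanar R G) (n_ge48 : (48 <= n)%N) (n_even : ~~ odd n)
    (v1 : 'I_((n - 2) %/ 2)) (v1_first : v1 = 0%N :> nat) :
  let H := @union_edge (fan ((n - 2) %/ 2)) (fan ((n - 2) %/ 2))
             (fan_path v1) (fan_path v1) in
  rho2 R G <= rho2 R H /\ (rho2 R G = rho2 R H <-> isomorphic G H).
Proof.
move=> H.
have nk : n = (2 * ((n - 2) %/ 2).+1)%N.
  have := odd_double_half n; rewrite (negbTE n_even) -divn2 -muln2.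
  by move: n_ge48; clear; lia.
have k23 : (23 <= (n - 2) %/ 2)%N by move: n_ge48; clear; lia.
have [rho [y [y0 yy eig ray]]] :=
  perron (hub _) (@fan_op_sym R _ (inr v1)) (@fan_op_off R _ (inr v1)).
(* If the end value were 0, its equation would equate 0 with the sum of the positive hub value and a
   nonnegative neighbour. *)
have yv : y (inr v1) != 0.
  have r5 := fan_rho_ge k23 ray; have r2 : 2 < rho by lra.
  have E := fan_eigen_rim eig; have a0 := fan_hub_gt0 E r2 y0 yy.
  have := E 0%N (leq_trans (isT : 0 < 23)%N k23).
  rewrite v1_first eqxx mul1r addr0 -[y (inr v1)]rimE v1_first => e.
  apply/eqP => y00; have := rim_ge0 y0 1%N; rewrite y00 in e.
  by move=> h; move: e; rewrite mulr0 subr0; lra.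
have rhoH : rho <= rho2 R H by apply: rho2_double_fan_ge yy yv eig.
have noK4 : no_k4_subdivision G by move=> b s; apply: outerplanar_no_k4 G_outer.
have noK23 : no_k23_subdivision G by move=> u z a b c s; apply: outerplanar_no_k23 G_outer.
(* This settles the equality case and, since isomorphic graphs have equal [rho2], also refutes a
   strict inequality in the wrong direction. *)
have max : rho2 R H <= rho2 R G -> isomorphic G H.
  move=> HG; apply: (isomorphic_double_fan k23 v1_first y0 yy eig ray) => //.
    by rewrite G_order.
  exact: le_trans HG.
split; last by split=> [e|]; [apply: max; rewrite e | exact: rho2_isomorphic].
by rewrite leNgt; apply/negP => lt; have := rho2_isomorphic R (max (ltW lt)) => e; rewrite e ltxx in lt.
Qed.
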